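(* Let $V>0$ and $\Omega=\{(x_1,x_2,x_3)\in\mathbb{R}^3: -1\le x_3\le 1\}$. Let $(u,p)$ be a smooth local-in-time solution of the initial value problem for the incompressible Navier–Stokes equations with unit density and viscosity $\gamma>0$ in $\Omega$, with boundary conditions $u_1=\pm V$, $u_2=u_3=0$ at $x_3=\pm1$, whose initial data satisfy $\operatorname{div}u=0$, these boundary conditions and $p>0$, with $\gamma$ sufficiently small (large Reynolds number) that the matrix $\widehat R$ of the context is initially positive definite, hence positive definite locally in time. Let $y_g$ be the geometric image of this flow, locally in space-time, say for $x\in\Omega_1\subset\Omega$, $0\le t<T$: that is, $y_g$ is a $C^\infty$ isometric embedding into $\mathbb{R}^6$, $\partial_iy_g\cdot\partial_jy_g=g_{ij}$, of a $t$-dependent metric $g$ with $\mathrm{Riem}(g)=\widehat R$ and $g_{ij}=\delta_{ij}$ at the base point. Let $g^*$ be the metric $$g^*_{11}=g^*_{22}=B^2,\quad g^*_{33}=B^2+(f')^2,\quad g^*_{12}=g^*_{13}=g^*_{23}=0,\qquad f'(x_3)=B\arctan\!\Big(-\frac{BV^2}{3}x_3^3\Big),$$ which is Riemann flat, with $B>0$ sufficiently large that $g\le g^*$ in the sense of quadratic forms. Then: (1) $y_g$ can be approximated in $C^0$, locally in space-time, by embeddings $y_w$ into $\mathbb{R}^6$ with $y_w\in C^1(\Omega_1)$ for each $t\in(0,T)$, $y_w\in L^\infty((0,T);C^1_{\rm loc}(\Omega_1))$, and $\partial_iy_w\cdot\partial_jy_w=g^*_{ij}$. Furthermore, the energy $$E(t)=\int_{\Omega_1}\partial_iy_w\cdot\partial_iy_w\,dx=\int_{\Omega_1}\mathrm{tr}(g^*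 )\,dx$$ is constant in $t$, and $y_w$ is continuous in $t$ taking values in $C^1_{\rm loc}$. (2) For fixed initial data $y_0=y_w(\cdot,0)$, the value at $t=0$ of such an embedding $y_w$, there are infinitely many solutions to the initial value problem for the evolution equations $\partial_iy\cdot\partial_jy=g^*_{ij}$, $y(\cdot,0)=y_0$, where a solution satisfies $y(\cdot,t)\in C^1(\Omega_1)$ for each $t\in(0,T)$ and $y\in L^\infty((0,T);C^1_{\rm loc}(\Omega_1))$.
   Context: Summation over repeated indices is used; $\partial_i=\partial/\partial x_i$, $i,j=1,2,3$. The incompressible Navier–Stokes equations with unit density are $\partial_tu_i+\partial_j(u_iu_j-T_{ij})=0$, $\operatorname{div}u=0$, with $T_{ij}=-p\,\delta_{ij}+2\gamma D_{ij}$, $D_{ij}=\frac12(\partial_iu_j+\partial_ju_i)$; hence $\Delta p=-\operatorname{div}\operatorname{div}(u\otimes u)$. In the dimensionless variables used, $\gamma$ is the inverse Reynolds number. Christoffel symbols: $\Gamma_{ij}^k=\frac12 g^{kl}(\partial_ig_{jl}+\partial_jg_{il}-\partial_lg_{ij})$; $\mathrm{Riem}(g)$ is the covariant curvature tensor $R_{ijkl}=g_{iq}(\partial_k\Gamma_{lj}^q-\partial_l\Gamma_{kj}^q+\Gamma_{kp}^q\Gamma_{lj}^p-\Gamma_{lp}^q\Gamma_{kj}^p)$, with $t$ a parameter. The tensor $\widehat R$ has the algebraic symmetries of a curvature tensor (skew-symmetries, interchange symmetry, first Bianchi identity) and $$\widehat R_{2323}=u_1^2-T_{11},\ \widehat R_{1313}=u_2^2-T_{22},\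 \widehat R_{1212}=u_3^2-T_{33},\ \widehat R_{3123}=u_1u_2-T_{12},\ \widehat R_{1223}=u_1u_3-T_{13},\ \widehat R_{3112}=u_2u_3-T_{23};$$ as a matrix, $$\widehat R=\begin{bmatrix}\widehat R_{1212}&\widehat R_{1223}&-\widehat R_{3112}\\ \widehat R_{1223}&\widehat R_{2323}&-\widehat R_{3123}\\ -\widehat R_{3112}&-\widehat R_{3123}&\widehat R_{1313}\end{bmatrix}.$$ The metric $g^*$ is the one induced by the embedding $(Bx_3,\,f(x_3),\,Bx_2,\,Bx_1,\,0,\,0)$ into $\mathbb{R}^6$ associated with the laminar Couette flow $u_1=Vx_3$, $u_2=u_3=0$, $p=0$. The embedding $y_g$ is short relative to $g^*$, meaning $g\le g^*$ as quadratic forms. ''Approximated in $C^0$'' means: for every $\varepsilon>0$ such a $y_w$ can be chosen with $\|y_g-y_w\|_{C^0}\le\varepsilon$. *)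

(* Defs.v *)
From HB Require Import structures.
From mathcomp Require Import all_boot all_order all_algebra.
From mathcomp Require Import all_classical all_reals all_analysis.

Set Implicit Arguments.
Unset Strict Implicit.
Unset Printing Implicit Defensive.

Import Order.TTheory GRing.Theory Num.Theory.
Import numFieldNormedType.Exports.

Local Open Scope classical_set_scope.
Local Open Scope ring_scope.

(* Time-dependent fields are curried, f : R -> 'rV[R]_3 -> _, so that f t is
   the field at time t. The coordinates x_1, x_2, x_3 are x 0 i1, x 0 i2,
   x 0 i3. *)
Definition i1 : 'I_3 := Ordinal (isT : (0 < 3)%N).
Definition i2 : 'I_3 := Ordinal (isT : (1 < 3)%N).
Definition i3 : 'I_3 := Ordinal (isT : (2 < 3)%N).

Section Differentiability.
Context {R : realType}.

Definition partial {W : normedModType R} (i : 'I_3) (f : 'rV[R]_3 -> W)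
  : 'rV[R]_3 -> W := 'D_(delta_mx 0 i) f.

Definition iter_derive {V W : normedModType R} (vs : seq V) (f : V -> W)
  : V -> W := foldr (fun v h => 'D_v h) f vs.

(* C^infty on a set A that need not be open: C^infty on an open neighbourhood
   of A. For functions that are smooth up to the boundary of A this amounts to
   choosing an extension, and no boundary derivative used below depends on
   that choice. *)
Definition smooth_on {V W : normedModType R} (A : set V) (f : V -> W) : Prop :=
  exists O : set V, [/\ open O, A `<=` O &
    forall (vs : seq V) (z : V), O z -> differentiable (iter_derive vs f) z].

Definition C1_on {n : nat} (Om : set 'rV[R]_3) (f : 'rV[R]_3 -> 'rV[R]_n)
  : Prop :=
  forall x, Om x -> differentiable f x /\
    forall i : 'I_3, {for x, continuous (partial i f)}.

(* f is at distance at most M from 0 in C^1(K). *)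
Definition C1_le {n : nat} (K : set 'rV[R]_3) (f : 'rV[R]_3 -> 'rV[R]_n) (M : R)
  : Prop :=
  forall x, K x -> `|f x| <= M /\ forall i : 'I_3, `|partial i f x| <= M.

(* An immersion that is a homeomorphism onto its image. *)
Definition embedding_on {n : nat} (Om : set 'rV[R]_3)
    (f : 'rV[R]_3 -> 'rV[R]_n) : Prop :=
  [/\ forall x, Om x -> differentiable f x,
      forall x, Om x -> row_free ('J f x) &
      exists2 h : 'rV[R]_n -> 'rV[R]_3,
        forall x, Om x -> h (f x) = x & {within f @` Om, continuous h}].

End Differentiability.

Section NavierStokes.
Context {R : realType}.
Implicit Types (u : 'rV[R]_3 -> 'rV[R]_3) (p : 'rV[R]_3 -> R) (x : 'rV[R]_3).

Definition strain u (i j : 'I_3) x : R :=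
  2^-1 * (partial i (fun y => u y 0 j) x + partial j (fun y => u y 0 i) x).

Definition stress (gamma : R) u p (i j : 'I_3) x : R :=
  - (p x *+ (i == j)) + 2 * gamma * strain u i j x.

(* u_i u_j - T_ij *)
Definition momentum_flux (gamma : R) u p (i j : 'I_3) x : R :=
  u x 0 i * u x 0 j - stress gamma u p i j x.

Definition slab : set 'rV[R]_3 := [set x | -1 <= x 0 i3 <= 1].

(* (u, p) is a smooth solution on [0, Ts) x slab, with the wall conditions
   u_1 = V at x_3 = 1 and u_1 = -V at x_3 = -1. *)
Record ns_solution (V gamma Ts : R) (u : R -> 'rV[R]_3 -> 'rV[R]_3)
    (p : R -> 'rV[R]_3 -> R) : Prop := NSSolution {
  ns_smooth_u : smooth_on (`[0, Ts[ `*` slab)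
    (fun z : R * 'rV[R]_3 => u z.1 z.2);
  ns_smooth_p : smooth_on (`[0, Ts[ `*` slab)
    (fun z : R * 'rV[R]_3 => p z.1 z.2 : R^o);
  ns_momentum : forall t x (i : 'I_3), 0 <= t < Ts -> slab x ->
    derive1 (fun s => u s x 0 i) t
      + \sum_(j < 3) partial j (momentum_flux gamma (u t) (p t) i j) x = 0;
  ns_div_free : forall t x, 0 <= t < Ts -> slab x ->
    \sum_(i < 3) partial i (fun y => u t y 0 i) x = 0;
  ns_wall : forall t x, 0 <= t < Ts -> x 0 i3 = 1 \/ x 0 i3 = -1 ->
    [/\ u t x 0 i1 = V * x 0 i3, u t x 0 i2 = 0 & u t x 0 i3 = 0]
}.

End NavierStokes.

Section Curvature.
Context {R : realType}.

Definition tensor4 : Type := 'I_3 -> 'I_3 -> 'I_3 -> 'I_3 -> R.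

Definition curvature_symmetries (Q : tensor4) : Prop :=
  [/\ forall i j k l, Q i j k l = - Q j i k l,
      forall i j k l, Q i j k l = - Q i j l k,
      forall i j k l, Q i j k l = Q k l i j &
      forall i j k l, Q i j k l + Q i k l j + Q i l j k = 0].

(* The relations that determine the tensor \hat R at the point x. *)
Definition is_Rhat (gamma : R) (u : 'rV[R]_3 -> 'rV[R]_3) (p : 'rV[R]_3 -> R)
    (x : 'rV[R]_3) (Q : tensor4) : Prop :=
  let M i j := momentum_flux gamma u p i j x in
  curvature_symmetries Q /\
  [/\ Q i2 i3 i2 i3 = M i1 i1, Q i1 i3 i1 i3 = M i2 i2
    & Q i1 i2 i1 i2 = M i3 i3] /\
  [/\ Q i3 i1 i2 i3 = M i1 i2, Q i1 i2 i2 i3 = M i1 i3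
    & Q i3 i1 i1 i2 = M i2 i3].

Definition Rhat_mx (Q : tensor4) : 'M[R]_3 :=
  \matrix_(a, b) nth 0 (nth [::]
    [:: [:: Q i1 i2 i1 i2; Q i1 i2 i2 i3; - Q i3 i1 i1 i2];
        [:: Q i1 i2 i2 i3; Q i2 i3 i2 i3; - Q i3 i1 i2 i3];
        [:: - Q i3 i1 i1 i2; - Q i3 i1 i2 i3; Q i1 i3 i1 i3]] a) b.

Definition quad_form (A : 'M[R]_3) (v : 'rV[R]_3) : R := (v *m A *m v^T) 0 0.

Definition posdef (A : 'M[R]_3) : Prop :=
  A^T = A /\ forall v : 'rV[R]_3, v != 0 -> 0 < quad_form A v.

Definition le_form (A B : 'M[R]_3) : Prop :=
  forall v : 'rV[R]_3, quad_form A v <= quad_form B v.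

Implicit Types (g : 'rV[R]_3 -> 'M[R]_3) (x : 'rV[R]_3).

(* Gamma_ij^k *)
Definition christoffel g (k i j : 'I_3) x : R :=
  2^-1 * \sum_(l < 3) invmx (g x) k l *
    (partial i (fun y => g y j l) x + partial j (fun y => g y i l) x
     - partial l (fun y => g y i j) x).

Definition Riem g x : tensor4 := fun i j k l =>
  \sum_(q < 3) g x i q *
    (partial k (christoffel g q l j) x - partial l (christoffel g q k j) x
     + \sum_(r < 3) (christoffel g q k r x * christoffel g r l j x
                     - christoffel g q l r x * christoffel g r k j x)).

Definition isometric_at (f : 'rV[R]_3 -> 'rV[R]_6) g x : Prop :=
  forall i j : 'I_3, \sum_(k < 6) partial i f x 0 k * partial j f x 0 k
                     = g x i j.

Definition couette_df (V B s : R) : R := B * atan (- (B * V ^+ 2 / 3 * s ^+ 3)).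

Definition gstar (V B : R) x : 'M[R]_3 :=
  \matrix_(i, j) if i != j then 0
    else if i == i3 then B ^+ 2 + couette_df V B (x 0 i3) ^+ 2 else B ^+ 2.

(* The geometric image on [0, T0) x Om0 of the flow with tensor Rh, with base
   point x0. *)
Record geometric_image (Rh : R -> 'rV[R]_3 -> tensor4) (Om0 : set 'rV[R]_3)
    (T0 : R) (x0 : 'rV[R]_3) (g : R -> 'rV[R]_3 -> 'M[R]_3)
    (yg : R -> 'rV[R]_3 -> 'rV[R]_6) : Prop := GeometricImage {
  gi_metric : forall t x, 0 <= t < T0 -> Om0 x -> posdef (g t x);
  gi_curvature : forall t x i j k l, 0 <= t < T0 -> Om0 x ->
    Riem (g t) x i j k l = Rh t x i j k l;
  gi_base : forall t, 0 <= t < T0 -> g t x0 = 1%:M;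
  gi_smooth : smooth_on (`[0, T0[ `*` Om0)
    (fun z : R * 'rV[R]_3 => yg z.1 z.2);
  gi_embedding : forall t, 0 <= t < T0 -> embedding_on Om0 (yg t);
  gi_isometric : forall t x, 0 <= t < T0 -> Om0 x ->
    isometric_at (yg t) (g t) x
}.

End Curvature.

Section Evolution.
Context {R : realType}.
Implicit Types (Om : set 'rV[R]_3) (y : R -> 'rV[R]_3 -> 'rV[R]_6)
  (gs : 'rV[R]_3 -> 'M[R]_3).

Definition C1_simple Om y : Prop :=
  exists (m : nat) (A : 'I_m -> set (measurableTypeR R))
         (c : 'I_m -> 'rV[R]_3 -> 'rV[R]_6),
    [/\ forall i, measurable (A i), forall i, C1_on Om (c i) &
        forall t x, y t x = \sum_(i < m) (\1_(A i) t : R) *: c i x].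

(* y in L^infty((0, T); C^1_loc(Om)): for every compact K in Om, the map
   t |-> y t in C^1(K) is strongly (Bochner) measurable and essentially
   bounded on (0, T). *)
Definition Linfty_C1loc Om (T : R) y : Prop :=
  forall K : set 'rV[R]_3, compact K -> K `<=` Om ->
    (exists s : nat -> R -> 'rV[R]_3 -> 'rV[R]_6,
      (forall n, C1_simple Om (s n)) /\
      {ae @lebesgue_measure R, forall t, 0 < t < T -> forall e : R, 0 < e ->
         \forall n \near \oo, C1_le K (s n t \- y t) e}) /\
    (exists M : R, {ae @lebesgue_measure R, forall t, 0 < t < T ->
         C1_le K (y t) M}).

Definition continuous_C1loc Om (T : R) y : Prop :=
  forall K : set 'rV[R]_3, compact K -> K `<=` Om ->
  forall t0 : R, 0 <= t0 < T -> forall e : R, 0 < e ->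
    \forall t \near within `[0, T[ (nbhs t0), C1_le K (y t \- y t0) e.

(* The embeddings y_w on [0, T) x Om, with induced metric gs. *)
Definition wrinkled Om (T : R) gs y : Prop :=
  [/\ forall t, 0 <= t < T ->
        [/\ C1_on Om (y t), embedding_on Om (y t) &
            forall x, Om x -> isometric_at (y t) gs x],
      Linfty_C1loc Om T y &
      continuous_C1loc Om T y].

(* As in the evolution problem itself, nothing links y t to y 0 as t -> 0. *)
Definition ivp_solution Om (T : R) gs (y0 : 'rV[R]_3 -> 'rV[R]_6) y : Prop :=
  [/\ forall t, 0 < t < T ->
        C1_on Om (y t) /\ forall x, Om x -> isometric_at (y t) gs x,
      Linfty_C1loc Om T y &
      forall x, Om x -> y 0 x = y0 x].

(* Solutions are to be counted by their values on [0, T) x Om only. *)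
Definition restrict_domain Om (T : R) y : R * 'rV[R]_3 -> 'rV[R]_6 :=
  (fun z => y z.1 z.2) \_ (`[0, T[ `*` Om).

Definition lebesgue3 :=
  ((@lebesgue_measure R \x @lebesgue_measure R) \x @lebesgue_measure R)%E.

Definition vec3 (a : R * R * R) : 'rV[R]_3 :=
  \row_(i < 3) nth 0 [:: a.1.1; a.1.2; a.2] i.

Definition integral3 Om (F : 'rV[R]_3 -> R) : \bar R :=
  (\int[lebesgue3]_(a in vec3 @^-1` Om) (F (vec3 a))%:E)%E.

Definition energy Om y (t : R) : \bar R :=
  integral3 Om (fun x => \sum_(i < 3) \sum_(k < 6) partial i (y t) x 0 k ^+ 2).

End Evolution.

(* Main.v *)
Require Import Defs.
From HB Require Import structures.
From mathcomp Require Import all_boot all_order all_algebra.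
From mathcomp Require Import all_classical all_reals all_analysis.
From mathcomp Require Import measurable_realfun ring lra.

Set Implicit Arguments.
Unset Strict Implicit.
Unset Printing Implicit Defensive.

Import Order.TTheory GRing.Theory Num.Theory.
Import numFieldNormedType.Exports.

Local Open Scope classical_set_scope.
Local Open Scope ring_scope.

(* The embeddings y_w come from the Nash-Kuiper scheme, run on the compact set
   [0, T] x closure Om1 with t as a parameter. After a slight contraction the
   map y_g is strictly short, and its metric defect is a finite sum of terms
   r_k(t, x) l_k (x) l_k with constant covectors l_k and r_k > 0. As the
   codimension is 3, a corrugation
     y + lam^-1 (cos (lam l_k . x) p + sin (lam l_k . x) q)
   with p and q normal to y adds a multiple of l_k (x) l_k to the metric up to
   an error of order 1 / lam, while displacing y by O(1 / lam) only. Iterating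
   makes the defect decay geometrically, so that the maps converge in C^1,
   uniformly in t, to an isometric immersion that is continuous in t; it stays
   injective because each corrugation is taken fine enough to preserve a
   quantitative separation of points.
   The metric gstar depends on x_3 only and is diagonal with only its 33 entry
   variable, hence flat. The energy is an integral of tr gstar by isometry.
   Infinitely many solutions arise because an L^infty solution may jump by a
   translation at t = 0. *)

(** * Smooth functions *)

(** The obstacle is the normal frame: a circular corrugation needs two orthonormal normal fields
    that are smooth on the whole compact set, and none are at hand. Projections of two coordinate
    vectors are smooth everywhere but may be short or nearly parallel, so that one corrugation
    removes a fraction of a coefficient that depends on the point and may vanish. Some pair is good
    at each point, and a small amplitude factor [kappa] keeps it good while all pairs are run
    through. The price is a contraction factor [theta] close to 1, which still makes the square
    roots of the defects summable. The error of each corrugation is re-expanded in the same fixed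
    family l_k (x) l_k, so that the metric identity stays exact and nothing is decomposed anew. A
    corrugation is small in C^0 but not in C^1, so that injectivity does not survive for free. It
    does because a normal vector is orthogonal to a chord up to second order, which protects a lower
    bound of |y(x') - y(x)|^2 by a multiple of |x' - x|^2. *)

Section LittleO.
Context {R : realType} {V W : normedModType R}.

Lemma is_diff_eps (f : V -> W) (d : {linear V -> W}) (x : V) :
  continuous d ->
  (forall e : R, 0 < e -> \forall h \near (0:V), `|f (h + x) - f x - d h| <= e * `|h|) ->
  is_diff x f d.
Proof.
move=> dc H.
have E : f \o shift x = cst (f x) + d +o_ (0 : V) id.
  apply/eqaddoP => e e0; have := H _ e0; apply: filterS => h.
  by rewrite /= !fctE /= opprD addrA.
have dE := diff_unique dc E.
apply: DiffDef => //; apply/diff_locallyP; rewrite dE; split => //.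
Qed.

Lemma diff_eps (f : V -> W) (x : V) : differentiable f x ->
  forall e : R, 0 < e ->
  \forall h \near (0:V), `|f (h + x) - f x - 'd f x h| <= e * `|h|.
Proof.
move=> /diff_locallyP [_ /eqaddoP H] e e0.
have := H _ e0; apply: filterS => h.
by rewrite /= !fctE /= opprD addrA.
Qed.

Lemma near_shift0 (x : V) (P : set V) : nbhs x P ->
  \forall h \near (0:V), P (h + x).
Proof.
by move=> /nbhs0P; apply: filterS => h; rewrite addrC.
Qed.

Lemma near_eq_is_diff (f g : V -> W) x : (\near x, f x = g x) ->
  differentiable f x -> is_diff x g ('d f x).
Proof.
move=> fg df; apply: is_diff_eps; first exact: diff_continuous.
move=> e e0; have fgx : f x = g x by exact: nbhs_singleton fg.
apply: filterS2 (diff_eps df e0) (near_shift0 fg) => h.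
by rewrite fgx => + <-.
Qed.

End LittleO.

Section SmoothFunctions.
Context {R : realType} {V : normedModType R}.
Implicit Types (O : set V) (f g : V -> R) (z v : V).

(** All directional derivatives are carried along, and differentiability is demanded at each order,
    so that the sum, product and chain rules apply at every level and closure properties follow by
    induction on the order. *)
Fixpoint Ck (k : nat) O f : Prop :=
  (forall z, O z -> differentiable f z) /\
  (if k is k'.+1 then forall v, Ck k' O ('D_v f) else True).

Definition smooth O f := forall k, Ck k O f.

Lemma Ck_diff k O f z : Ck k O f -> O z -> differentiable f z.
Proof. by case: k => [|k] [+ _]; apply. Qed.

Lemma Ck_sub k O O' f : O' `<=` O -> Ck k O f -> Ck k O' f.
Proof.
move=> OO'; elim: k f => [|k IH] f /= [df dk]; split => //.
- by move=> z /OO'/df.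
- by move=> z /OO'/df.
- by move=> v; apply: IH.
Qed.

Lemma CkW k O f : Ck k.+1 O f -> Ck k O f.
Proof.
elim: k f => [|k IH] f; first by case.
by move=> [df dk]; split => // v; apply: IH; exact: dk.
Qed.

Lemma Ck_ext k O f g : open O -> (forall z, O z -> f z = g z) ->
  Ck k O f -> Ck k O g.
Proof.
move=> oO; elim: k f g => [|k IH] f g fg [df dk].
all: have nfg z : O z -> \near z, f z = g z
  by move=> Oz; near do apply: fg; exact: open_nbhs_nbhs.
  by split => // z Oz; have [] := near_eq_is_diff (nfg z Oz) (df z Oz).
split; first by move=> z Oz; have [] := near_eq_is_diff (nfg z Oz) (df z Oz).
move=> v; apply: IH (dk v) => z Oz; apply: near_eq_derive; exact: nfg.
Unshelve. all: by end_near. Qed.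

Lemma Ck_cst k O (c : R) : Ck k O (fun=> c).
Proof.
elim: k c => [|k IH] c; split => //; try by move=> z _; exact: differentiable_cst.
move=> v; suff -> : 'D_v (fun=> c) = (fun=> 0) :> (V -> R) by exact: IH.
by apply/funext => z; exact: derive_cst.
Qed.

Lemma Ck_linear k O f (d : V -> R) : (forall z, differentiable f z) ->
  (forall z v, 'D_v f z = d v) -> Ck k O f.
Proof.
move=> df dE; case: k => [|k]; split => // v.
have -> : 'D_v f = (fun=> d v) :> (V -> R) by apply/funext => z; exact: dE.
exact: Ck_cst.
Qed.

Lemma CkD k O f g : open O -> Ck k O f -> Ck k O g ->
  Ck k O (fun z => f z + g z).
Proof.
move=> oO; elim: k f g => [|k IH] f g [df dkf] [dg dkg]; split => //.
- by move=> z Oz; apply: differentiableD; [exact: df|exact: dg].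
- by move=> z Oz; apply: differentiableD; [exact: df|exact: dg].
move=> v; apply: (Ck_ext oO _ (IH _ _ (dkf v) (dkg v))) => z Oz.
by rewrite -deriveD//; apply: diff_derivable; [exact: df|exact: dg].
Qed.

Lemma CkM k O f g : open O -> Ck k O f -> Ck k O g ->
  Ck k O (fun z => f z * g z).
Proof.
move=> oO; elim: k f g => [|k IH] f g cf cg; split => //.
- by move=> z Oz; apply: differentiableM; [exact: Ck_diff cf Oz|exact: Ck_diff cg Oz].
- by move=> z Oz; apply: differentiableM; [exact: Ck_diff cf Oz|exact: Ck_diff cg Oz].
move=> v; apply: (Ck_ext oO _ (CkD oO (IH _ _ (CkW cf) (cg.2 v)) (IH _ _ (CkW cg) (cf.2 v)))) => z Oz.
by rewrite [RHS]deriveM//; apply: diff_derivable; [exact: Ck_diff cf Oz|exact: Ck_diff cg Oz].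
Qed.

Lemma CkN k O f : open O -> Ck k O f -> Ck k O (fun z => - f z).
Proof.
move=> oO cf; have := CkM oO (Ck_cst k O (-1)) cf.
by apply: Ck_ext => // z _; rewrite mulN1r.
Qed.

Lemma Ck_sum (I : Type) (s : seq I) (P : pred I) k O (F : I -> V -> R) : open O ->
  (forall i, P i -> Ck k O (F i)) -> Ck k O (fun z => \sum_(i <- s | P i) F i z).
Proof.
move=> oO cF; elim: s => [|i s IH].
  by apply: Ck_ext (Ck_cst k O 0) => // z _; rewrite big_nil.
case: (boolP (P i)) => Pi.
  by apply: Ck_ext (CkD oO (cF _ Pi) IH) => // z _; rewrite big_cons Pi.
by apply: Ck_ext IH => // z _; rewrite big_cons (negbTE Pi).
Qed.

Lemma Ck_prod (I : Type) (s : seq I) (P : pred I) k O (F : I -> V -> R) : open O ->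
  (forall i, P i -> Ck k O (F i)) -> Ck k O (fun z => \prod_(i <- s | P i) F i z).
Proof.
move=> oO cF; elim: s => [|i s IH].
  by apply: Ck_ext (Ck_cst k O 1) => // z _; rewrite big_nil.
case: (boolP (P i)) => Pi.
  by apply: Ck_ext (CkM oO (cF _ Pi) IH) => // z _; rewrite big_cons Pi.
by apply: Ck_ext IH => // z _; rewrite big_cons (negbTE Pi).
Qed.

Lemma derive_comp1 (phi : R -> R) (a : R) f z v : differentiable f z ->
  is_derive (f z) 1 phi a -> differentiable (phi \o f) z /\
  'D_v (phi \o f) z = a * 'D_v f z.
Proof.
move=> df [/derivable1_diffP dphi aE].
have dc : differentiable (phi \o f) z by exact: differentiable_comp.
split => //; rewrite !deriveE// diff_comp//= (diff1E dphi) derive1E aE.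
by rewrite mulrC.
Qed.

(** The regularity of [phi] enters only through [phi' \o f]. For cosine and sine, inverse, square
    root and arctangent this composite is an expression in [phi \o f] or in functions treated
    before, so that an induction on the order closes. *)
Lemma CkS_comp (phi phi' : R -> R) k O f : open O ->
  (forall z, O z -> is_derive (f z) 1 phi (phi' (f z))) ->
  Ck k.+1 O f -> Ck k O (phi' \o f) -> Ck k.+1 O (phi \o f).
Proof.
move=> oO dphi cf cp; split.
  by move=> z Oz; have [] := derive_comp1 0 (Ck_diff cf Oz) (dphi z Oz).
move=> v; apply: Ck_ext (CkM oO cp (cf.2 v)) => // z Oz.
by have [_ ->] := derive_comp1 v (Ck_diff cf Oz) (dphi z Oz).
Qed.

Lemma Ck0_comp (phi phi' : R -> R) O f :
  (forall z, O z -> is_derive (f z) 1 phi (phi' (f z))) ->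
  Ck 0 O f -> Ck 0 O (phi \o f).
Proof.
move=> dphi cf; split => // z Oz.
by have [] := derive_comp1 0 (Ck_diff cf Oz) (dphi z Oz).
Qed.

Lemma Ck_cos_sin k O f : open O -> Ck k O f ->
  Ck k O (fun z => cos (f z)) /\ Ck k O (fun z => sin (f z)).
Proof.
move=> oO; elim: k => [|k IH] cf.
  split; [apply: (@Ck0_comp cos (fun t => - sin t))|apply: (@Ck0_comp sin cos)] => //.
have [cc cs] := IH (CkW cf).
split; [apply: (@CkS_comp cos (fun t => - sin t))|apply: (@CkS_comp sin cos)] => //.
exact: CkN.
Qed.

Lemma Ck_inv k O f : open O -> (forall z, O z -> f z != 0) -> Ck k O f ->
  Ck k O (fun z => (f z)^-1).
Proof.
move=> oO f0; elim: k => [|k IH] cf.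
  apply: (@Ck0_comp GRing.inv (fun t => - t ^- 2 *: 1)) => // z Oz.
  by apply: (is_deriveV (f:=id)) => //; exact: f0.
apply: (@CkS_comp GRing.inv (fun t => - t ^- 2 *: 1)) => //.
  by move=> z Oz; apply: (is_deriveV (f:=id)) => //; exact: f0.
have c := IH (CkW cf); have := CkN oO (CkM oO c c).
by apply: Ck_ext => // z Oz; rewrite /= [RHS]mulr1 expr2 invfM.
Qed.

Lemma Ck_sqrt k O f : open O -> (forall z, O z -> 0 < f z) -> Ck k O f ->
  Ck k O (fun z => Num.sqrt (f z)).
Proof.
move=> oO f0; elim: k => [|k IH] cf.
  by apply: (@Ck0_comp Num.sqrt (fun t => (2 * Num.sqrt t)^-1)) => // z Oz;
    apply: is_derive1_sqrt; exact: f0.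
apply: (@CkS_comp Num.sqrt (fun t => (2 * Num.sqrt t)^-1)) => //.
  by move=> z Oz; apply: is_derive1_sqrt; exact: f0.
apply: (Ck_inv (f := fun z => 2 * Num.sqrt (f z))) => //.
  by move=> z Oz; rewrite mulf_neq0// gt_eqF// sqrtr_gt0 f0.
by apply: CkM => //; [exact: Ck_cst|apply: IH; exact: CkW].
Qed.

Lemma Ck_atan k O f : open O -> Ck k O f -> Ck k O (fun z => atan (f z)).
Proof.
move=> oO; elim: k => [|k IH] cf.
  exact: (@Ck0_comp atan (fun t => (1 + t ^+ 2)^-1)).
apply: (@CkS_comp atan (fun t => (1 + t ^+ 2)^-1)) => //.
apply: (Ck_inv (f := fun z => 1 + f z ^+ 2)) => //.
  by move=> z Oz; rewrite gt_eqF// ltr_pwDl// sqr_ge0.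
apply: CkD => //; first exact: Ck_cst.
by apply: CkM => //; exact: CkW.
Qed.

End SmoothFunctions.

Section SmoothClosure.
Context {R : realType} {V : normedModType R}.
Implicit Types (O : set V) (f g : V -> R) (z v : V).

Lemma smooth_sub O O' f : O' `<=` O -> smooth O f -> smooth O' f.
Proof. by move=> OO' sf k; exact: Ck_sub OO' (sf k). Qed.

Lemma smooth_ext O f g : open O -> (forall z, O z -> f z = g z) ->
  smooth O f -> smooth O g.
Proof. by move=> oO fg sf k; exact: Ck_ext oO fg (sf k). Qed.

Lemma smooth_cst O (c : R) : smooth O (fun=> c).
Proof. by move=> k; exact: Ck_cst. Qed.

Lemma smoothD O f g : open O -> smooth O f -> smooth O g ->
  smooth O (fun z => f z + g z).
Proof. by move=> oO sf sg k; exact: CkD. Qed.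

Lemma smoothN O f : open O -> smooth O f -> smooth O (fun z => - f z).
Proof. by move=> oO sf k; exact: CkN. Qed.

Lemma smoothM O f g : open O -> smooth O f -> smooth O g ->
  smooth O (fun z => f z * g z).
Proof. by move=> oO sf sg k; exact: CkM. Qed.

Lemma smoothX O f n : open O -> smooth O f -> smooth O (fun z => f z ^+ n).
Proof.
move=> oO sf; elim: n => [|n IH].
  by apply: smooth_ext (smooth_cst O 1).
by apply: smooth_ext (smoothM oO sf IH) => // z _; rewrite exprS.
Qed.

Lemma smooth_sum (I : Type) (s : seq I) (P : pred I) O (F : I -> V -> R) :
  open O -> (forall i, P i -> smooth O (F i)) ->
  smooth O (fun z => \sum_(i <- s | P i) F i z).
Proof. by move=> oO sF k; apply: Ck_sum => // i /sF. Qed.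

Lemma smooth_prod (I : Type) (s : seq I) (P : pred I) O (F : I -> V -> R) :
  open O -> (forall i, P i -> smooth O (F i)) ->
  smooth O (fun z => \prod_(i <- s | P i) F i z).
Proof. by move=> oO sF k; apply: Ck_prod => // i /sF. Qed.

Lemma smooth_cos O f : open O -> smooth O f -> smooth O (fun z => cos (f z)).
Proof. by move=> oO sf k; exact: (Ck_cos_sin oO (sf k)).1. Qed.

Lemma smooth_sin O f : open O -> smooth O f -> smooth O (fun z => sin (f z)).
Proof. by move=> oO sf k; exact: (Ck_cos_sin oO (sf k)).2. Qed.

Lemma smooth_inv O f : open O -> (forall z, O z -> f z != 0) -> smooth O f ->
  smooth O (fun z => (f z)^-1).
Proof. by move=> oO f0 sf k; exact: Ck_inv. Qed.

Lemma smooth_sqrt O f : open O -> (forall z, O z -> 0 < f z) -> smooth O f ->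
  smooth O (fun z => Num.sqrt (f z)).
Proof. by move=> oO f0 sf k; exact: Ck_sqrt. Qed.

Lemma smooth_atan O f : open O -> smooth O f -> smooth O (fun z => atan (f z)).
Proof. by move=> oO sf k; exact: Ck_atan. Qed.

Lemma smooth_derive O f v : smooth O f -> smooth O ('D_v f).
Proof. by move=> sf k; have [_] := sf k.+1; exact. Qed.

Lemma smooth_diff O f z : smooth O f -> O z -> differentiable f z.
Proof. by move=> sf Oz; exact: Ck_diff (sf 0%N) Oz. Qed.

Lemma smooth_continuous O f z : smooth O f -> O z -> {for z, continuous f}.
Proof. by move=> sf Oz; apply/differentiable_continuous; exact: smooth_diff Oz. Qed.

Lemma smooth_det n O (M : V -> 'M[R]_n) : open O ->
  (forall i j, smooth O (fun z => M z i j)) -> smooth O (fun z => \det (M z)).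
Proof.
move=> oO sM; apply: smooth_sum => // s _; apply: smoothM => //.
  exact: smooth_cst.
by apply: smooth_prod.
Qed.

Lemma smooth_invmx n O (M : V -> 'M[R]_n) : open O ->
  (forall z, O z -> M z \in unitmx) ->
  (forall i j, smooth O (fun z => M z i j)) ->
  forall i j, smooth O (fun z => invmx (M z) i j).
Proof.
move=> oO uM sM i j.
apply: (@smooth_ext _ (fun z => (\det (M z))^-1 * cofactor (M z) j i)) => //.
  by move=> z Oz; rewrite /invmx (uM z Oz) !mxE.
apply: smoothM => //.
  apply: smooth_inv => //; last exact: smooth_det.
  by move=> z /uM; rewrite unitmxE unitfE.
apply: smoothM => //; first exact: smooth_cst.
by apply: smooth_det => // k l; under eq_fun do rewrite !mxE; exact: sM.
Qed.

Lemma open_gt0 O f : open O -> smooth O f -> open (O `&` [set z | 0 < f z]).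
Proof.
move=> oO sf; rewrite openE => z [Oz fz]; apply: filterI.
  exact: open_nbhs_nbhs.
have cf := smooth_continuous sf Oz.
by move: fz => /(cvgr_gt _ cf).
Qed.

End SmoothClosure.

(** * Uniform bounds on compact sets *)

Section Compactness.
Context {R : realType} {X : topologicalType}.

Lemma compact_bounded (K : set X) (Q : X -> R) : compact K ->
  (forall z, K z -> exists C, \forall w \near z, K w -> Q w <= C) ->
  exists2 C, 0 < C & forall z, K z -> Q z <= C.
Proof.
move=> /compact_near_coveringP cK H.
have [] := cK _ (pinfty_nbhs R) (fun C z => K z -> Q z <= C) _ _.
  move=> z Kz; have [C HC] := H z Kz.
  near=> w C' => /= Kw; apply: (@le_trans _ _ C).
    by apply: (near HC w) => //; near: w.
  by near: C'; apply: nbhs_pinfty_ge; rewrite num_real.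
move=> C [_ HC]; exists (Num.max C 0 + 1).
  by rewrite ltr_pwDr// le_max lexx orbT.
move=> z Kz; apply: (HC (Num.max C 0 + 1)) => //.
by rewrite (@le_lt_trans _ _ (Num.max C 0)) ?le_max ?lexx// ltrDl.
Unshelve. all: by end_near. Qed.

Lemma compact_continuous_bounded (K : set X) (f : X -> R) : compact K ->
  (forall z, K z -> {for z, continuous f}) ->
  exists2 C, 0 < C & forall z, K z -> `|f z| <= C.
Proof.
move=> cK cf; apply: compact_bounded => // z Kz; exists (`|f z| + 1).
have /cvgrPdist_le /(_ 1 ltr01) := cf z Kz; apply: filterS => w fw _.
by rewrite -lerBlDl (le_trans _ fw)// distrC (le_trans (lerB_dist _ _))// distrC.
Qed.

Lemma compact_continuous_gt0 (K : set X) (f : X -> R) : compact K ->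
  (forall z, K z -> {for z, continuous f}) -> (forall z, K z -> 0 < f z) ->
  exists2 c, 0 < c & forall z, K z -> c <= f z.
Proof.
move=> cK cf f0.
have [|C C0 HC] := @compact_bounded K (fun z => (f z)^-1) cK.
  move=> z Kz; exists (2 / f z).
  have : f z / 2 < f z by rewrite ltr_pdivrMr// ltr_pMr ?f0// ltr1n.
  move=> /(cvgr_gt _ (cf z Kz)); apply: filterS => w fw _.
  have fz2 : 0 < f z / 2 by rewrite divr_gt0 ?f0.
  rewrite -[leRHS]invf_div lef_pV2 ?posrE//; first exact: ltW.
  exact: lt_trans fw.
exists C^-1; first by rewrite invr_gt0.
by move=> z Kz; rewrite -[leRHS]invrK lef_pV2 ?posrE ?invr_gt0 ?f0// HC.
Qed.

End Compactness.

(** * Mean values and quantitative injectivity *)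

Section MeanValue.
Context {R : realType} {V : normedModType R}.
Implicit Types (f : V -> R) (a h z : V).

Lemma ball_segment z (e s : R) a b : ball z e a -> ball z e b -> 0 <= s <= 1 ->
  ball z e (s *: (b - a) + a).
Proof.
rewrite -!ball_normE /= => za zb /andP[s0 s1].
have -> : z - (s *: (b - a) + a) = (1 - s) *: (z - a) + s *: (z - b).
  rewrite scalerBl scale1r !scalerBr -[RHS]addrA opprB subrKA.
  by rewrite opprD opprB [RHS]addrAC addrA.
rewrite (le_lt_trans (ler_normD _ _))// !normrZ ger0_norm ?subr_ge0// ger0_norm//.
have [->|s0'] := eqVneq s 0; first by rewrite subr0 mul0r addr0 mul1r.
apply: (@lt_le_trans _ _ ((1 - s) * e + s * e)); last by rewrite -mulrDl subrK mul1r.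
apply: ler_ltD; first by rewrite ler_wpM2l ?subr_ge0// ltW.
by rewrite ltr_pM2l// lt_def s0' s0.
Qed.

Lemma mvt_line f a h :
  (forall s : R, 0 <= s <= 1 -> differentiable f (s *: h + a)) ->
  exists2 s : R, 0 <= s <= 1 & f (h + a) - f a = 'D_h f (s *: h + a).
Proof.
move=> df; pose phi (s : R) := f (s *: h + a).
have dphi (s : R) : 0 <= s <= 1 -> is_derive s 1 phi ('D_h f (s *: h + a)).
  move=> s01.
  have D : is_diff s (fun s : R => s *: h + a) (fun s => s *: h).
    have := is_diffD (is_diff_scalel s h) (is_diff_cst a s).
    by move=> H; apply: is_diff_eq; rewrite addr0.
  have dc : differentiable phi s.
    by apply: (@differentiable_comp _ _ _ _ (fun s : R => s *: h + a) f); [|exact: df].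
  apply: DeriveDef; first exact/derivable1_diffP.
  rewrite !deriveE//; last exact: df.
  rewrite (_ : phi = f \o (fun s : R => s *: h + a))// diff_comp//; last exact: df.
  by rewrite /= diff_val scale1r.
have [||s s01 E] := @MVT_segment _ phi (fun s => 'D_h f (s *: h + a)) 0 1 ler01.
- by move=> x /[!in_itv]/= /andP[/ltW x0 /ltW x1]; apply: dphi; rewrite x0.
- apply: continuous_in_subspaceT => s /[!inE]/= s01.
  apply/differentiable_continuous/derivable1_diffP.
  by have [] := dphi s s01.
exists s => //; move: E; rewrite /phi scale1r scale0r add0r => ->.
by rewrite subr0 mulr1.
Qed.

End MeanValue.

Section SpaceTime.
Context {R : realType}.
Notation V4 := (R * 'rV[R]_3)%type.
Implicit Types (f : V4 -> R) (z : V4) (O K : set V4).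

Definition ev (i : 'I_3) : V4 := (0, delta_mx 0 i).

Definition dx (i : 'I_3) f : V4 -> R := 'D_(ev i) f.

Lemma derive_horizontal f z (h : 'rV[R]_3) : differentiable f z ->
  'D_((0, h) : V4) f z = \sum_(i < 3) h 0 i * dx i f z.
Proof.
move=> df; rewrite deriveE//.
have -> : ((0, h) : V4) = \sum_(i < 3) h 0 i *: ev i.
  rewrite {1}(row_sum_delta h) !big_ord_recl !big_ord0 /ev.
  by congr pair; rewrite /= ?scaler0 ?addr0.
rewrite linear_sum; apply: eq_bigr => i _.
by rewrite linearZ /dx deriveE.
Qed.

Lemma ler_coord n (h : 'rV[R]_n) i : `|h 0 i| <= `|h|.
Proof.
rewrite [leRHS]/Num.Def.normr /= mx_normrE.
by apply/bigmax_geP; right; exists (0, i).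
Qed.

Lemma smooth_dx O f i : smooth O f -> smooth O (dx i f).
Proof. exact: smooth_derive. Qed.

Lemma mvt_horizontal f z (e : R) t x x' :
  (forall w, ball z e w -> differentiable f w) ->
  ball z e (t, x) -> ball z e (t, x') ->
  exists2 w, ball z e (t, w) & `|w - x| <= `|x' - x| /\
    f (t, x') - f (t, x) = \sum_(i < 3) (x' - x) 0 i * dx i f (t, w).
Proof.
move=> df bx bx'.
have E (s : R) : s *: ((0, x' - x) : V4) + (t, x) = s *: ((t, x') - (t, x)) + (t, x).
  by congr pair; rewrite /= subrr.
have [s s01|s s01 fE] := @mvt_line _ _ f (t, x) (0, x' - x).
  by apply: df; rewrite E; exact: ball_segment.
have wE : s *: ((0, x' - x) : V4) + (t, x) = (t, s *: (x' - x) + x).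
  by congr pair; rewrite /= scaler0 add0r.
have bw : ball z e (t, s *: (x' - x) + x).
  by rewrite -wE E; exact: ball_segment.
exists (s *: (x' - x) + x) => //; split.
  rewrite addrK normrZ; case/andP: s01 => s0 s1.
  by rewrite ger0_norm// ler_piMl.
rewrite -derive_horizontal; last exact: df.
by rewrite -wE -fE; congr (f _ - _); congr pair; rewrite /= ?add0r// subrK.
Qed.

(** Meant for difference quotients, which need not be continuous on the diagonal: local bounds on
    pairs in one time slice are made uniform on a strip around it. *)
Lemma near_diag_uniform K (Q : V4 -> 'rV[R]_3 -> R) : compact K ->
  (forall z, K z -> exists2 e : R, 0 < e & exists M, forall t x x',
     ball z e (t, x) -> ball z e (t, x') -> Q (t, x) x' <= M) ->
  exists2 rho : R, 0 < rho & exists2 M, 0 < M & forall t x x',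
     K (t, x) -> `|x - x'| < rho -> Q (t, x) x' <= M.
Proof.
move=> /compact_near_coveringP cK H.
(* One small parameter [r] is both the width of the strip and the inverse of the bound, so that a
   single filter serves in the covering argument. *)
have [] := cK _ (0^'+ : set_system R) (fun r z => forall x', `|z.2 - x'| < r -> Q z x' <= r^-1).
  move=> z Kz; have [e e0 [M HM]] := H z Kz.
  have e20 : 0 < e / 2 by rewrite divr_gt0.
  near=> w r => x' wx'.
  have r0 : 0 < r by [].
  have re : r < e / 2 by near: r; apply: nbhs_right_lt.
  have rM : r < (`|M| + 1)^-1 by near: r; apply: nbhs_right_lt; rewrite invr_gt0 ltr_wpDl.
  have wb : ball z (e / 2) w by near: w; exact: nbhsx_ballx.
  apply: (@le_trans _ _ M).
    rewrite (surjective_pairing w); apply: HM.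
      by rewrite -surjective_pairing; apply: le_ball wb; lra.
    move: wb; rewrite -!ball_normE /= !prod_normE /= !gt_max => /andP[w1 w2].
    rewrite (lt_trans w1) /=; last lra.
    rewrite -(subrK w.2 z.2) -addrA (le_lt_trans (ler_normD _ _))// (splitr e).
    by rewrite ltrD// (lt_trans wx').
  rewrite (le_trans (ler_norm _))// (@le_trans _ _ (`|M| + 1)) ?lerDl//.
  rewrite -[leLHS]invrK lef_pV2 ?posrE// ?invr_gt0 ?ltr_wpDl//.
  exact: ltW.
move=> e /= e0 He; have e20 : 0 < e / 2 by rewrite divr_gt0.
exists (e / 2) => //; exists (e / 2)^-1; first by rewrite invr_gt0.
move=> t x x' Kx xx'; apply: (He (e / 2)) => //=.
by rewrite sub0r normrN gtr0_norm//; lra.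
Unshelve. all: by end_near. Qed.

Lemma ball_in_nbhs O z : open O -> O z ->
  exists2 e : R, 0 < e & forall w, ball z e w -> O w.
Proof.
move=> oO Oz; have : nbhs z O by exact: open_nbhs_nbhs.
by move=> /nbhs_ballP[e /= e0 He]; exists e.
Qed.

Lemma continuous_ball_bound (I : finType) (F : I -> V4 -> R) z :
  (forall i, {for z, continuous (F i)}) -> forall eta : R, 0 < eta ->
  exists2 e : R, 0 < e & forall w, ball z e w -> forall i, `|F i w - F i z| <= eta.
Proof.
move=> cF eta eta0.
have : \forall w \near z, forall i, `|F i w - F i z| <= eta.
  have : forall i, \forall w \near z, `|F i w - F i z| <= eta.
    move=> i; have /cvgrPdist_le /(_ _ eta0) := cF i.
    by apply: filterS => w; rewrite distrC.
  by move=> /filter_forall.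
by move=> /nbhs_ballP[e /= e0 He]; exists e.
Qed.

Lemma sum_row_le n (c : 'I_n -> R) (h : 'I_n -> R) (H M : R) :
  (forall i, `|h i| <= H) -> (forall i, `|c i| <= M) ->
  `|\sum_(i < n) h i * c i| <= n%:R * (H * M).
Proof.
move=> hH cM; apply: (le_trans (ler_norm_sum _ _ _)).
rewrite -[X in _ <= X%:R * _]card_ord -sum1_card natr_sum mulr_suml.
by apply: ler_sum => i _; rewrite mul1r normrM ler_pM.
Qed.

End SpaceTime.

Section Slices.
Context {R : realType}.
Notation V4 := (R * 'rV[R]_3)%type.
Implicit Types (f g : V4 -> R) (z : V4) (O K : set V4) (y p : 'I_6 -> V4 -> R).

Lemma dx_cst i (c : R) z : dx i (fun=> c) z = 0.
Proof. exact: derive_cst. Qed.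

Lemma dxD i f g z : differentiable f z -> differentiable g z ->
  dx i (fun w => f w + g w) z = dx i f z + dx i g z.
Proof. by move=> df dg; rewrite /dx -deriveD//; exact: diff_derivable. Qed.

Lemma dxM i f g z : differentiable f z -> differentiable g z ->
  dx i (fun w => f w * g w) z = f z * dx i g z + g z * dx i f z.
Proof. by move=> df dg; rewrite /dx [LHS]deriveM//; exact: diff_derivable. Qed.

Lemma dxZ i (c : R) f z : differentiable f z ->
  dx i (fun w => c * f w) z = c * dx i f z.
Proof.
move=> df; rewrite (dxM _ (differentiable_cst c z) df).
by rewrite dx_cst mulr0 addr0.
Qed.

Lemma dx_sum i n (F : 'I_n -> V4 -> R) z : (forall k, differentiable (F k) z) ->
  dx i (fun w => \sum_(k < n) F k w) z = \sum_(k < n) dx i (F k) z.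
Proof.
move=> dF; rewrite /dx -derive_sum; last by move=> k; exact: diff_derivable.
by congr ('D_ _ _ z); apply/funext => w; rewrite fct_sumE.
Qed.

Lemma ler_norm_near (a b c M : R) : `|a - b| <= c -> `|b| + c <= M -> `|a| <= M.
Proof.
move=> h; apply: le_trans; rewrite -{1}[a](subrK b) addrC.
by rewrite (le_trans (ler_normD _ _))// lerD.
Qed.

Lemma normal_quadratic O K y p : open O -> K `<=` O -> compact K ->
  (forall k, smooth O (y k)) -> (forall k, smooth O (p k)) ->
  (forall z i, O z -> \sum_(k < 6) p k z * dx i (y k) z = 0) ->
  exists2 C, 0 < C & forall t x x', K (t, x) -> K (t, x') ->
    `|\sum_(k < 6) p k (t, x) * (y k (t, x') - y k (t, x))| <= C * `|x' - x| ^+ 2.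
Proof.
move=> oO KO cK sy sp py.
have [|rho rho0 [M M0 HM]] := @near_diag_uniform _ K
    (fun z x' => `|\sum_(k < 6) p k z * (y k (z.1, x') - y k z)| / `|x' - z.2| ^+ 2) cK.
  move=> z Kz; have [e1 e10 He1] := ball_in_nbhs oO (KO _ Kz).
  have /continuous_ball_bound /(_ 1 ltr01) [e2 e20 He2] :
      forall ki : 'I_6 * 'I_3, {for z, continuous (dx ki.2 (y ki.1))}.
    by move=> ki; apply: smooth_continuous (KO _ Kz); exact: smooth_dx.
  have /continuous_ball_bound /(_ 1 ltr01) [e3 e30 He3] :
      forall ki : 'I_6 * 'I_3, {for z, continuous (dx ki.2 (p ki.1))}.
    by move=> ki; apply: smooth_continuous (KO _ Kz); exact: smooth_dx.
  pose A := \sum_(ki : 'I_6 * 'I_3) (`|dx ki.2 (y ki.1) z| + `|dx ki.2 (p ki.1) z|) + 1.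
  have A0 : 0 < A by rewrite ltr_wpDl// sumr_ge0// => ki _; rewrite addr_ge0.
  pose e := Num.min e1 (Num.min e2 e3).
  have bO w : ball z e w -> O w.
    by move=> bw; apply: He1; apply: le_ball bw; rewrite ge_min lexx.
  have zA i k : `|dx i (y k) z| + 1 <= A /\ `|dx i (p k) z| + 1 <= A.
    rewrite /A (bigD1 (k, i))//=; set S := \sum_(_ | _) _.
    have S0 : 0 <= S by apply: sumr_ge0 => ki _; rewrite addr_ge0.
    have := normr_ge0 (dx i (y k) z); have := normr_ge0 (dx i (p k) z).
    by split; lra.
  have yA w i k : ball z e w -> `|dx i (y k) w| <= A.
    move=> bw; apply: ler_norm_near (zA i k).1.
    by apply: (He2 _ _ (k, i)); apply: le_ball bw; rewrite !ge_min lexx orbT.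
  have pA w i k : ball z e w -> `|dx i (p k) w| <= A.
    move=> bw; apply: ler_norm_near (zA i k).2.
    by apply: (He3 _ _ (k, i)); apply: le_ball bw; rewrite !ge_min lexx !orbT.
  exists e; first by rewrite !lt_min e10 e20.
  exists (6%:R * ((3%:R * A) * (3%:R * A))) => t x x' bx bx' /=.
  have [->|xx'] := eqVneq x' x.
    by rewrite subrr normr0 expr0n invr0 mulr0 !mulr_ge0// ltW.
  have d0 : 0 < `|x' - x| by rewrite normr_gt0 subr_eq0.
  rewrite ler_pdivrMr ?exprn_gt0//.
  pose F w := \sum_(k < 6) p k (t, x) * y k w.
  have dF w : ball z e w -> differentiable F w.
    move=> bw; apply: (@smooth_diff _ _ O); last exact: bO.
    by apply: smooth_sum => // k _; apply: smoothM => //; exact: smooth_cst.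
  have [w bw [wx E]] := mvt_horizontal dF bx bx'.
  have -> : \sum_(k < 6) p k (t, x) * (y k (t, x') - y k (t, x)) = F (t, x') - F (t, x).
    by rewrite /F -sumrB; apply: eq_bigr => k _; rewrite mulrBr.
  (* Normality at [w] lets [p k (t, w)] be subtracted for free. *)
  have dFE i : dx i F (t, w) = \sum_(k < 6) (p k (t, x) - p k (t, w)) * dx i (y k) (t, w).
    rewrite dx_sum => [|k]; last first.
      by apply: differentiableM; [exact: differentiable_cst|apply: smooth_diff (sy k) (bO _ bw)].
    under [RHS]eq_bigr do rewrite mulrBl.
    rewrite sumrB (py _ i (bO _ bw)) subr0; apply: eq_bigr => k _.
    by rewrite dxZ//; apply: smooth_diff (sy k) (bO _ bw).
  rewrite E; under eq_bigr do rewrite dFE mulr_sumr.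
  rewrite exchange_big/=.
  have -> : 6%:R * (3%:R * A * (3%:R * A)) * `|x' - x| ^+ 2 =
      \sum_(k < 6) (3%:R * (A * `|x' - x|)) * (3%:R * (`|x' - x| * A)).
    by rewrite sumr_const card_ord -mulr_natl expr2; ring.
  apply: (le_trans (ler_norm_sum _ _ _)); apply: ler_sum => k _.
  rewrite (_ : \sum_(j < 3) _ = (p k (t, x) - p k (t, w)) * \sum_(j < 3) (x' - x) 0 j * dx j (y k) (t, w)); last first.
    by rewrite mulr_sumr; apply: eq_bigr => j _; rewrite mulrCA.
  rewrite normrM ler_pM//; last first.
    by apply: sum_row_le => i; [exact: ler_coord|exact: yA].
  have [|v bv [vx ->]] := @mvt_horizontal _ (p k) z e t w x _ bw bx.
    by move=> v bv; apply: smooth_diff (sp k) (bO _ bv).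
  apply: (@le_trans _ _ (3%:R * (`|x - w| * A))).
    by apply: sum_row_le => i; [exact: ler_coord|exact: pA].
  by rewrite ler_pM2l// mulrC ler_pM2l// distrC.
(* Mean values are available only inside small balls, as [K] may fail to be convex. For pairs at
   distance at least [rho] crude bounds on the values suffice. *)
have [L [L0 HL]] : exists L, 0 < L /\ forall k t x x', K (t, x) -> K (t, x') ->
    `|y k (t, x') - y k (t, x)| <= L /\ `|p k (t, x)| <= L.
  have H k : exists L, 0 < L /\ forall t x x', K (t, x) -> K (t, x') ->
      `|y k (t, x') - y k (t, x)| <= L /\ `|p k (t, x)| <= L.
    have [|B B0 HB] := @compact_continuous_bounded _ _ K (y k) cK.
      by move=> z Kz; apply: smooth_continuous (KO _ Kz).
    have [|B' B'0 HB'] := @compact_continuous_bounded _ _ K (p k) cK.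
      by move=> z Kz; apply: smooth_continuous (KO _ Kz).
    exists (B + B + B'); split; first by rewrite !addr_gt0.
    move=> t x x' Kx Kx'; split.
      have := ler_normB (y k (t, x')) (y k (t, x)).
      by have := HB _ Kx; have := HB _ Kx'; lra.
    by rewrite (le_trans (HB' _ Kx))// lerDr ltW// addr_gt0.
  have /choice[L HL] := H.
  exists (\sum_k L k); split.
    by rewrite (bigD1 ord0)//= ltr_pwDl ?(HL _).1// sumr_ge0// => k _; rewrite ltW// (HL _).1.
  move=> k t x x' Kx Kx'; have [h1 h2] := (HL k).2 _ _ _ Kx Kx'.
  have LL : L k <= \sum_k L k.
    by rewrite [leRHS](bigD1 k)//= lerDl sumr_ge0// => j _; rewrite ltW// (HL _).1.
  by split; [exact: le_trans h1 _|exact: le_trans h2 _].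
exists (M + 6%:R * (L * L) / rho ^+ 2).
  by rewrite addr_gt0// divr_gt0 ?exprn_gt0// !mulr_gt0.
move=> t x x' Kx Kx'; have [->|xx'] := eqVneq x' x.
  by under eq_bigr do rewrite subrr mulr0; rewrite big1// !subrr !normr0 expr0n mulr0.
have d0 : 0 < `|x' - x| by rewrite normr_gt0 subr_eq0.
have [lt_rho|ge_rho] := ltP `|x' - x| rho.
  rewrite mulrDl ler_wpDr//.
    by rewrite mulr_ge0 ?sqr_ge0// divr_ge0 ?sqr_ge0// !mulr_ge0// ltW.
  by rewrite -ler_pdivrMr ?exprn_gt0//; apply: (HM t x x') => //; rewrite distrC.
rewrite mulrDl ler_wpDl// ?mulr_ge0 ?sqr_ge0// ?(ltW M0)//.
apply: (@le_trans _ _ (6%:R * (L * L))).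
  by apply: sum_row_le => k; have [] := HL k t x x' Kx Kx'.
rewrite mulrAC ler_pdivlMr ?exprn_gt0// ler_wpM2l ?mulr_ge0 ?(ltW L0)//.
by rewrite ler_sqr ?nnegrE ?(ltW rho0).
Qed.

End Slices.

Section Separation.
Context {R : realType}.
Notation V4 := (R * 'rV[R]_3)%type.
Implicit Types (f g : V4 -> R) (z : V4) (O K : set V4) (y p q : 'I_6 -> V4 -> R).

(* The injectivity of every y(t, .) on the slices of K, in the quantitative
   form that survives the perturbations. *)
Definition separated K y := exists2 c, 0 < c & forall t x x',
  K (t, x) -> K (t, x') ->
  c * `|x' - x| ^+ 2 <= \sum_(k < 6) (y k (t, x') - y k (t, x)) ^+ 2.

(** The new squared distance is the old one, plus a cross term, plus a square that is dropped; by
    [normal_quadratic] the cross term is O(|x' - x|^2 / lam). Nothing but a bound by 1 is asked of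
    [c] and [s], because the cosine and sine of the rapid phase have derivatives of order [lam]. *)
Lemma separated_perturb O K y p q : open O -> K `<=` O -> compact K ->
  (forall k, smooth O (y k)) -> (forall k, smooth O (p k)) ->
  (forall k, smooth O (q k)) ->
  (forall z i, O z -> \sum_(k < 6) p k z * dx i (y k) z = 0) ->
  (forall z i, O z -> \sum_(k < 6) q k z * dx i (y k) z = 0) ->
  separated K y ->
  exists2 L, 0 < L & forall lam, L <= lam -> forall c s : V4 -> R,
    (forall z, `|c z| <= 1) -> (forall z, `|s z| <= 1) ->
    separated K (fun k z => y k z + lam^-1 * (c z * p k z + s z * q k z)).
Proof.
move=> oO KO cK sy sp sq py qy [c0 c00 Hy].
have [C C0 HC] := normal_quadratic oO KO cK sy sp py.
have [D D0 HD] := normal_quadratic oO KO cK sy sq qy.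
(* The cross term is at most 4 (C + D) / lam times |x' - x|^2, which for [lam >= L] is at most half
   of the old lower bound. *)
pose L := 8%:R * (C + D) / c0.
have L0 : 0 < L by rewrite divr_gt0// mulr_gt0// addr_gt0.
exists L => // lam Llam c s c1 s1.
have lam0 : 0 < lam by exact: lt_le_trans Llam.
exists (c0 / 2); first by rewrite divr_gt0.
move=> t x x' Kx Kx'; have := Hy t x x' Kx Kx'.
set h2 := `|x' - x| ^+ 2 => Hd.
have h20 : 0 <= h2 by exact: sqr_ge0.
pose S z (u : 'I_6 -> V4 -> R) := \sum_(k < 6) u k z * (y k (t, x') - y k (t, x)).
have Sp : `|S (t, x) p| <= C * h2 by exact: HC.
have Sq : `|S (t, x) q| <= D * h2 by exact: HD.
have Sp' : `|S (t, x') p| <= C * h2.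
  have := HC t x' x Kx' Kx; rewrite distrC -/h2; congr (_ <= _).
  by rewrite -normrN -sumrN; congr `|_|; apply: eq_bigr => k _; ring.
have Sq' : `|S (t, x') q| <= D * h2.
  have := HD t x' x Kx' Kx; rewrite distrC -/h2; congr (_ <= _).
  by rewrite -normrN -sumrN; congr `|_|; apply: eq_bigr => k _; ring.
pose w := c (t, x') * S (t, x') p + s (t, x') * S (t, x') q
  - (c (t, x) * S (t, x) p + s (t, x) * S (t, x) q).
have wle : `|w| <= 2%:R * (C + D) * h2.
  have H (a b B : R) : `|a| <= 1 -> `|b| <= B -> `|a * b| <= B.
    by move=> a1 bB; rewrite normrM -[B]mul1r ler_pM.
  have := H _ _ _ (c1 (t, x')) Sp'; have := H _ _ _ (s1 (t, x')) Sq'.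
  have := H _ _ _ (c1 (t, x)) Sp; have := H _ _ _ (s1 (t, x)) Sq.
  rewrite /w !ler_norml => /andP[? ?] /andP[? ?] /andP[? ?] /andP[? ?].
  by apply/andP; split; lra.
have E : \sum_(k < 6) (y k (t, x') - y k (t, x)) ^+ 2 + 2 * (lam^-1 * w) <=
  \sum_(k < 6) (y k (t, x') + lam^-1 * (c (t, x') * p k (t, x') + s (t, x') * q k (t, x')) -
     (y k (t, x) + lam^-1 * (c (t, x) * p k (t, x) + s (t, x) * q k (t, x)))) ^+ 2.
  have -> : w = \sum_(k < 6) (c (t, x') * p k (t, x') + s (t, x') * q k (t, x')
     - (c (t, x) * p k (t, x) + s (t, x) * q k (t, x))) * (y k (t, x') - y k (t, x)).
    by rewrite /w /S !mulr_sumr -!big_split -sumrB; apply: eq_bigr => k _ /=; ring.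
  rewrite !mulr_sumr -big_split; apply: ler_sum => k _ /=.
  set a := c (t, x') * _ + _; set b := c (t, x) * _ + _.
  rewrite -subr_ge0 (_ : _ - _ = (lam^-1 * (a - b)) ^+ 2) ?sqr_ge0//.
  by ring.
apply: le_trans E.
have : `|lam^-1 * w| <= c0 / 4 * h2.
  rewrite normrM gtr0_norm ?invr_gt0// ler_pdivrMl// (le_trans wle)//.
  rewrite [leRHS]mulrA ler_wpM2r//.
  have : L * c0 <= lam * c0 by rewrite ler_pM2r.
  by rewrite /L divfK ?gt_eqF//; lra.
by rewrite ler_norml => /andP[? ?]; lra.
Qed.

Lemma sphere_compact : compact [set h : 'rV[R]_3 | `|h| = 1].
Proof.
apply: bounded_closed_compact.
  exists 1; split; first exact: real1.
  by move=> M M1 h /= ->; exact: ltW.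
apply: (@closed_comp _ _ (fun h : 'rV[R]_3 => `|h|) [set 1]).
  by move=> h _; exact: norm_continuous.
exact: closed_eq.
Qed.

Lemma continuous_sum_at (X : topologicalType) (I : finType) (F : I -> X -> R) (x : X) :
  (forall i, {for x, continuous (F i)}) ->
  {for x, continuous (fun w => \sum_i F i w)}.
Proof.
move=> cF; apply: cvg_big => [|i _]; first exact: add_continuous.
exact: cF.
Qed.

Lemma continuousX_at (X : topologicalType) (F : X -> R) n (x : X) :
  {for x, continuous F} -> {for x, continuous (fun w => F w ^+ n)}.
Proof.
by move=> cF; apply: (@continuous_comp _ _ _ F (fun r => r ^+ n)) => //; exact: exprn_continuous.
Qed.

(** Compactness of [K] times the unit sphere, then homogeneity in [h]. *)
Lemma posdef_uniform K (M : 'I_3 -> 'I_3 -> V4 -> R) : compact K ->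
  (forall z i j, K z -> {for z, continuous (M i j)}) ->
  (forall z (h : 'rV[R]_3), K z -> h != 0 ->
    0 < \sum_(i < 3) \sum_(j < 3) h 0 i * h 0 j * M i j z) ->
  exists2 m, 0 < m & forall z (h : 'rV[R]_3), K z ->
    m * `|h| ^+ 2 <= \sum_(i < 3) \sum_(j < 3) h 0 i * h 0 j * M i j z.
Proof.
move=> cK cM M0.
pose F (w : V4 * 'rV[R]_3) := \sum_(i < 3) \sum_(j < 3) w.2 0 i * w.2 0 j * M i j w.1.
have [||m m0 Hm] := @compact_continuous_gt0 _ _ _ F (compact_setX cK sphere_compact).
- move=> [z h] [/= Kz _].
  have ch i : {for (z, h), continuous (fun w : V4 * 'rV[R]_3 => w.2 0 i)}.
    apply: (@continuous_comp _ _ _ snd (fun h : 'rV[R]_3 => h 0 i)).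
      exact: cvg_snd.
    exact: coord_continuous.
  apply: continuous_sum_at => i; apply: continuous_sum_at => j.
  apply: continuousM; first by apply: continuousM; exact: ch.
  apply: (@continuous_comp _ _ _ fst (M i j)); first exact: cvg_fst.
  exact: cM.
- move=> [z h] [/= Kz h1]; apply: M0 => //.
  by rewrite -normr_eq0 h1 oner_eq0.
exists m => // z h Kz; have [->|h0] := eqVneq h 0.
  rewrite normr0 expr0n mulr0 big1// => i _; rewrite big1// => j _.
  by rewrite mxE !mul0r.
have h0' : 0 < `|h| by rewrite normr_gt0.
have := Hm (z, `|h|^-1 *: h); rewrite /F /=.
have -> : \sum_i \sum_j (`|h|^-1 *: h) 0 i * (`|h|^-1 *: h) 0 j * M i j z =
    `|h| ^- 2 * \sum_i \sum_j h 0 i * h 0 j * M i j z.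
  rewrite mulr_sumr; apply: eq_bigr => i _; rewrite mulr_sumr; apply: eq_bigr => j _.
  by rewrite !mxE -exprVn; ring.
rewrite ler_pdivlMl ?exprn_gt0// [_ * m]mulrC; apply; split => //=.
by rewrite normrZ ger0_norm ?invr_ge0// mulVf// gt_eqF.
Qed.

Lemma continuous_slice (w : V4 * 'rV[R]_3) :
  {for w, continuous (fun w : V4 * 'rV[R]_3 => (w.1.1, w.2))}.
Proof.
have h : {for w, continuous (fun w : V4 * 'rV[R]_3 => w.1.1)}.
  by apply: (@continuous_comp _ _ _ fst fst); exact: cvg_fst.
have h2 : {for w, continuous (fun w : V4 * 'rV[R]_3 => w.2)} by exact: cvg_snd.
exact: (cvg_pair h h2).
Qed.

(** Close pairs are separated by the immersion bound through the mean value theorem, distant pairs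
    by injectivity and compactness. *)
Lemma separated_immersion (C : set 'rV[R]_3) (a b m : R) O y : open O ->
  let K := `[a, b]%classic `*` C in K `<=` O -> compact C ->
  (forall k, smooth O (y k)) -> 0 < m ->
  (forall z (h : 'rV[R]_3), K z ->
    m * `|h| ^+ 2 <= \sum_(k < 6) (\sum_(i < 3) h 0 i * dx i (y k) z) ^+ 2) ->
  (forall t x x', K (t, x) -> K (t, x') ->
    (forall k, y k (t, x) = y k (t, x')) -> x = x') ->
  separated K y.
Proof.
move=> oO K KO cC sy m0 my injy.
have cK : compact K by apply: compact_setX => //; exact: segment_compact.
pose S z x' := \sum_(k < 6) (y k (z.1, x') - y k z) ^+ 2.
have S_gt0 t x x' : K (t, x) -> K (t, x') -> x' != x -> 0 < S (t, x) x'.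
  move=> Kx Kx' xx'; rewrite lt_def sumr_ge0 ?andbT; last by move=> k _; exact: sqr_ge0.
  apply: contra_neq xx' => /psumr_eq0P H; apply: (injy t) => // k.
  have /eqP := H (fun k _ => sqr_ge0 _) k isT.
  by rewrite sqrf_eq0 subr_eq0 => /eqP.
have [|rho rho0 [M M0 HM]] := @near_diag_uniform _ K
    (fun z x' => `|x' - z.2| ^+ 2 / S z x') cK.
  move=> z Kz; have [e1 e10 He1] := ball_in_nbhs oO (KO _ Kz).
  (* Each of the six components loses 9 eta^2 |h|^2; the total 54 m / 216 = m / 4 is taken out of m
     / 2. *)
  pose eta := Num.min 1 (m / 216%:R).
  have eta0 : 0 < eta by rewrite lt_min ltr01 divr_gt0.
  have eta2 : eta ^+ 2 <= m / 216%:R.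
    rewrite expr2 -[leRHS]mul1r ler_pM ?(ltW eta0)// ?ge_min ?lexx// orbT//.
  have /continuous_ball_bound /(_ _ eta0) [e2 e20 He2] :
      forall ki : 'I_6 * 'I_3, {for z, continuous (dx ki.2 (y ki.1))}.
    by move=> ki; apply: smooth_continuous (KO _ Kz); exact: smooth_dx.
  exists (Num.min e1 e2); first by rewrite lt_min e10.
  exists (4 / m) => t x x' bx bx' /=.
  have [->|xx'] := eqVneq x' x.
    by rewrite subrr normr0 expr0n mul0r divr_ge0// ltW.
  set h := x' - x.
  have h0 : 0 < `|h| ^+ 2 by rewrite exprn_gt0// normr_gt0 subr_eq0.
  have Sle : m / 4 * `|h| ^+ 2 <= S (t, x) x'.
    (* With A the differential at the centre [z] and B the true increment, (2 B - A)^2 >= 0 gives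
       B^2 >= A^2 / 2 - (B - A)^2. *)
    have Sk k : (\sum_(i < 3) h 0 i * dx i (y k) z) ^+ 2 / 2 - 9%:R * (eta ^+ 2 * `|h| ^+ 2) <=
        (y k (t, x') - y k (t, x)) ^+ 2.
      have [|w bw [_ ->]] := @mvt_horizontal _ (y k) z _ t x x' _ bx bx'.
        by move=> w bw; apply: (smooth_diff (sy k)); apply: He1; apply: le_ball bw; rewrite ge_min lexx.
      rewrite -/h; set A := \sum_i _; set B := \sum_i _.
      have : `|B - A| <= 3%:R * (`|h| * eta).
        rewrite /A /B -sumrB; under eq_bigr do rewrite -mulrBr.
        apply: sum_row_le => i; first exact: ler_coord.
        by apply: (He2 _ _ (k, i)); apply: le_ball bw; rewrite ge_min lexx orbT.
      rewrite -ler_sqr ?nnegrE ?mulr_ge0 ?(ltW eta0)// real_normK ?num_real//.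
      have : 0 <= (2 * B - A) ^+ 2 by exact: sqr_ge0.
      rewrite !exprMn; move: (`|h| ^+ 2) (eta ^+ 2) => H E.
      rewrite -natrX /=; nra.
    apply: le_trans (ler_sum _ (fun k _ => Sk k)).
    rewrite sumrB -mulr_suml sumr_const card_ord -mulr_natl.
    have := my z h Kz; set Q := \sum_k _.
    have : eta ^+ 2 * `|h| ^+ 2 <= m / 216%:R * `|h| ^+ 2 by rewrite ler_pM2r.
    move: (eta ^+ 2 * _) => E; lra.
  have S0 : 0 < S (t, x) x' by apply: lt_le_trans Sle; rewrite mulr_gt0// divr_gt0.
  rewrite ler_pdivrMr// mulrAC ler_pdivlMr// mulrC.
  by have := Sle; rewrite mulrAC ler_pdivrMr// [_ * 4]mulrC.
(* Pairs of one time slice away from the diagonal: a compact set on which [S] is positive. *)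
pose far := (K `*` C) `&` [set w : V4 * 'rV[R]_3 | rho <= `|w.2 - w.1.2|].
have cfar : compact far.
  apply: compact_closedI; first exact: compact_setX.
  apply: (@closed_comp _ _ (fun w : V4 * 'rV[R]_3 => `|w.2 - w.1.2|) [set r | rho <= r]);
    last exact: closed_ge.
  move=> w _; apply: continuous_comp; last exact: norm_continuous.
  apply: continuousB; first exact: cvg_snd.
  apply: (@continuous_comp _ _ _ fst snd); [exact: cvg_fst|exact: cvg_snd].
have [||d d0 Hd] := @compact_continuous_gt0 _ _ far (fun w => S w.1 w.2) cfar.
- move=> [[t x] x'] [[/= Kx Cx'] _].
  have Kx' : K (t, x') by case: Kx.
  apply: continuous_sum_at => k; apply: continuousX_at; apply: continuousB.
    apply: (@continuous_comp _ _ _ (fun w : V4 * 'rV[R]_3 => (w.1.1, w.2)) (y k)); last first.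
      by apply: smooth_continuous (KO _ Kx').
    exact: continuous_slice.
  apply: (@continuous_comp _ _ _ fst (y k)); first exact: cvg_fst.
  by apply: smooth_continuous (KO _ Kx).
- move=> [[t x] x'] [[/= Kx Cx'] hrho].
  apply: S_gt0 => //; first by case: Kx.
  by rewrite -subr_eq0 -normr_gt0 (lt_le_trans rho0).
have [|D D0 HD] := @compact_continuous_bounded _ _ (K `*` C) (fun w => `|w.2 - w.1.2| ^+ 2) (compact_setX cK cC).
  move=> w _; apply: continuousX_at; apply: continuous_comp; last exact: norm_continuous.
  apply: continuousB; first exact: cvg_snd.
  apply: (@continuous_comp _ _ _ fst snd); [exact: cvg_fst|exact: cvg_snd].
exists (Num.min M^-1 (d / D)); first by rewrite lt_min invr_gt0 M0 divr_gt0.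
move=> t x x' Kx Kx'; have [->|xx'] := eqVneq x' x.
  by rewrite subrr normr0 expr0n mulr0 sumr_ge0// => k _; exact: sqr_ge0.
have S0 := S_gt0 _ _ _ Kx Kx' xx'.
have h2 : 0 <= `|x' - x| ^+ 2 by exact: sqr_ge0.
have [lt_rho|ge_rho] := ltP `|x' - x| rho.
  apply: (@le_trans _ _ (M^-1 * `|x' - x| ^+ 2)).
    by rewrite ler_wpM2r// ge_min lexx.
  rewrite ler_pdivrMl// -ler_pdivrMr//.
  by apply: (HM t x x') => //; rewrite distrC.
apply: (@le_trans _ _ (d / D * `|x' - x| ^+ 2)).
  by rewrite ler_wpM2r// ge_min lexx orbT.
have Cx' : C x' by case: Kx'.
apply: (@le_trans _ _ d); last by apply: (Hd ((t, x), x')).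
rewrite mulrAC ler_pdivrMr// ler_pM2l//.
by have := HD ((t, x), x') (conj Kx Cx'); rewrite ger0_norm.
Qed.

End Separation.

(** * Corrugations *)

Section NormalProjection.
Context {R : realType} {n m : nat}.
Implicit Types J : 'M[R]_(n, m).

(** The orthogonal projection onto the complement of the row space of [J]; for a Jacobian this is
    the normal space. It is smooth in [J] wherever the Gram matrix is invertible. *)
Definition nproj J : 'M[R]_m := 1%:M - J^T *m invmx (J *m J^T) *m J.

Lemma mul_nproj J : J *m J^T \in unitmx -> J *m nproj J = 0.
Proof.
move=> uG; rewrite /nproj mulmxBr mulmx1 !mulmxA.
by rewrite mulmxV// mul1mx subrr.
Qed.

Lemma tr_nproj J : (nproj J)^T = nproj J.
Proof.
rewrite /nproj linearB/= trmx1 !trmx_mul trmxK trmx_inv trmx_mul trmxK.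
by rewrite mulmxA.
Qed.

Lemma nproj_idem J : J *m J^T \in unitmx -> nproj J *m nproj J = nproj J.
Proof.
move=> uG; rewrite {1}/nproj mulmxBl mul1mx -(mulmxA _ J).
by rewrite mul_nproj// mulmx0 subr0.
Qed.

Lemma mxtrace_nproj J : J *m J^T \in unitmx -> \tr (nproj J) = m%:R - n%:R.
Proof.
move=> uG; rewrite /nproj linearB/= mxtrace1 -mulmxA mxtrace_mulC -mulmxA.
by rewrite mulVmx// mxtrace1.
Qed.

Lemma nproj_sym J i j : nproj J i j = nproj J j i.
Proof. by rewrite -[in LHS]tr_nproj mxE. Qed.

Lemma nproj_col_dot J a b : J *m J^T \in unitmx ->
  \sum_k nproj J k a * nproj J k b = nproj J a b.
Proof.
move=> uG; rewrite -[in RHS](nproj_idem uG) [RHS]mxE.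
by apply: eq_bigr => k _; rewrite [in LHS]nproj_sym.
Qed.

Lemma nproj_col_sqr J a : J *m J^T \in unitmx -> \sum_k nproj J k a ^+ 2 <= 1.
Proof.
move=> uG; under eq_bigr do rewrite expr2.
have E := nproj_col_dot a a uG; rewrite E.
have h : nproj J a a ^+ 2 <= nproj J a a.
  rewrite -{2}E (bigD1 a)//= expr2 lerDl; apply: sumr_ge0 => k _.
  by rewrite -expr2 sqr_ge0.
move: h; move: (nproj J a a) => A h; nra.
Qed.

Lemma nproj_entry J k a : J *m J^T \in unitmx -> `|nproj J k a| <= 1.
Proof.
move=> uG; have h : nproj J k a ^+ 2 <= 1.
  apply: le_trans (nproj_col_sqr a uG); rewrite (bigD1 k)//= lerDl.
  by apply: sumr_ge0 => j _; exact: sqr_ge0.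
by rewrite ler_norml; apply/andP; split; move: h; move: (nproj J k a) => x; nra.
Qed.

Lemma nproj_comb_le J a b c s : J *m J^T \in unitmx -> c ^+ 2 + s ^+ 2 = 1 ->
  \sum_k (c * nproj J k a + s * nproj J k b) ^+ 2 <= 2.
Proof.
move=> uG cs.
apply: (@le_trans _ _ (\sum_k (2 * c ^+ 2 * nproj J k a ^+ 2 + 2 * s ^+ 2 * nproj J k b ^+ 2))).
  apply: ler_sum => k _; rewrite -subr_ge0.
  rewrite (_ : _ - _ = (c * nproj J k a - s * nproj J k b) ^+ 2) ?sqr_ge0//.
  by ring.
rewrite big_split/= -!mulr_sumr.
have := nproj_col_sqr a uG; have := nproj_col_sqr b uG.
have := sqr_ge0 c; have := sqr_ge0 s.
move: (c ^+ 2) (s ^+ 2) (\sum_k _) (\sum_k _) cs => C S A B CS S0 C0 B1 A1.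
have h1 : C * A <= C by rewrite ler_piMr.
have h2 : S * B <= S by rewrite ler_piMr.
by rewrite -!mulrA -mulrDr; lra.
Qed.

End NormalProjection.

Section CoordinatePlane.
Context {R : realType}.
Implicit Types J : 'M[R]_(3, 6).

(* The minors P_aa P_bb - P_ab^2 of a projection P of rank 3 add up to
   (tr P)^2 - tr P = 6, so that one of the 36 is at least 1/6. *)
Lemma nproj_plane J : J *m J^T \in unitmx -> exists a b : 'I_6,
  a != b /\ forall c s : R, c ^+ 2 + s ^+ 2 = 1 ->
  1 / 12%:R <= \sum_k (c * nproj J k a + s * nproj J k b) ^+ 2.
Proof.
move=> uG; pose P := nproj J.
pose W a b := P a a * P b b - P a b ^+ 2.
have WS : \sum_a \sum_b W a b = 6%:R.
  have trP : \sum_a P a a = 3%:R.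
    rewrite -[LHS]/(\tr P) mxtrace_nproj//; lra.
  have -> : \sum_a \sum_b W a b = \sum_a P a a * 3%:R - \sum_a P a a.
    rewrite -sumrB; apply: eq_bigr => a _; rewrite sumrB -mulr_sumr trP; congr (_ - _).
    rewrite -(nproj_col_dot a a uG); apply: eq_bigr => k _.
    by rewrite expr2 /P [nproj J a k]nproj_sym.
  by rewrite -mulr_suml trP; lra.
have [a [b Wab]] : exists a b, 1 / 6%:R <= W a b.
  apply: contrapT => H.
  suff : \sum_a \sum_b W a b < 6%:R by rewrite WS ltxx.
  have Wlt a b : W a b < 1 / 6%:R.
    by rewrite ltNge; apply/negP => h; apply: H; exists a, b.
  have -> : (6%:R : R) = \sum_(a < 6) \sum_(b < 6) (1 / 6%:R).
    by rewrite !sumr_const !card_ord -mulrnA -(mulr_natl (1 / 6%:R)) natrM; lra.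
  have lt6 (F : 'I_6 -> R) G : (forall i, F i < G i) -> \sum_i F i < \sum_i G i.
    move=> FG; apply: ltr_sum => //; apply/hasP; exists ord0 => //.
  by apply: (lt6) => a; exact: lt6.
have Paa i : 0 <= P i i <= 1.
  rewrite -(nproj_col_dot i i uG); apply/andP; split.
    by apply: sumr_ge0 => k _; rewrite -expr2 sqr_ge0.
  by under eq_bigr do rewrite -expr2; exact: nproj_col_sqr.
exists a, b; split.
  by apply: contraTneq Wab => ->; rewrite -ltNge /W expr2 subrr; lra.
move=> c s cs.
have -> : \sum_k (c * P k a + s * P k b) ^+ 2 =
    c ^+ 2 * P a a + 2 * (c * s) * P a b + s ^+ 2 * P b b.
  rewrite -(nproj_col_dot a a uG) -(nproj_col_dot a b uG) -(nproj_col_dot b b uG).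
  rewrite !mulr_sumr -!big_split; apply: eq_bigr => k _ /=.
  by rewrite -/P; ring.
(* The least value of a positive binary form on the unit circle is at least determinant over trace;
   here the determinant is at least 1/6 and the trace at most 2, whence 1/12. *)
move: Wab (Paa a) (Paa b); rewrite /W.
move: (P a a) (P b b) (P a b) => A B C h /andP[A0 A1] /andP[B0 B1].
have AB0 : 0 < A + B.
  have : A * B <= A * 1 by rewrite ler_wpM2l.
  have := sqr_ge0 C; move: (A * B) (C ^+ 2) h => X Y h; lra.
(* (A + B) Q = (A c + C s)^2 + (C c + B s)^2 + (A B - C^2)(c^2 + s^2) *)
have E : (A + B) * (c ^+ 2 * A + 2 * (c * s) * C + s ^+ 2 * B) =
   (A * c + C * s) ^+ 2 + (C * c + B * s) ^+ 2 + (A * B - C ^+ 2) * (c ^+ 2 + s ^+ 2).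
  by ring.
rewrite cs mulr1 in E.
have := sqr_ge0 (A * c + C * s); have := sqr_ge0 (C * c + B * s).
have : A + B <= 2 by lra.
move: E; set Q := _ + _ * B; move: (_ ^+ 2) (_ ^+ 2) => U W'.
move: AB0; move: (A + B) => D D0 E D2 U0 W0.
have DQ : 1 / 6%:R <= D * Q by rewrite E; lra.
have Q0 : 0 < Q by rewrite -(pmulr_rgt0 _ D0); move: (D * Q) DQ => X; lra.
have : D * Q <= 2 * Q by rewrite ler_wpM2r// ltW.
by move: (D * Q) DQ => X; lra.
Qed.

End CoordinatePlane.

Section Gram.
Context {R : realType}.
Notation V4 := (R * 'rV[R]_3)%type.
Implicit Types (f g : V4 -> R) (z : V4) (O K : set V4) (y p q : 'I_6 -> V4 -> R).

Definition jac y z : 'M[R]_(3, 6) := \matrix_(i, k) dx i (y k) z.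

Definition gram y i j z : R := \sum_(k < 6) dx i (y k) z * dx j (y k) z.

Lemma jacE y z i j : (jac y z *m (jac y z)^T) i j = gram y i j z.
Proof. by rewrite mxE; apply: eq_bigr => k _; rewrite !mxE. Qed.

Lemma gramC y i j z : gram y i j z = gram y j i z.
Proof. by apply: eq_bigr => k _; rewrite mulrC. Qed.

Lemma gram_quad y z (h : 'rV[R]_3) :
  \sum_(k < 6) (\sum_(i < 3) h 0 i * dx i (y k) z) ^+ 2 =
  \sum_(i < 3) \sum_(j < 3) h 0 i * h 0 j * gram y i j z.
Proof.
under eq_bigr do rewrite expr2 mulr_suml.
rewrite exchange_big; apply: eq_bigr => i _ /=.
under eq_bigr do rewrite mulr_sumr.
rewrite exchange_big; apply: eq_bigr => j _ /=.
by rewrite /gram mulr_sumr; apply: eq_bigr => k _; ring.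
Qed.

Lemma unitmx_gram n m (J : 'M[R]_(n, m)) :
  (forall h : 'rV[R]_n, \sum_k (\sum_i h 0 i * J i k) ^+ 2 = 0 -> h = 0) ->
  J *m J^T \in unitmx.
Proof.
move=> H; rewrite -row_free_unit -kermx_eq0; apply/eqP/row_matrixP => i.
rewrite row0; apply: H; set h := row i _.
have h0 : h *m (J *m J^T) = 0 by rewrite /h -row_mul mulmx_ker row0.
have -> : \sum_k (\sum_i h 0 i * J i k) ^+ 2 = (h *m (J *m J^T) *m h^T) 0 0.
  rewrite mulmxA -mulmxA -trmx_mul [RHS]mxE; apply: eq_bigr => k _.
  by rewrite [in RHS]mxE expr2 !mxE.
by rewrite h0 mul0mx mxE.
Qed.

Lemma smooth_gram O y i j : open O -> (forall k, smooth O (y k)) ->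
  smooth O (gram y i j).
Proof. by move=> oO sy; apply: smooth_sum => // k _; apply: smoothM => //; exact: smooth_dx. Qed.

Lemma smooth_nproj O y k a : open O -> (forall k, smooth O (y k)) ->
  (forall z, O z -> jac y z *m (jac y z)^T \in unitmx) ->
  smooth O (fun z => nproj (jac y z) k a).
Proof.
move=> oO sy uG.
apply: (@smooth_ext _ _ _ (fun z => (k == a)%:R - \sum_j (\sum_i dx i (y k) z *
    invmx (jac y z *m (jac y z)^T) i j) * dx j (y a) z)) => //.
  move=> z _; rewrite !mxE; congr (_ - _); apply: eq_bigr => j _.
  by rewrite !mxE; congr (_ * _); apply: eq_bigr => i _; rewrite !mxE.
apply: smoothD => //; first exact: smooth_cst.
apply: smoothN => //; apply: smooth_sum => // j _; apply: smoothM => //; last exact: smooth_dx.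
apply: smooth_sum => // i _; apply: smoothM => //; first exact: smooth_dx.
apply: smooth_invmx => // i' j'.
by apply: smooth_ext (smooth_gram i' j' oO sy) => // z _; rewrite jacE.
Qed.

Lemma family_bounded O K (I : finType) (F : I -> V4 -> R) : K `<=` O -> compact K ->
  (forall i, smooth O (F i)) ->
  exists2 B, 0 < B & forall i z, K z -> `|F i z| <= B.
Proof.
move=> KO cK sF.
have H i : exists B, 0 < B /\ forall z, K z -> `|F i z| <= B.
  have [|B B0 HB] := @compact_continuous_bounded _ _ K (F i) cK; last by exists B.
  by move=> z Kz; apply: smooth_continuous (KO _ Kz).
have /choice[B HB] := H.
exists (1 + \sum_i B i); first by rewrite ltr_pwDl// sumr_ge0// => i _; rewrite ltW// (HB i).1.
move=> i z Kz; apply: (le_trans ((HB i).2 z Kz)); rewrite (bigD1 i)//=.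
have : 0 <= \sum_(j | j != i) B j by apply: sumr_ge0 => j _; rewrite ltW// (HB j).1.
lra.
Qed.

Lemma family_gt0 O K (I : finType) (F : I -> V4 -> R) : K `<=` O -> compact K ->
  (forall i, smooth O (F i)) -> (forall i z, K z -> 0 < F i z) ->
  exists2 c, 0 < c & forall i z, K z -> c <= F i z.
Proof.
move=> KO cK sF F0.
have H i : exists c, 0 < c /\ forall z, K z -> c <= F i z.
  have [||c c0 Hc] := @compact_continuous_gt0 _ _ K (F i) cK; last by exists c.
    by move=> z Kz; apply: smooth_continuous (KO _ Kz).
  by move=> z; exact: F0.
have /choice[c Hc] := H.
have S0 : 0 < 1 + \sum_i (c i)^-1.
  by rewrite ltr_pwDl// sumr_ge0// => i _; rewrite invr_ge0 ltW// (Hc i).1.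
exists (1 + \sum_i (c i)^-1)^-1; first by rewrite invr_gt0.
move=> i z Kz; apply: le_trans ((Hc i).2 z Kz).
rewrite -[leRHS]invrK lef_pV2 ?posrE ?invr_gt0 ?(Hc i).1//.
rewrite (bigD1 i)//=; set s := \sum_(j | _) _.
have : 0 <= s by apply: sumr_ge0 => j _; rewrite invr_ge0 ltW// (Hc j).1.
lra.
Qed.

Definition phase (l : 'I_3 -> R) z : R := \sum_(i < 3) l i * z.2 0 i.

Lemma differentiable_coord2 i z : differentiable (fun z : V4 => z.2 0 i) z.
Proof.
apply: (@differentiable_comp _ _ _ _ (fun z : V4 => z.2) (fun h : 'rV[R]_3 => h 0 i)).
  have c : continuous (snd : V4 -> 'rV[R]_3) by move=> w; exact: cvg_snd.
  exact: (@linear_differentiable R V4 'rV[R]_3 (snd : {linear V4 -> 'rV[R]_3}) z c).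
exact: differentiable_coord.
Qed.

Lemma derive_coord2 i z (v : V4) : 'D_v (fun z : V4 => z.2 0 i) z = v.2 0 i.
Proof.
rewrite /derive; apply: lim_near_cst => //.
near=> h; rewrite /= !mxE addrK.
rewrite /GRing.scale/= mulrA mulVf ?mul1r//.
by near: h; exact: nbhs_dnbhs_neq.
Unshelve. all: by end_near. Qed.

Lemma smooth_coord2 O i : smooth O (fun z : V4 => z.2 0 i).
Proof.
move=> k; apply: (@Ck_linear _ _ k O _ (fun v : V4 => v.2 0 i)).
  by move=> z; exact: differentiable_coord2.
by move=> z v; exact: derive_coord2.
Qed.

Lemma smooth_phase O l : open O -> smooth O (phase l).
Proof.
move=> oO; apply: smooth_sum => // i _; apply: smoothM => //; first exact: smooth_cst.
exact: smooth_coord2.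
Qed.

Lemma dx_phase l i z : dx i (phase l) z = l i.
Proof.
rewrite dx_sum => [|k]; last first.
  by apply: differentiableM; [exact: differentiable_cst|exact: differentiable_coord2].
under eq_bigr do rewrite (dxZ _ _ (differentiable_coord2 _ _)) /dx derive_coord2 /ev/= mxE.
by rewrite (bigD1 i)//= !eqxx mulr1 big1 ?addr0// => k /negbTE ki; rewrite ki mulr0.
Qed.

End Gram.

(** * The metric induced by one corrugation *)

Section Oscillation.
Context {R : realType}.
Notation V4 := (R * 'rV[R]_3)%type.
Implicit Types (f g : V4 -> R) (z : V4) (O K : set V4) (y p q : 'I_6 -> V4 -> R).
Implicit Types (l : 'I_3 -> R).

Definition corrugate y p q l (lam : R) : 'I_6 -> V4 -> R := fun k z =>
  y k z + lam^-1 * (cos (lam * phase l z) * p k z + sin (lam * phase l z) * q k z).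

(** The part of the derivative that comes from the phase: its factor [lam] cancels the amplitude
    [lam^-1], so that it has order one. The derivatives of [p] and [q], collected in [loop_err],
    keep the factor [lam^-1]. *)
Definition loop p q l lam k z : R :=
  - sin (lam * phase l z) * p k z + cos (lam * phase l z) * q k z.

Definition loop_err p q l lam i k z : R :=
  cos (lam * phase l z) * dx i (p k) z + sin (lam * phase l z) * dx i (q k) z.

Lemma smooth_corrugate O y p q l lam k : open O -> (forall k, smooth O (y k)) ->
  (forall k, smooth O (p k)) -> (forall k, smooth O (q k)) ->
  smooth O (corrugate y p q l lam k).
Proof.
move=> oO sy sp sq.
have sph : smooth O (fun z => lam * phase l z).
  by apply: smoothM => //; [exact: smooth_cst|exact: smooth_phase].
apply: smoothD => //; apply: smoothM => //; first exact: smooth_cst.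
by apply: smoothD => //; apply: smoothM => //; [exact: smooth_cos|exact: smooth_sin].
Qed.

Lemma smooth_loop O p q l lam k : open O ->
  (forall k, smooth O (p k)) -> (forall k, smooth O (q k)) ->
  smooth O (loop p q l lam k).
Proof.
move=> oO sp sq.
have sph : smooth O (fun z => lam * phase l z).
  by apply: smoothM => //; [exact: smooth_cst|exact: smooth_phase].
by apply: smoothD => //; apply: smoothM => //; [apply: smoothN => //; exact: smooth_sin|exact: smooth_cos].
Qed.

Lemma dx_corrugate O y p q l lam i k z : open O -> (forall k, smooth O (y k)) ->
  (forall k, smooth O (p k)) -> (forall k, smooth O (q k)) -> lam != 0 -> O z ->
  dx i (corrugate y p q l lam k) z =
  dx i (y k) z + l i * loop p q l lam k z + lam^-1 * loop_err p q l lam i k z.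
Proof.
move=> oO sy sp sq lam0 Oz.
have d f : smooth O f -> differentiable f z by move=> sf; exact: smooth_diff sf Oz.
have sph : smooth O (fun z => lam * phase l z).
  by apply: smoothM => //; [exact: smooth_cst|exact: smooth_phase].
have sc := smooth_cos oO sph; have ss := smooth_sin oO sph.
have dph : dx i (fun z => lam * phase l z) z = lam * l i.
  by rewrite dxZ ?dx_phase//; apply: d; exact: smooth_phase.
have dc : dx i (fun z => cos (lam * phase l z)) z = - sin (lam * phase l z) * (lam * l i).
  have [_ E] := derive_comp1 (phi := cos) (ev i) (d _ sph) (is_derive_cos _).
  by rewrite -dph -E.
have ds : dx i (fun z => sin (lam * phase l z)) z = cos (lam * phase l z) * (lam * l i).
  have [_ E] := derive_comp1 (phi := sin) (ev i) (d _ sph) (is_derive_sin _).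
  by rewrite -dph -E.
have scp : smooth O (fun z => cos (lam * phase l z) * p k z) by exact: smoothM.
have ssq : smooth O (fun z => sin (lam * phase l z) * q k z) by exact: smoothM.
have scs := smoothD oO scp ssq.
rewrite dxD; [|exact: d|by apply: d; apply: smoothM => //; exact: smooth_cst].
rewrite (dxZ _ _ (d _ scs)) (dxD _ (d _ scp) (d _ ssq)).
rewrite (dxM _ (d _ sc) (d _ (sp k))) (dxM _ (d _ ss) (d _ (sq k))) dc ds.
by rewrite /loop /loop_err; field.
Qed.

Definition gram_err y p q l lam i j z : R :=
  \sum_(k < 6) ((dx i (y k) z + l i * loop p q l lam k z) * loop_err p q l lam j k z
   + loop_err p q l lam i k z * (dx j (y k) z + l j * loop p q l lam k z)
   + lam^-1 * (loop_err p q l lam i k z * loop_err p q l lam j k z)).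

(** The terms of order one that couple the tangent vectors of [y] with the loop vanish, the loop
    being a combination of normals; besides its square only terms with a factor [lam^-1] are
    left. *)
Lemma gram_corrugate O y p q l lam i j z : open O -> (forall k, smooth O (y k)) ->
  (forall k, smooth O (p k)) -> (forall k, smooth O (q k)) -> lam != 0 -> O z ->
  (forall i, \sum_(k < 6) p k z * dx i (y k) z = 0) ->
  (forall i, \sum_(k < 6) q k z * dx i (y k) z = 0) ->
  gram (corrugate y p q l lam) i j z =
  gram y i j z + l i * l j * \sum_(k < 6) loop p q l lam k z ^+ 2
  + lam^-1 * gram_err y p q l lam i j z.
Proof.
move=> oO sy sp sq lam0 Oz pn qn.
have wn i' : \sum_(k < 6) loop p q l lam k z * dx i' (y k) z = 0.
  rewrite /loop; move: (lam * phase l z) => th.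
  transitivity (- sin th * (\sum_(k < 6) p k z * dx i' (y k) z) +
      cos th * (\sum_(k < 6) q k z * dx i' (y k) z)).
    rewrite !mulr_sumr -big_split; apply: eq_bigr => k _ /=.
    by ring.
  by rewrite pn qn !mulr0 addr0.
have E : gram (corrugate y p q l lam) i j z =
  gram y i j z + l i * l j * \sum_(k < 6) loop p q l lam k z ^+ 2
  + lam^-1 * gram_err y p q l lam i j z +
  (l j * (\sum_(k < 6) loop p q l lam k z * dx i (y k) z) +
   l i * (\sum_(k < 6) loop p q l lam k z * dx j (y k) z)).
  rewrite /gram /gram_err !mulr_sumr -!big_split; apply: eq_bigr => k _ /=.
  rewrite (dx_corrugate l i k oO sy sp sq lam0 Oz) (dx_corrugate l j k oO sy sp sq lam0 Oz).
  move: (dx i (y k) z) (dx j (y k) z) (loop p q l lam k z) (l i) (l j) (lam^-1).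
  move: (loop_err p q l lam i k z) (loop_err p q l lam j k z) => e e' a b w c d n.
  by ring.
rewrite E (wn i) (wn j); move: (gram _ _ _ _) (_ * gram_err _ _ _ _ _ _ _ _) (_ * \sum_(k < 6) _) => a b c.
by rewrite !mulr0 !addr0.
Qed.

Lemma cos_sin_comb (B a b t : R) : `|a| <= B -> `|b| <= B ->
  `|cos t * a + sin t * b| <= 2 * B /\ `|- sin t * a + cos t * b| <= 2 * B.
Proof.
move=> aB bB.
have H (c u : R) : `|c| <= 1 -> `|u| <= B -> `|c * u| <= B.
  by move=> c1 uB; rewrite normrM -[B]mul1r ler_pM.
have c1 : `|cos t| <= 1 by rewrite ler_norml cos_geN1 cos_le1.
have s1 : `|sin t| <= 1 by rewrite ler_norml sin_geN1 sin_le1.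
have := H _ _ c1 aB; have := H _ _ s1 bB; have := H _ _ s1 aB; have := H _ _ c1 bB.
rewrite mulNr; split.
  by apply: (le_trans (ler_normD _ _)); lra.
by apply: (le_trans (ler_normD _ _)); rewrite normrN; lra.
Qed.

(** The bound is free of [lam]: cosine and sine are at most 1, and so is the [lam^-1] inside the
    error. Hence [lam] can be chosen after it. *)
Lemma gram_err_le y p q l lam i j z B L : 1 <= lam -> 0 <= B -> 0 <= L ->
  (forall i, `|l i| <= L) ->
  (forall i k, `|dx i (y k) z| <= B) ->
  (forall k, `|p k z| <= B) -> (forall k, `|q k z| <= B) ->
  (forall i k, `|dx i (p k) z| <= B) -> (forall i k, `|dx i (q k) z| <= B) ->
  `|gram_err y p q l lam i j z| <= 24%:R * (B + L * (2 * B)) * B + 24%:R * B ^+ 2.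
Proof.
move=> lam1 B0 L0 lL yB pB qB dpB dqB.
have eB i' k : `|loop_err p q l lam i' k z| <= 2 * B by have [] := cos_sin_comb (lam * phase l z) (dpB i' k) (dqB i' k).
have wB k : `|loop p q l lam k z| <= 2 * B by have [] := cos_sin_comb (lam * phase l z) (pB k) (qB k).
have AB i' k : `|dx i' (y k) z + l i' * loop p q l lam k z| <= B + L * (2 * B).
  by apply: (le_trans (ler_normD _ _)); rewrite lerD// normrM ler_pM.
apply: (le_trans (ler_norm_sum _ _ _)).
apply: (@le_trans _ _ (\sum_(k < 6) (4 * (B + L * (2 * B)) * B + 4 * B ^+ 2))); last first.
  by rewrite sumr_const card_ord -(mulr_natl (_ + _)); lra.
apply: ler_sum => k _.
have h1 : `|(dx i (y k) z + l i * loop p q l lam k z) * loop_err p q l lam j k z| <= (B + L * (2 * B)) * (2 * B).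
  by rewrite normrM ler_pM.
have h2 : `|loop_err p q l lam i k z * (dx j (y k) z + l j * loop p q l lam k z)| <= (2 * B) * (B + L * (2 * B)).
  by rewrite normrM ler_pM.
have h3 : `|lam^-1 * (loop_err p q l lam i k z * loop_err p q l lam j k z)| <= 1 * ((2 * B) * (2 * B)).
  rewrite normrM; apply: ler_pM => //; last by rewrite normrM ler_pM.
  by rewrite ger0_norm ?invr_ge0 ?invf_le1 ?(le_trans ler01)// (lt_le_trans ltr01).
apply: (le_trans (ler_normD _ _)); apply: (@le_trans _ _ ((B + L * (2 * B)) * (2 * B) + (2 * B) * (B + L * (2 * B)) + 1 * ((2 * B) * (2 * B)))).
  by apply: lerD => //; apply: (le_trans (ler_normD _ _)); exact: lerD.
rewrite expr2; lra.
Qed.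

End Oscillation.

(** * One corrugation of a short map *)

Section Step.
Context {R : realType}.
Notation V4 := (R * 'rV[R]_3)%type.
Implicit Types (f g : V4 -> R) (z : V4) (O K : set V4) (y p q : 'I_6 -> V4 -> R).
Context (K : set V4) (gs : 'I_3 -> 'I_3 -> V4 -> R) (I : finType)
  (l : I -> 'I_3 -> R).
Hypothesis cK : compact K.

Definition immersion_bound y (m : R) := forall z (h : 'rV[R]_3), K z ->
  m * `|h| ^+ 2 <= \sum_(k < 6) (\sum_(i < 3) h 0 i * dx i (y k) z) ^+ 2.

(* The metric defect gs - gram y is a positive combination of the primitive
   metrics l_k (x) l_k. *)
Definition short_map (m : R) y (r : I -> V4 -> R) := exists O,
  [/\ open O /\ K `<=` O,
      (forall k, smooth O (y k)) /\ (forall k, smooth O (r k)),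
      forall k z, K z -> 0 < r k z,
      forall z i j, O z -> gram y i j z + \sum_k r k z * l k i * l k j = gs i j z
    & immersion_bound y m /\ separated K y].

(** The coefficients are linear in [E] and of any sign: they serve to absorb small symmetric errors
    into coefficients that are already positive. *)
Definition spanning := exists c : I -> 'I_3 -> 'I_3 -> R,
  forall E : 'I_3 -> 'I_3 -> R, (forall i j, E i j = E j i) ->
  forall i j, \sum_k (\sum_a \sum_b c k a b * E a b) * l k i * l k j = E i j.

Lemma immersion_unit y m z : 0 < m -> immersion_bound y m -> K z ->
  jac y z *m (jac y z)^T \in unitmx.
Proof.
move=> m0 my Kz; apply: unitmx_gram => h H.
have := my z h Kz; under eq_bigr do under eq_bigr do rewrite -[dx _ (y _) z](mxE matrix_key (fun i k => dx i (y k) z)).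
rewrite -/(jac y z) H => h0; apply/eqP; rewrite -normr_eq0 -sqrf_eq0 eq_le sqr_ge0 andbT.
by rewrite -(pmulr_rle0 _ m0).
Qed.

Lemma sum2_bound (c E : 'I_3 -> 'I_3 -> R) B : (forall a b, `|E a b| <= B) ->
  `|\sum_a \sum_b c a b * E a b| <= (\sum_a \sum_b `|c a b|) * B.
Proof.
move=> EB; apply: (le_trans (ler_norm_sum _ _ _)); rewrite mulr_suml.
apply: ler_sum => a _; apply: (le_trans (ler_norm_sum _ _ _)); rewrite mulr_suml.
by apply: ler_sum => b _; rewrite normrM ler_wpM2l.
Qed.

Lemma quad3_bound (X : 'I_3 -> 'I_3 -> R) (h : 'rV[R]_3) B :
  (forall i j, `|X i j| <= B) ->
  `|\sum_(i < 3) \sum_(j < 3) h 0 i * h 0 j * X i j| <= 9%:R * B * `|h| ^+ 2.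
Proof.
move=> XB; apply: (le_trans (ler_norm_sum _ _ _)).
apply: (@le_trans _ _ (\sum_(i < 3) \sum_(j < 3) `|h| ^+ 2 * B)); last first.
  by rewrite !sumr_const !card_ord -mulrnA -(mulr_natl (_ * B)) natrM; lra.
apply: ler_sum => i _; apply: (le_trans (ler_norm_sum _ _ _)).
apply: ler_sum => j _; rewrite normrM ler_pM// normrM expr2 ler_pM//; exact: ler_coord.
Qed.

(* One corrugation along the l k0 direction. The normals are projections of the
   fixed coordinate vectors a and b, so that they exist globally and smoothly;
   as they are not orthonormal, only a fraction of r k0 is removed. *)
Lemma step (m : R) y r k0 (a b : 'I_6) (kappa eps : R) : 0 < m -> spanning ->
  short_map m y r -> 0 < kappa -> kappa <= 1 / 4 -> 0 < eps ->
  exists y' r', short_map (m - eps) y' r' /\ forall z, K z ->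
  [/\ forall k, `|y' k z - y k z| <= eps,
      forall i k, `|dx i (y' k) z - dx i (y k) z| <=
        `|l k0 i| * (2 * Num.sqrt (kappa * r k0 z)) + eps,
      forall k, k != k0 -> `|r' k z - r k z| <= eps
    & exists c s : R, c ^+ 2 + s ^+ 2 = 1 /\
      `|r' k0 z - r k0 z * (1 - kappa * \sum_k (c * nproj (jac y z) k a + s * nproj (jac y z) k b) ^+ 2)| <= eps].
Proof.
move=> m0 [c Hc] [ O [[oO KO] [sy sr] r0 defect [my ysep]]] kap0 kap4 eps0.
pose D z := \det (jac y z *m (jac y z)^T).
have sD : smooth O D.
  apply: smooth_det => // i j; apply: smooth_ext (smooth_gram i j oO sy) => // z _.
  by rewrite jacE.
(* Here the amplitude and the normal projection are smooth. That the determinant [D] is nonzero is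
   written as positivity of its square, which is an open condition by [open_gt0]. *)
pose O1 := (O `&` [set z | 0 < r k0 z]) `&` [set z | 0 < D z ^+ 2].
have oO1' : open (O `&` [set z | 0 < r k0 z]) by exact: open_gt0.
have OO1' : O `&` [set z | 0 < r k0 z] `<=` O by move=> z [].
have oO1 : open O1.
  by apply: open_gt0 => //; apply: smoothX => //; exact: smooth_sub OO1' sD.
have O1O : O1 `<=` O by move=> z [[]].
have KO1 : K `<=` O1.
  move=> z Kz; split; first by split; [exact: KO|exact: r0].
  rewrite /= lt_def sqr_ge0 andbT sqrf_eq0 -unitfE -unitmxE.
  exact: immersion_unit m0 my Kz.
have uG z : O1 z -> jac y z *m (jac y z)^T \in unitmx.
  by move=> [_ /=]; rewrite unitmxE unitfE lt_def sqrf_eq0 => /andP[].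
have sy1 k : smooth O1 (y k) by exact: smooth_sub O1O (sy k).
have sr1 k : smooth O1 (r k) by exact: smooth_sub O1O (sr k).
(* The squared length of the loop is then [kappa * r k0 z] times that of a projected unit vector, so
   that the proportion removed from [r k0] does not depend on its size. *)
pose al z := Num.sqrt (kappa * r k0 z).
have sal : smooth O1 al.
  apply: smooth_sqrt => //; last by apply: smoothM => //; exact: smooth_cst.
  by move=> z [[_ /= rz] _]; rewrite mulr_gt0.
pose pp e k z := al z * nproj (jac y z) k e.
have spp e k : smooth O1 (pp e k).
  by apply: smoothM => //; apply: smooth_nproj.
have npp e z i : O1 z ->
    \sum_(k < 6) pp e k z * dx i (y k) z = 0.
  move=> Oz; have /matrixP /(_ i e) := mul_nproj (uG z Oz).
  rewrite [LHS]mxE [RHS]mxE => H.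
  transitivity (al z * \sum_k jac y z i k * nproj (jac y z) k e); last by rewrite H mulr0.
  by rewrite mulr_sumr; apply: eq_bigr => k _; rewrite /pp [jac _ _ _ _]mxE; ring.
have [Ls Ls0 HLs] := separated_perturb oO1 KO1 cK sy1 (spp a) (spp b) (npp a) (npp b) ysep.
have [B1 B10 HB1] := @family_bounded _ O1 K _ (fun ik : 'I_3 * 'I_6 => dx ik.1 (y ik.2)) KO1 cK (fun ik => smooth_dx _ (sy1 _)).
have [B2 B20 HB2] := @family_bounded _ O1 K _ (fun ek : 'I_6 * 'I_6 => pp ek.1 ek.2) KO1 cK (fun ek => spp _ _).
have [B3 B30 HB3] := @family_bounded _ O1 K _ (fun w : 'I_3 * ('I_6 * 'I_6) => dx w.1 (pp w.2.1 w.2.2)) KO1 cK (fun w => smooth_dx _ (spp _ _)).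
have [rho rho0 Hrho] := family_gt0 KO1 cK sr1 r0.
pose B := B1 + B2 + B3.
have B0 : 0 < B by rewrite !addr_gt0.
pose L := \sum_i `|l k0 i|.
have L0 : 0 <= L by apply: sumr_ge0.
have lL i : `|l k0 i| <= L.
  by rewrite /L (bigD1 i)//= lerDl; apply: sumr_ge0.
pose BX := 24%:R * (B + L * (2 * B)) * B + 24%:R * B ^+ 2.
have BX0 : 0 <= BX.
  by rewrite addr_ge0// ?mulr_ge0 ?sqr_ge0// ?addr_ge0 ?mulr_ge0// ltW.
pose cb := \sum_k \sum_i \sum_j `|c k i j|.
have cb0 : 0 <= cb by do 3 (apply: sumr_ge0 => ? _).
(* All that gets divided by [lam]: displacement and derivative error (2 B), change of the
   coefficients (cb BX), change of the quadratic form (9 BX). *)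
pose M0 := 2 * B + cb * BX + 9%:R * BX.
(* Since r'_k is at least r_k / 2 minus a correction of size [mu], the bound rho / 4 keeps it
   positive. *)
pose mu := Num.min eps (rho / 4).
have mu0 : 0 < mu by rewrite lt_min eps0 divr_gt0.
have M00 : 0 < M0.
  have : 0 <= cb * BX by rewrite mulr_ge0.
  rewrite /M0; lra.
pose lam := Ls + 1 + M0 / mu.
have lam1 : 1 <= lam.
  by rewrite /lam -addrA addrCA lerDl addr_ge0 ?divr_ge0 ?(ltW Ls0) ?(ltW M00) ?(ltW mu0).
have lam0 : 0 < lam by exact: lt_le_trans ltr01 lam1.
have lamn : lam != 0 by rewrite gt_eqF.
have lamM : lam^-1 * M0 <= mu.
  rewrite ler_pdivrMl// -ler_pdivrMr// /lam lerDr addr_ge0 ?(ltW Ls0)//.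
have lamX X : 0 <= X -> X <= M0 -> lam^-1 * X <= mu.
  move=> X0 XM; apply: le_trans lamM; rewrite ler_wpM2l// invr_ge0 ltW//.
pose y' := corrugate y (pp a) (pp b) (l k0) lam.
have sy' k : smooth O1 (y' k) by exact: smooth_corrugate.
pose w k z := loop (pp a) (pp b) (l k0) lam k z.
pose s2 z := \sum_(k < 6) w k z ^+ 2.
have ss2 : smooth O1 s2.
  by apply: smooth_sum => // k _; apply: smoothX => //; exact: smooth_loop.
pose E i j z := gram y' i j z - gram y i j z - l k0 i * l k0 j * s2 z.
have sE i j : smooth O1 (E i j).
  apply: smoothD => //; last apply: smoothN => //.
    by apply: smoothD => //; [exact: smooth_gram|apply: smoothN => //; exact: smooth_gram].
  by apply: smoothM => //; exact: smooth_cst.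
have EX i j z : O1 z -> E i j z = lam^-1 * gram_err y (pp a) (pp b) (l k0) lam i j z.
  move=> Oz; rewrite /E /y' (gram_corrugate (l k0) i j oO1 sy1 (spp a) (spp b) lamn Oz) => [|i'|i'].
  - rewrite -/(s2 z); move: (gram y i j z) (_ * s2 z) (lam^-1 * _) => u v x; ring.
  - exact: npp.
  - exact: npp.
pose dr k z := \sum_i \sum_j c k i j * E i j z.
have sdr k : smooth O1 (dr k).
  apply: smooth_sum => // i _; apply: smooth_sum => // j _; apply: smoothM => //.
  exact: smooth_cst.
pose r' k z := r k z - (k == k0)%:R * s2 z - dr k z.
have sr' k : smooth O1 (r' k).
  apply: smoothD => //; last exact: smoothN.
  apply: smoothD => //; apply: smoothN => //; apply: smoothM => //; exact: smooth_cst.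
have BB z i k e : K z -> [/\ `|dx i (y k) z| <= B, `|pp e k z| <= B & `|dx i (pp e k) z| <= B].
  move=> Kz; split.
  - by apply: (le_trans (HB1 (i, k) z Kz)); rewrite /B; lra.
  - by apply: (le_trans (HB2 (e, k) z Kz)); rewrite /B; lra.
  - by apply: (le_trans (HB3 (i, (e, k)) z Kz)); rewrite /B; lra.
have errB i j z : K z -> `|gram_err y (pp a) (pp b) (l k0) lam i j z| <= BX.
  move=> Kz; apply: gram_err_le => //; first exact: ltW.
  - by move=> i' k; have [] := BB z i' k a Kz.
  - by move=> k; have [] := BB z 0 k a Kz.
  - by move=> k; have [] := BB z 0 k b Kz.
  - by move=> i' k; have [] := BB z i' k a Kz.
  - by move=> i' k; have [] := BB z i' k b Kz.
have EB i j z : K z -> `|E i j z| <= lam^-1 * BX.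
  by move=> Kz; rewrite EX; [rewrite normrM gtr0_norm ?invr_gt0// ler_wpM2l ?errB// invr_ge0 ltW|exact: KO1].
have drB k z : K z -> `|dr k z| <= mu.
  move=> Kz; apply: (le_trans (sum2_bound _ (fun i j => EB i j z Kz))).
  apply: (@le_trans _ _ (lam^-1 * (cb * BX))).
    rewrite mulrCA ler_wpM2l ?invr_ge0 ?(ltW lam0)// ler_wpM2r// /cb [leRHS](bigD1 k)//= lerDl.
    by do 3 (apply: sumr_ge0 => ? _).
  apply: lamX; first by rewrite mulr_ge0.
  by rewrite /M0; have := BX0; have := ltW B0; lra.
have mueps : mu <= eps by rewrite ge_min lexx.
have murho : mu <= rho / 4 by rewrite ge_min lexx orbT.
have s2E z : O1 z -> s2 z = r k0 z * (kappa *
   \sum_k (- sin (lam * phase (l k0) z) * nproj (jac y z) k a + cos (lam * phase (l k0) z) * nproj (jac y z) k b) ^+ 2).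
  move=> Oz; have al2 : al z ^+ 2 = kappa * r k0 z.
    by rewrite sqr_sqrtr// ltW// mulr_gt0//; case: Oz => [[]].
  rewrite mulrA [r k0 z * kappa]mulrC -al2 mulr_sumr; apply: eq_bigr => k _.
  rewrite /w /loop /pp -exprMn; congr (_ ^+ 2).
  by move: (sin _) (cos _) (al z) (nproj _ _ _) (nproj _ _ _) => s0 c0 u v x; ring.
have cs1 z : (- sin (lam * phase (l k0) z)) ^+ 2 + cos (lam * phase (l k0) z) ^+ 2 = 1.
  by rewrite sqrrN addrC cos2Dsin2.
have s2_le z : K z -> 0 <= s2 z <= r k0 z / 2.
  move=> Kz; apply/andP; split; first by apply: sumr_ge0 => k _; exact: sqr_ge0.
  rewrite s2E; last exact: KO1.
  rewrite ler_wpM2l ?(ltW (r0 _ _ Kz))//.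
  (* The projected vector has squared length at most 2 and kappa <= 1/4, so that at least half of
     [r k0] is kept. *)
  have := nproj_comb_le a b (uG _ (KO1 _ Kz)) (cs1 z); set S := \sum_k _ => S2.
  have S0 : 0 <= S by apply: sumr_ge0 => k _; exact: sqr_ge0.
  apply: (@le_trans _ _ (1 / 4 * 2)); last lra.
  by apply: ler_pM => //; exact: ltW.
exists y', r'; split.
  exists O1; split => //.
  - move=> k z Kz; have := drB k z Kz; rewrite ler_norml => /andP[d1 d2].
    have := s2_le z Kz => /andP[s0 s1]; have := Hrho k z Kz; rewrite /r'.
    have [->|kk0] := eqVneq k k0; rewrite ?mul1r ?mul0r.
      have := Hrho k0 z Kz; have := drB k0 z Kz; rewrite ler_norml => /andP[d1' d2'].
      by lra.
    by lra.
  - move=> z i j Oz; rewrite -(defect z i j (O1O _ Oz)).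
    have Esym i' j' : E i' j' z = E j' i' z.
      by rewrite /E (gramC y') (gramC y) (mulrC (l k0 i')).
    have -> : \sum_k r' k z * l k i * l k j = \sum_k r k z * l k i * l k j
        - \sum_k (k == k0)%:R * s2 z * l k i * l k j - \sum_k dr k z * l k i * l k j.
      rewrite -!sumrB; apply: eq_bigr => k _; rewrite /r'.
      by move: (r k z) (s2 z) (dr k z) (l k i) (l k j) (_%:R) => v1 v2 v3 v4 v5 v6; ring.
    rewrite (Hc (fun i j => E i j z) Esym).
    have -> : \sum_k (k == k0)%:R * s2 z * l k i * l k j = s2 z * l k0 i * l k0 j.
      rewrite (bigD1 k0)//= eqxx mul1r big1 ?addr0// => k /negbTE ->.
      by rewrite !mul0r.
    rewrite /E; move: (gram y' i j z) (gram y i j z) (s2 z) (l k0 i) (l k0 j) => v1 v2 v3 v4 v5.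
    by move: (\sum_k _) => v6; ring.
  - split.
      move=> z h Kz; rewrite gram_quad.
      have Oz := KO1 _ Kz.
      have -> : \sum_(i < 3) \sum_(j < 3) h 0 i * h 0 j * gram y' i j z =
        \sum_(i < 3) \sum_(j < 3) h 0 i * h 0 j * gram y i j z
        + s2 z * (\sum_(i < 3) h 0 i * l k0 i) ^+ 2
        + \sum_(i < 3) \sum_(j < 3) h 0 i * h 0 j * E i j z.
        have -> (v : R) : v * (\sum_(i < 3) h 0 i * l k0 i) ^+ 2 =
            \sum_(i < 3) \sum_(j < 3) h 0 i * h 0 j * (l k0 i * l k0 j * v).
          rewrite expr2 big_distrlr/= mulr_sumr; apply: eq_bigr => i _.
          by rewrite mulr_sumr; apply: eq_bigr => j _; ring.
        rewrite -!big_split; apply: eq_bigr => i _ /=.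
        rewrite -!big_split; apply: eq_bigr => j _ /=.
        rewrite /E; move: (gram y' i j z) (gram y i j z) (s2 z) (l k0 i) (l k0 j) => v1 v2 v3 v4 v5.
        by move: (h 0 i) (h 0 j) => v6 v7; ring.
      rewrite -gram_quad mulrBl -addrA lerD//; first exact: my.
      have := quad3_bound h (fun i j => EB i j z Kz).
      rewrite ler_norml => /andP[+ _].
      have : 9%:R * (lam^-1 * BX) * `|h| ^+ 2 <= eps * `|h| ^+ 2.
        rewrite ler_wpM2r ?sqr_ge0// mulrCA (le_trans _ mueps)// lamX ?mulr_ge0//.
        have : 0 <= cb * BX by rewrite mulr_ge0.
        by rewrite /M0; have := ltW B0; lra.
      have : 0 <= s2 z * (\sum_(i < 3) h 0 i * l k0 i) ^+ 2.
        by rewrite mulr_ge0 ?sqr_ge0//; have /andP[] := s2_le z Kz.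
      move=> a1 a2 a3; rewrite -[leLHS]add0r; apply: lerD => //; apply: le_trans a3.
      by rewrite lerN2.
    apply: HLs => [|z|z].
    + by rewrite /lam -addrA lerDl addr_ge0// divr_ge0// ltW.
    + by rewrite ler_norml cos_geN1 cos_le1.
    + by rewrite ler_norml sin_geN1 sin_le1.
move=> z Kz; have Oz := KO1 _ Kz; split.
- move=> k; rewrite /y' /corrugate addrAC subrr add0r normrM gtr0_norm ?invr_gt0//.
  have [_ pa _] := BB z 0 k a Kz; have [_ pb _] := BB z 0 k b Kz.
  have [h _] := cos_sin_comb (lam * phase (l k0) z) pa pb.
  apply: (@le_trans _ _ (lam^-1 * (2 * B))); first by rewrite ler_wpM2l// invr_ge0 ltW.
  apply: le_trans mueps; apply: lamX; first by rewrite mulr_ge0// ltW.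
  have : 0 <= cb * BX by rewrite mulr_ge0.
  by rewrite /M0; lra.
- move=> i k; rewrite /y' (dx_corrugate (l k0) i k oO1 sy1 (spp a) (spp b) lamn Oz).
  have -> (v1 v2 v3 : R) : v1 + v2 + v3 - v1 = v2 + v3 by ring.
  rewrite (le_trans (ler_normD _ _))//; apply: lerD.
    rewrite normrM ler_wpM2l//.
    have al0 : 0 <= al z by exact: sqrtr_ge0.
    have ppal e : `|pp e k z| <= al z.
      by rewrite /pp normrM ger0_norm// ler_piMr// nproj_entry//; exact: uG.
    by have [_] := cos_sin_comb (lam * phase (l k0) z) (ppal a) (ppal b).
  rewrite normrM gtr0_norm ?invr_gt0//.
  have [_ _ pa] := BB z i k a Kz; have [_ _ pb] := BB z i k b Kz.
  have [h _] := cos_sin_comb (lam * phase (l k0) z) pa pb.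
  apply: (@le_trans _ _ (lam^-1 * (2 * B))); first by rewrite ler_wpM2l// invr_ge0 ltW.
  apply: le_trans mueps; apply: lamX; first by rewrite mulr_ge0// ltW.
  have : 0 <= cb * BX by rewrite mulr_ge0.
  by rewrite /M0; lra.
- move=> k /negbTE kk0; rewrite /r' kk0 mul0r subr0 addrAC subrr add0r normrN.
  exact: le_trans (drB k z Kz) mueps.
(* The direction of the loop at this phase. It turns rapidly with the point, so that lower bounds on
   its length have to be uniform over the unit circle. *)
exists (- sin (lam * phase (l k0) z)), (cos (lam * phase (l k0) z)); split => //.
rewrite /r' eqxx mul1r (s2E z Oz).
have Er (v1 v2 v3 : R) : v1 - v1 * v2 - v3 - v1 * (1 - v2) = - v3 by ring.
by rewrite Er normrN (le_trans (drB _ _ Kz)).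
Qed.

End Step.

(** * Stability of good normal planes under a drift of the Jacobian *)

Section Drift.
Context {R : realType}.

(** Pythagoras for u = P u + (u - P u), where P is the normal projection. *)
Lemma sqr_norm_mul_nproj n m (J : 'M[R]_(n, m)) (u : 'cV[R]_m) :
  J *m J^T \in unitmx ->
  \sum_k (nproj J *m u) k 0 ^+ 2 <= \sum_k u k 0 ^+ 2 /\
  \sum_k (u - nproj J *m u) k 0 ^+ 2 <= \sum_k u k 0 ^+ 2.
Proof.
move=> uG; set v := nproj J *m u.
have vu : \sum_k v k 0 * (u - v) k 0 = 0.
  transitivity ((v^T *m (u - v)) 0 0).
    by rewrite mxE; apply: eq_bigr => k _; rewrite [v^T _ _]mxE.
  rewrite /v trmx_mul tr_nproj mulmxBr -!mulmxA [nproj J *m (nproj J *m u)]mulmxA.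
  by rewrite nproj_idem// subrr mxE.
have E : \sum_k u k 0 ^+ 2 = \sum_k v k 0 ^+ 2 + \sum_k (u - v) k 0 ^+ 2.
  transitivity (\sum_k v k 0 ^+ 2 + \sum_k (u - v) k 0 ^+ 2 +
      2 * \sum_k v k 0 * (u - v) k 0); last by rewrite vu mulr0 addr0.
  rewrite mulr_sumr -!big_split; apply: eq_bigr => k _ /=.
  by rewrite [(u - v) k 0]mxE [(- v) k 0]mxE; move: (u k 0) (v k 0) => x z; ring.
have h1 : 0 <= \sum_k v k 0 ^+ 2 by apply: sumr_ge0 => k _; exact: sqr_ge0.
have h2 : 0 <= \sum_k (u - v) k 0 ^+ 2 by apply: sumr_ge0 => k _; exact: sqr_ge0.
by rewrite E; split; rewrite ?lerDl ?lerDr.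
Qed.

(** Write u = P u + J^T v with P = [nproj J]. The projection for [J0] annihilates J0^T v, which
    leaves (J - J0)^T v; the immersion bound controls [v] by m |v|^2 <= 1. The constant is 108 = 2 .
    6 . 3^2: six components, each a sum of three terms, and 2 from the square of a sum. *)
Lemma nproj_drift (J J0 : 'M[R]_(3, 6)) (u : 'cV[R]_6) (m eta : R) :
  J *m J^T \in unitmx -> J0 *m J0^T \in unitmx -> 0 < m ->
  (forall h : 'rV[R]_3, m * `|h| ^+ 2 <= \sum_k (\sum_i h 0 i * J i k) ^+ 2) ->
  (forall i k, `|J i k - J0 i k| <= eta) ->
  \sum_k u k 0 ^+ 2 <= 1 ->
  \sum_k (nproj J0 *m u) k 0 ^+ 2 <=
  2 * \sum_k (nproj J *m u) k 0 ^+ 2 + 108%:R * eta ^+ 2 / m.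
Proof.
move=> uJ uJ0 m0 mJ JJ0 u1.
pose v : 'cV[R]_3 := invmx (J *m J^T) *m (J *m u).
have uE : u = nproj J *m u + J^T *m v.
  by rewrite /nproj mulmxBl mul1mx /v !mulmxA subrK.
pose d := (J - J0)^T *m v.
have P0u : nproj J0 *m u = nproj J0 *m (nproj J *m u) + nproj J0 *m d.
  rewrite {1}uE mulmxDr; congr (_ + _).
  rewrite /d [(J - J0)^T](_ : _ = J^T - J0^T); last by apply/matrixP => i k; rewrite !mxE.
  rewrite (mulmxBl J^T J0^T v) mulmxBr [X in _ = _ - X](_ : _ = 0) ?subr0//.
  by rewrite mulmxA -[nproj J0]tr_nproj -trmx_mul mul_nproj// trmx0 mul0mx.
have v1 : m * `|v^T| ^+ 2 <= 1.
  apply: (le_trans (mJ v^T)); apply: le_trans u1.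
  have [_] := sqr_norm_mul_nproj u uJ; apply: le_trans.
  apply: ler_sum => k _.
  suff -> : (u - nproj J *m u) k 0 = \sum_i v^T 0 i * J i k by [].
  rewrite {1}uE addrAC subrr add0r mxE; apply: eq_bigr => i _.
  by rewrite [in LHS]mxE [in RHS]mxE mulrC.
have dle : \sum_k d k 0 ^+ 2 <= 54%:R * eta ^+ 2 / m.
  have eta0 : 0 <= eta by apply: le_trans (JJ0 0 0).
  apply: (@le_trans _ _ (\sum_(k < 6) (3%:R * (`|v^T| * eta)) ^+ 2)).
    apply: ler_sum => k _; rewrite -[leLHS]real_normK ?num_real// ler_sqr ?nnegrE ?mulr_ge0//.
    rewrite mxE (_ : \sum_j _ = \sum_j v^T 0 j * (J - J0) j k); last first.
      by apply: eq_bigr => j _; rewrite [_^T k j]mxE [v^T _ _]mxE mulrC.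
    apply: sum_row_le => i; first exact: ler_coord.
    by rewrite !mxE.
  rewrite sumr_const card_ord -(mulr_natl (_ ^+ 2)) !exprMn ler_pdivlMr//.
  have := ler_wpM2l (sqr_ge0 eta) v1; rewrite mulr1.
  move: (`|v^T| ^+ 2) (eta ^+ 2) => a b h; rewrite -natrX/=; lra.
have [d0 _] := sqr_norm_mul_nproj d uJ0.
have [p0 _] := sqr_norm_mul_nproj (nproj J *m u) uJ0.
rewrite P0u; set a := nproj J0 *m (nproj J *m u); set b := nproj J0 *m d.
apply: (@le_trans _ _ (\sum_k (2 * a k 0 ^+ 2 + 2 * b k 0 ^+ 2))).
  apply: ler_sum => k _; rewrite mxE -subr_ge0.
  by rewrite (_ : _ - _ = (a k 0 - b k 0) ^+ 2) ?sqr_ge0//; ring.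
rewrite big_split/= -!mulr_sumr; apply: lerD; first by rewrite ler_pM2l.
have : \sum_k b k 0 ^+ 2 <= 54%:R * eta ^+ 2 / m by exact: le_trans d0 dle.
rewrite !ler_pdivlMr// -mulrA; move: (_ * m) (eta ^+ 2) => x z; lra.
Qed.

Lemma nproj_combE n m (J : 'M[R]_(n, m)) a b c s k :
  c * nproj J k a + s * nproj J k b =
  (nproj J *m (c *: delta_mx a 0 + s *: delta_mx b 0 : 'cV[R]_m)) k 0.
Proof.
rewrite mulmxDr -!scalemxAr -!colE [RHS]mxE.
by rewrite [X in _ = X + _]mxE [X in _ = _ + X]mxE ![col _ _ _ _]mxE.
Qed.

(** The drift may cost half of 1/12, and the factor 2 of [nproj_drift] halves the remaining 1/24. *)
Lemma nproj_plane_drift (J J0 : 'M[R]_(3, 6)) a b (m eta : R) :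
  J *m J^T \in unitmx -> J0 *m J0^T \in unitmx -> 0 < m ->
  (forall h : 'rV[R]_3, m * `|h| ^+ 2 <= \sum_k (\sum_i h 0 i * J i k) ^+ 2) ->
  (forall i k, `|J i k - J0 i k| <= eta) -> 108%:R * eta ^+ 2 / m <= 1 / 24%:R ->
  (forall c s : R, c ^+ 2 + s ^+ 2 = 1 ->
     1 / 12%:R <= \sum_k (c * nproj J0 k a + s * nproj J0 k b) ^+ 2) ->
  a != b -> forall c s : R, c ^+ 2 + s ^+ 2 = 1 ->
     1 / 48%:R <= \sum_k (c * nproj J k a + s * nproj J k b) ^+ 2.
Proof.
move=> uJ uJ0 m0 mJ JJ0 eta_m ab0 ab c s cs.
pose u : 'cV[R]_6 := c *: delta_mx a 0 + s *: delta_mx b 0.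
have u1 : \sum_k u k 0 ^+ 2 <= 1.
  rewrite (bigD1 a)//= (bigD1 b) 1?eq_sym//= big1 => [|k /andP[/negbTE ka /negbTE kb]].
    rewrite !mxE !eqxx/= (negbTE ab) eq_sym (negbTE ab) /= !mulr1 !mulr0 addr0 add0r addr0.
    by rewrite cs.
  by rewrite !mxE ka kb/= !mulr0 addr0 expr0n.
have := nproj_drift uJ uJ0 m0 mJ JJ0 u1.
under eq_bigr do rewrite -nproj_combE.
under [X in _ <= 2 * X + _ -> _]eq_bigr do rewrite -nproj_combE.
have := ab0 c s cs; move: (\sum_k _) (\sum_k _) eta_m => X Y; lra.
Qed.

End Drift.

(** * A full stage: all directions and all pairs of normals *)

Section Stage.
Context {R : realType}.
Notation V4 := (R * 'rV[R]_3)%type.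
Implicit Types (f g : V4 -> R) (z : V4) (O : set V4) (y p q : 'I_6 -> V4 -> R).
Context (K : set V4) (gs : 'I_3 -> 'I_3 -> V4 -> R) (I : finType)
  (l : I -> 'I_3 -> R).
Hypothesis cK : compact K.
Hypothesis span : spanning l.

Lemma short_map_le m m' y r : m' <= m -> short_map K gs l m y r ->
  short_map K gs l m' y r.
Proof.
move=> mm [ O [H1 H2 H3 H4 [H5 H6]]]; exists O; split => //; split => //.
by move=> z h Kz; apply: le_trans (H5 z h Kz); rewrite ler_wpM2r ?sqr_ge0.
Qed.

(** One [step] per entry of the list. A step moves the Jacobian by at most [D], and the smallness of
    N D keeps every plane that is good for [y0] good throughout. A reduction can be measured against
    the initial [r0] at whatever moment its triple comes up, because every other step raises a
    coefficient by at most [eps]. *)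
Lemma triples_loop (Lb mlow kappa eps Rb : R) (N : nat) m0 y0 r0 :
  (forall k i, `|l k i| <= Lb) -> 0 < mlow ->
  0 < kappa -> kappa <= 1 / 4 -> 0 < eps ->
  let D := Lb * (2 * Num.sqrt (kappa * Rb)) + eps in
  108%:R * (N%:R * D) ^+ 2 / mlow <= 1 / 24%:R ->
  short_map K gs l m0 y0 r0 -> mlow + N%:R * eps <= m0 ->
  (forall k z, K z -> r0 k z + N%:R * eps <= Rb) ->
  forall S : seq (I * ('I_6 * 'I_6)), (size S <= N)%N ->
  exists y r, short_map K gs l (m0 - (size S)%:R * eps) y r /\
  forall z, K z ->
  [/\ forall k, `|y k z - y0 k z| <= (size S)%:R * eps,
      forall i k, `|dx i (y k) z - dx i (y0 k) z| <= (size S)%:R * D,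
      forall k, r k z <= r0 k z + (size S)%:R * eps
    & forall k a b, (k, (a, b)) \in S -> a != b ->
      (forall c s : R, c ^+ 2 + s ^+ 2 = 1 ->
        1 / 12%:R <= \sum_j (c * nproj (jac y0 z) j a + s * nproj (jac y0 z) j b) ^+ 2) ->
      r k z <= r0 k z * (1 - kappa / 48%:R) + (size S)%:R * eps].
Proof.
move=> lL mlow0 kap0 kap4 eps0 D HD st0 m0N r0N.
have r00 k z : K z -> 0 < r0 k z by case: st0 => [ O [_ _ + _ _]]; exact.
elim/last_ind => [|S [k1 [a1 b1]] IH].
  move=> _; exists y0, r0; rewrite /= mul0r subr0; split => // z Kz; split => //.
  - by move=> k; rewrite subrr normr0.
  - by move=> i k; rewrite subrr normr0 mul0r.
  - by move=> k; rewrite addr0.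
rewrite size_rcons => SN; have [|y [r [st H]]] := IH; first exact: ltnW.
set n := size S in SN st H *; clearbody n; clear IH.
have nN : n.+1%:R * eps <= N%:R * eps by rewrite ler_pM2r// ler_nat.
have nS (x : R) : n.+1%:R * x = n%:R * x + x by rewrite -natr1 mulrDl mul1r.
have Lb0 : 0 <= Lb by apply: le_trans (lL k1 0).
have D0 : 0 <= D by rewrite addr_ge0 ?(ltW eps0)// mulr_ge0 ?Lb0// mulr_ge0// sqrtr_ge0.
have mn0 : mlow <= m0 - n%:R * eps.
  by rewrite lerBrDr (le_trans _ m0N)// lerD2l ler_pM2r// ler_nat ltnW.
have mn : 0 < m0 - n%:R * eps by exact: lt_le_trans mn0.
have [y' [r' [st' H']]] := step cK k1 a1 b1 mn span st kap0 kap4 eps0.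
exists y', r'; rewrite !nS.
split; first by rewrite opprD addrA.
have yb : immersion_bound K y (m0 - n%:R * eps) by case: st => [ O [_ _ _ _ []]].
have y0b : immersion_bound K y0 m0 by case: st0 => [ O [_ _ _ _ []]].
have m00 : 0 < m0.
  apply: lt_le_trans mlow0 (le_trans _ m0N); rewrite lerDl mulr_ge0// ltW//.
move=> z Kz; have [h1 h2 h3 h4] := H z Kz; have [h1' h2' h3' [c [s [cs h4']]]] := H' z Kz.
have rz k : 0 < r k z by case: st => [ O [_ _ + _ _]]; exact.
set S0 := \sum_k _ in h4'.
have S00 : 0 <= S0 by apply: sumr_ge0 => j _; exact: sqr_ge0.
have h5 k : r' k z <= r k z + eps.
  have [->|kk] := eqVneq k k1; last by have := h3' k kk; rewrite ler_norml => /andP[]; lra.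
  move: h4'; rewrite ler_norml => /andP[_ h].
  have : 0 <= r k1 z * (kappa * S0) by rewrite !mulr_ge0// ltW.
  move: h; rewrite mulrBr mulr1; move: (r k1 z * _) => u; lra.
split.
- move=> k; rewrite -(subrK (y k z) (y' k z)) -addrA addrC.
  by apply: (le_trans (ler_normD _ _)); apply: lerD; [exact: h1|exact: h1'].
- move=> i k; rewrite -(subrK (dx i (y k) z) (dx i (y' k) z)) -addrA addrC.
  apply: (le_trans (ler_normD _ _)); apply: lerD; first exact: h2.
  apply: (le_trans (h2' i k)); rewrite /D lerD2r; apply: ler_pM => //.
  rewrite ler_pM2l// ler_wsqrtr// ler_pM2l//.
  apply: (le_trans (h3 k1)); apply: le_trans (r0N k1 z Kz); rewrite lerD2l.
  by rewrite (le_trans _ nN)// nS lerDl ltW.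
- by move=> k; have := h5 k; have := h3 k; lra.
move=> k a b; rewrite mem_rcons inE => /orP[|kS ab J0]; last first.
  by have := h5 k; have := h4 k a b kS ab J0; lra.
move=> /eqP[-> -> ->] ab J0.
have uJ := immersion_unit mn yb Kz.
have uJ0 := immersion_unit m00 y0b Kz.
have mJ (h : 'rV[R]_3) : mlow * `|h| ^+ 2 <= \sum_k (\sum_i h 0 i * jac y z i k) ^+ 2.
  under eq_bigr do under eq_bigr do rewrite mxE.
  by apply: le_trans (yb z h Kz); rewrite ler_wpM2r// sqr_ge0.
have JJ0 i j : `|jac y z i j - jac y0 z i j| <= N%:R * D.
  rewrite !mxE; apply: (le_trans (h2 i j)); rewrite ler_wpM2r// ler_nat; exact: ltnW.
have := nproj_plane_drift uJ uJ0 mlow0 mJ JJ0 HD J0 ab cs; rewrite -/S0 => S048.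
move: h4'; rewrite ler_norml => /andP[_ h].
have e2 : r k1 z * (1 - kappa / 48%:R) <= (r0 k1 z + n%:R * eps) * (1 - kappa / 48%:R).
  by rewrite ler_wpM2r//; lra.
rewrite lerBlDl in h; apply: (le_trans h); rewrite addrA; apply: lerD => //.
apply: (@le_trans _ _ (r k1 z * (1 - kappa / 48%:R))).
  by rewrite ler_pM2l// lerD2l lerN2 ler_pM2l//; lra.
apply: (le_trans e2); rewrite mulrDl lerD2l ler_piMr ?mulr_ge0// ?(ltW eps0)//.
by lra.
Qed.

(* At every point some pair of coordinates (a, b) is good (nproj_plane), and
   it stays good as the Jacobian drifts; running through all pairs therefore
   reduces every r k by a fixed factor everywhere. *)
Lemma stage (Rmax mlow : R) : 0 < Rmax -> 0 < mlow ->
  exists theta C : R, [/\ 0 < theta, theta < 1 & 0 < C] /\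
  forall Rn m y r eps, 0 < Rn -> Rn <= Rmax -> 0 < eps -> mlow + eps <= m ->
    short_map K gs l m y r -> (forall k z, K z -> r k z <= Rn) ->
  exists y' r', [/\ short_map K gs l (m - eps) y' r',
     forall k z, K z -> r' k z <= theta * Rn,
     forall k z, K z -> `|y' k z - y k z| <= eps
   & forall i k z, K z -> `|dx i (y' k) z - dx i (y k) z| <= C * Num.sqrt Rn].
Proof.
move=> Rmax0 mlow0.
pose Lb := \sum_k \sum_i `|l k i|.
have Lb0 : 0 <= Lb by do 2 (apply: sumr_ge0 => ? _).
have lL k i : `|l k i| <= Lb.
  rewrite /Lb (bigD1 k)//= (bigD1 i)//= -addrA lerDl addr_ge0//; first exact: sumr_ge0.
  by do 2 (apply: sumr_ge0 => ? _).
pose S := enum {: I * ('I_6 * 'I_6)}; pose N := size S.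
pose M : R := N.+1%:R.
have M0 : 0 < M by rewrite ltr0n.
have NM : N%:R <= M by rewrite ler_nat.
have [c0 c00 c0E] : exists2 c0 : R, 0 < c0 & c0 = 108%:R * 24%:R.
  by eexists; [|reflexivity]; rewrite mulr_gt0// ltr0n.
(* The drift granted to a single step: M of them add up to sqrt (mlow / c0), for which 108 (M del)^2
   / mlow = 1/24, the limit set by [triples_loop]. *)
pose del := Num.sqrt (mlow / c0) / M.
have del0 : 0 < del by rewrite divr_gt0// sqrtr_gt0 divr_gt0.
pose s0 := del / (4 * (Lb + 1)).
have L10 : 0 < Lb + 1 by rewrite ltr_wpDl.
have s00 : 0 < s0 by rewrite divr_gt0// mulr_gt0.
(* Fixed by [Rmax] once and for all, so that [theta] and [C] are the same for all stages. The factor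
   2 leaves room for the coefficients to grow during a stage. *)
pose kappa := Num.min (1 / 4) (s0 ^+ 2 / (2 * Rmax)).
have kap0 : 0 < kappa by rewrite lt_min !divr_gt0// ?exprn_gt0// mulr_gt0.
have kap4 : kappa <= 1 / 4 by rewrite ge_min lexx.
have kaps : Num.sqrt (kappa * (2 * Rmax)) <= s0.
  rewrite -[leRHS]ger0_norm ?(ltW s00)// -sqrtr_sqr ler_wsqrtr//.
  by rewrite -ler_pdivlMr ?mulr_gt0// ge_min lexx orbT.
(* A good triple yields the factor 1 - kappa / 48; half of this gain is given up to absorb the
   errors of all steps. *)
pose theta := 1 - kappa / 96%:R.
pose C := M * (2 * Lb + 1).
exists theta, C; split.
  split; rewrite /theta; [lra|lra|].
  by rewrite /C mulr_gt0//; lra.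
move=> Rn m y r eps Rn0 RnR eps0 meps st rR.
(* The requirements in order: total displacement and loss of the immersion constant at most [eps];
   drift of a step at most [del]; errors at most half of the gain; change of derivatives of order
   sqrt Rn; growth of the coefficients at most [Rn]. *)
pose e := Num.min (eps / M) (Num.min (del / 2) (Num.min (kappa / 96%:R * Rn / M) (Num.min (Num.sqrt Rn) (Rn / M)))).
have e0 : 0 < e.
  have k96 : 0 < kappa / 96%:R * Rn by rewrite mulr_gt0// divr_gt0// ltr0n.
  rewrite !lt_min sqrtr_gt0 Rn0 (divr_gt0 eps0 M0) (divr_gt0 k96 M0) (divr_gt0 Rn0 M0).
  by rewrite (divr_gt0 del0).
have [e1 e2 e3 e4 e5] : [/\ e <= eps / M, e <= del / 2, e <= kappa / 96%:R * Rn / M, e <= Num.sqrt Rn & e <= Rn / M].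
  by split; rewrite /e !ge_min lexx ?orbT.
have MeE x : e <= x / M -> N%:R * e <= x.
  by rewrite ler_pdivlMr// mulrC => h; apply: le_trans h; rewrite ler_wpM2r// ltW.
have Ne := MeE _ e1; have Nk := MeE _ e3; have NR := MeE _ e5.
pose D := Lb * (2 * Num.sqrt (kappa * (2 * Rn))) + e.
have sqR : Num.sqrt (kappa * (2 * Rn)) <= s0.
  by apply: le_trans kaps; rewrite ler_wsqrtr// ler_pM2l// ler_pM2l.
have D0 : 0 <= D by rewrite addr_ge0 ?(ltW e0)// mulr_ge0// mulr_ge0// sqrtr_ge0.
have Dd : D <= del.
  have : Lb * (2 * s0) <= del / 2.
    have : (Lb + 1) * (2 * s0) = del / 2 by rewrite /s0; field; rewrite gt_eqF.
    by rewrite mulrDl mul1r; move: (Lb * _) => u; lra.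
  have : Lb * (2 * Num.sqrt (kappa * (2 * Rn))) <= Lb * (2 * s0).
    by rewrite ler_wpM2l// ler_pM2l.
  by rewrite /D; move: (Lb * _) (Lb * _) => u v; lra.
have HD : 108%:R * (N%:R * D) ^+ 2 / mlow <= 1 / 24%:R.
  rewrite ler_pdivrMr//.
  have : (N%:R * D) ^+ 2 <= (M * del) ^+ 2.
    have a0 : 0 <= N%:R * D by rewrite mulr_ge0.
    have b0 : 0 <= M * del by rewrite mulr_ge0// ltW.
    by rewrite ler_sqr//; apply: ler_pM.
  have -> : M * del = Num.sqrt (mlow / c0) by rewrite /del mulrC divfK ?gt_eqF.
  rewrite sqr_sqrtr ?divr_ge0 ?(ltW mlow0) ?(ltW c00)// ler_pdivlMr// c0E.
  by move: (_ ^+ 2) => u; lra.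
have [||y' [r' [st' H]]] := triples_loop lL mlow0 kap0 kap4 e0 HD st _ _ (leqnn (size S)).
- by move: Ne; move: (N%:R * e) => u; lra.
- move=> k z Kz; have := rR k z Kz; move: NR; move: (N%:R * e) => u; lra.
exists y', r'; split.
- by apply: short_map_le st'; rewrite lerD2l lerN2.
- move=> k z Kz; have [_ _ _ h4] := H z Kz.
  have mm : 0 < m by lra.
  have yb : immersion_bound K y m by case: st => [ O [_ _ _ _ []]].
  have [a [b [ab J0]]] := nproj_plane (immersion_unit mm yb Kz).
  have kS : (k, (a, b)) \in S by rewrite mem_enum.
  apply: (le_trans (h4 k a b kS ab J0)).
  have : r k z * (1 - kappa / 48%:R) <= Rn * (1 - kappa / 48%:R).
    by rewrite ler_wpM2r ?rR//; lra.
  move: Nk; rewrite -/N; have -> : theta * Rn = Rn * (1 - kappa / 48%:R) + kappa / 96%:R * Rn.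
    by rewrite /theta; field.
  move: (r k z * _) (Rn * _) (N%:R * e) => u v w; move: (_ * Rn) => x; lra.
- by move=> k z Kz; have [h _ _ _] := H z Kz; apply: (le_trans (h k)).
move=> i k z Kz; have [_ h _ _] := H z Kz; apply: (le_trans (h i k)).
have sR0 : 0 <= Num.sqrt Rn by exact: sqrtr_ge0.
have : Num.sqrt (kappa * (2 * Rn)) <= Num.sqrt Rn.
  by rewrite ler_wsqrtr// mulrA ler_piMl ?(ltW Rn0)//; lra.
move=> sk; rewrite /C -mulrA; apply: ler_pM => //.
rewrite (mulrDl (2 * Lb)) mul1r; apply: lerD => //.
by rewrite [2 * Lb]mulrC -mulrA ler_wpM2l// ler_pM2l.
Qed.

End Stage.

(** * Nash-Kuiper iteration *)

Section Sequences.
Context {R : realType}.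

(** The intervals [u n - b n, u n + b n] are nested, and the supremum of their left ends lies in all
    of them. The error bound [b] is explicit, hence uniform in the point whenever the increments
    are. *)
Lemma telescoping_limit (u b : nat -> R) :
  (forall n, `|u n.+1 - u n| <= b n - b n.+1) -> (forall n, 0 <= b n) ->
  exists l, forall n, `|u n - l| <= b n.
Proof.
move=> ub b0.
have inc n m : (n <= m)%N -> u n - b n <= u m - b m.
  elim: m => [|m IH]; first by rewrite leqn0 => /eqP ->.
  rewrite leq_eqVlt => /predU1P[->//|/IH h]; apply: (le_trans h).
  by have := ub m; rewrite ler_norml => /andP[]; lra.
have dec n m : (n <= m)%N -> u m + b m <= u n + b n.
  elim: m => [|m IH]; first by rewrite leqn0 => /eqP ->.
  rewrite leq_eqVlt => /predU1P[->//|/IH h]; apply: le_trans h.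
  by have := ub m; rewrite ler_norml => /andP[]; lra.
have ac n m : u n - b n <= u m + b m.
  have h1 := inc _ _ (leq_maxl n m); have h2 := dec _ _ (leq_maxr n m).
  by have := b0 (maxn n m); lra.
pose A : set R := [set u n - b n | n in setT].
have A0 : A !=set0 by exists (u 0%N - b 0%N), 0%N.
have Aub n : ubound A (u n + b n) by move=> _ [m _ <-]; exact: ac.
have hA : has_sup A by split => //; exists (u 0%N + b 0%N); exact: Aub.
exists (sup A) => n; rewrite ler_norml; apply/andP; split.
  have : sup A <= u n + b n by apply: ge_sup => //; exact: Aub.
  by lra.
have : u n - b n <= sup A by apply: sup_upper_bound => //; exists n.
by lra.
Qed.

Lemma dependent_choice_nat (S : Type) (Inv : nat -> S -> Prop)
    (Rel : nat -> S -> S -> Prop) (s0 : S) : Inv 0%N s0 ->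
  (forall n s, Inv n s -> exists s', Inv n.+1 s' /\ Rel n s s') ->
  exists f : nat -> S, f 0%N = s0 /\
    forall n, Inv n (f n) /\ Rel n (f n) (f n.+1).
Proof.
move=> I0 H.
have /choice[g Hg] (p : nat * S) : exists s', Inv p.1 p.2 -> Inv p.1.+1 s' /\ Rel p.1 p.2 s'.
  have [/H[s' Hs']|nI] := pselect (Inv p.1 p.2); first by exists s'.
  by exists s0.
pose f := fix f n := if n is n'.+1 then g (n', f n') else s0.
have If n : Inv n (f n).
  by elim: n => [//|n IH]; have [] := Hg (n, f n) IH.
by exists f; split => // n; split => //; have [] := Hg (n, f n) (If n).
Qed.

Lemma sqrtr_expr (q : R) n : 0 <= q -> Num.sqrt (q ^+ n) = Num.sqrt q ^+ n.
Proof.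
move=> q0; elim: n => [|n IH]; first by rewrite !expr0 sqrtr1.
by rewrite !exprS sqrtrM// IH.
Qed.

Lemma geometric_small (q C e : R) : 0 <= q -> q < 1 -> 0 < e ->
  exists n, C * q ^+ n <= e.
Proof.
move=> q0 q1 e0.
have : (fun n => C * q ^+ n) @ \oo --> (C * 0 : R).
  apply: cvgMr; apply: cvg_expr; by rewrite ger0_norm.
rewrite mulr0 => /cvgrPdist_le /(_ _ e0) [n _ Hn].
by exists n; have := Hn n (leqnn n); rewrite /= sub0r normrN => /(le_trans (ler_norm _)).
Qed.

End Sequences.

Section Iteration.
Context {R : realType}.
Notation V4 := (R * 'rV[R]_3)%type.
Implicit Types (f g : V4 -> R) (z : V4) (O : set V4) (y p q : 'I_6 -> V4 -> R).
Context (K : set V4) (gs : 'I_3 -> 'I_3 -> V4 -> R) (I : finType)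
  (l : I -> 'I_3 -> R).
Hypothesis cK : compact K.
Hypothesis span : spanning l.

(** One of the six components carries at least a sixth of the squared distance. *)
Lemma separated_scale y (d : R) : 0 < d -> separated K y ->
  exists2 e0, 0 < e0 & forall t x x', K (t, x) -> K (t, x') -> d <= `|x' - x| ->
    exists k, e0 <= `|y k (t, x') - y k (t, x)|.
Proof.
move=> d0 [c c0 H]; pose e0 := Num.sqrt (c / 6%:R) * d.
have c6 : 0 < c / 6%:R by rewrite divr_gt0.
have e00 : 0 < e0 by rewrite mulr_gt0// sqrtr_gt0.
exists e0 => // t x x' Kx Kx' dx'.
apply: contrapT => N.
have : \sum_(k < 6) (y k (t, x') - y k (t, x)) ^+ 2 < \sum_(k < 6) e0 ^+ 2.
  apply: ltr_sum; first by apply/hasP; exists ord0 => //; exact: mem_index_enum.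
  move=> k _; rewrite -[ltLHS]real_normK ?num_real// ltr_sqr ?nnegrE ?(ltW e00)//.
  by rewrite ltNge; apply/negP => h; apply: N; exists k.
rewrite ltNge => /negP; apply; apply: le_trans (H t x x' Kx Kx').
rewrite sumr_const card_ord -(mulr_natl (_ ^+ 2)) /e0 exprMn sqr_sqrtr ?(ltW c6)//.
have -> (v w : R) : 6%:R * (v / 6%:R * w) = v * w by field.
by rewrite ler_pM2l// ler_sqr ?nnegrE ?(ltW d0).
Qed.

(* The C^1 limit: Y is the limiting map and Z its limiting x-derivative. *)
Lemma short_map_limit m0 y0 r0 eps : 0 < m0 -> 0 < eps ->
  short_map K gs l m0 y0 r0 ->
  exists (Y : 'I_6 -> V4 -> R) (Z : 'I_3 -> 'I_6 -> V4 -> R),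
  [/\ forall e, 0 < e -> exists y O, [/\ open O, K `<=` O, forall k, smooth O (y k)
        & forall z, K z -> (forall k, `|y k z - Y k z| <= e) /\
            (forall i k, `|dx i (y k) z - Z i k z| <= e)],
      forall z i j, K z -> \sum_(k < 6) Z i k z * Z j k z = gs i j z,
      forall k z, K z -> `|y0 k z - Y k z| <= eps
    & forall rho, 0 < rho -> exists2 mu, 0 < mu & forall t x x',
        K (t, x) -> K (t, x') -> rho <= `|x' - x| ->
        exists k, mu <= `|Y k (t, x') - Y k (t, x)|].
Proof.
move=> m00 eps0 st0; pose mlow := m0 / 2.
have mlow0 : 0 < mlow by rewrite divr_gt0.
have [Rmax Rmax0 Hr0] : exists2 B, 0 < B & forall k z, K z -> r0 k z <= B.
  case: st0 => [ O [[oO KO] [_ sr] _ _ _]].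
  have [B B0 HB] := family_bounded KO cK sr.
  by exists B => // k z Kz; apply: le_trans (HB k z Kz); exact: ler_norm.
have [theta [C [[th0 th1 C0] Hstage]]] := stage gs cK span Rmax0 mlow0.
pose S : Type := (('I_6 -> V4 -> R) * (I -> V4 -> R) * R)%type.
(* The last component of the state is a budget e, at least halved at each stage, so that from now on
   displacements, and likewise losses of the immersion constant, add up to at most 2 e. Points at
   distance at least 2^-n are 8 e apart, of which the later motion of both ends consumes at most 4
   e. *)
pose Inv n (s : S) := [/\ 0 < s.2, short_map K gs l (mlow + 2 * s.2) s.1.1 s.1.2,
  forall k z, K z -> s.1.2 k z <= theta ^+ n * Rmax &
  forall t x x', K (t, x) -> K (t, x') -> 2^-1 ^+ n <= `|x' - x| ->
    exists k, 8%:R * s.2 <= `|s.1.1 k (t, x') - s.1.1 k (t, x)|].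
pose Rel n (s s' : S) := [/\ s'.2 <= s.2 / 2,
  forall k z, K z -> `|s'.1.1 k z - s.1.1 k z| <= s.2 &
  forall i k z, K z -> `|dx i (s'.1.1 k) z - dx i (s.1.1 k) z| <=
    C * Num.sqrt (theta ^+ n * Rmax)].
have half0 n : (0 : R) < 2^-1 ^+ n by rewrite exprn_gt0// invr_gt0.
have sepst m y r : short_map K gs l m y r -> separated K y.
  by case=> [ O [_ _ _ _ []]].
have [e0 [e00 e0m e0eps He0]] : exists e0, [/\ 0 < e0, e0 <= m0 / 4, e0 <= eps / 2 &
    forall t x x', K (t, x) -> K (t, x') -> 2^-1 ^+ 0 <= `|x' - x| ->
    exists k, 8%:R * e0 <= `|y0 k (t, x') - y0 k (t, x)|].
  have [e1 e10 He1] := separated_scale (half0 0%N) (sepst _ _ _ st0).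
  exists (Num.min (e1 / 8%:R) (Num.min (m0 / 4) (eps / 2))); split.
  - by rewrite !lt_min !divr_gt0.
  - by rewrite !ge_min lexx !orbT.
  - by rewrite !ge_min lexx !orbT.
  - move=> t x x' Kx Kx' h; have [k hk] := He1 t x x' Kx Kx' h; exists k.
    by apply: le_trans hk; rewrite mulrC -ler_pdivlMr// ge_min lexx.
have I0 : Inv 0%N (y0, r0, e0).
  split => //=.
  - by apply: short_map_le st0; rewrite /mlow; lra.
  - by move=> k z Kz; rewrite expr0 mul1r; exact: Hr0.
have next n s : Inv n s -> exists s', Inv n.+1 s' /\ Rel n s s'.
  case: s => [[y r] e] [/= e_gt0 st rR _].
  have Rn0 : 0 < theta ^+ n * Rmax by rewrite mulr_gt0// exprn_gt0.
  have RnR : theta ^+ n * Rmax <= Rmax.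
    by rewrite ler_piMl ?(ltW Rmax0)// exprn_ile1// ltW.
  have [|y' [r' [st' rR' yy' dyy']]] := Hstage _ _ y r e Rn0 RnR e_gt0 _ st rR; first lra.
  have [e1 e10 He1] := separated_scale (half0 n.+1) (sepst _ _ _ st').
  pose e' := Num.min (e1 / 8%:R) (e / 2).
  have e'1 : e' <= e1 / 8%:R by rewrite ge_min lexx.
  have e'2 : e' <= e / 2 by rewrite ge_min lexx orbT.
  exists (y', r', e'); split; first split => /=.
  - by rewrite lt_min !divr_gt0.
  - by apply: short_map_le st'; lra.
  - by move=> k z Kz; rewrite exprS -mulrA; exact: rR'.
  - move=> t x x' Kx Kx' h; have [k hk] := He1 t x x' Kx Kx' h; exists k.
    by apply: le_trans hk; rewrite mulrC -ler_pdivlMr.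
  - by split.
have [F [F0 HF]] := dependent_choice_nat I0 next.
pose y n := (F n).1.1; pose e n := (F n).2.
have e_gt0 n : 0 < e n by case: (HF n) => [[]].
have ylim k z : exists Y, K z -> forall n, `|y n k z - Y| <= 2 * e n.
  have [Kz|nK] := pselect (K z); last by exists 0.
  have [||Y HY] := @telescoping_limit _ (fun n => y n k z) (fun n => 2 * e n).
  - move=> n; have [_ [eS yS _]] := HF n.
    by apply: (le_trans (yS k z Kz)); move: eS; rewrite -/(e n) -/(e n.+1); lra.
  - by move=> n; rewrite mulr_ge0// ltW.
  by exists Y.
have /choice[Y0 HY0] (kz : 'I_6 * V4) := ylim kz.1 kz.2.
pose Y k z := Y0 (k, z).
have HY n k z : K z -> `|y n k z - Y k z| <= 2 * e n by move=> Kz; exact: (HY0 (k, z)).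
pose q := Num.sqrt theta.
have q0 : 0 <= q by exact: sqrtr_ge0.
have q1 : q < 1 by rewrite -sqrtr1 ltr_sqrt.
(* The tail of the geometric series of derivative increments, of ratio [q]. *)
pose b n := C * Num.sqrt Rmax / (1 - q) * q ^+ n.
have b0 n : 0 <= b n.
  by rewrite !mulr_ge0 ?exprn_ge0 ?sqrtr_ge0 ?(ltW C0)// invr_ge0 subr_ge0 ltW.
have zlim i k z : exists Z, K z -> forall n, `|dx i (y n k) z - Z| <= b n.
  have [Kz|nK] := pselect (K z); last by exists 0.
  have [|//|Z HZ] := @telescoping_limit _ (fun n => dx i (y n k) z) b.
    move=> n; have [_ [_ _ dS]] := HF n.
    apply: (le_trans (dS i k z Kz)).
    rewrite sqrtrM ?exprn_ge0 ?(ltW th0)// sqrtr_expr ?(ltW th0)// -/q /b exprS.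
    rewrite le_eqVlt; apply/orP; left; apply/eqP.
    by move: (q ^+ n) => x; field; rewrite subr_eq0 gt_eqF.
  by exists Z.
have /choice[Z0 HZ0] (kz : ('I_3 * 'I_6) * V4) := zlim kz.1.1 kz.1.2 kz.2.
pose Z i k z := Z0 ((i, k), z).
have HZ n i k z : K z -> `|dx i (y n k) z - Z i k z| <= b n.
  by move=> Kz; exact: (HZ0 ((i, k), z)).
have e_le n : e n <= e 0%N * 2^-1 ^+ n.
  elim: n => [|n IH]; first by rewrite expr0 mulr1.
  have [_ [eS _ _]] := HF n.
  apply: (le_trans eS); rewrite -/(e n) exprS mulrCA mulrC ler_pM2l ?invr_gt0//.
have half1 : 2^-1 < 1 :> R by rewrite invf_lt1// ltr1n.
have half0' : 0 <= 2^-1 :> R by rewrite invr_ge0.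
exists Y, Z; split.
- move=> d d0.
  have [n1 Hn1] := geometric_small (2 * e 0%N) half0' half1 d0.
  have [n2 Hn2] := geometric_small (C * Num.sqrt Rmax / (1 - q)) q0 q1 d0.
  pose n := maxn n1 n2.
  have [[_ [ O [[oO KO] [sy _] _ _ _]] _ _] _] := HF n.
  exists (y n), O; split => // z Kz; split => [k|i k].
    apply: (le_trans (HY n k z Kz)); apply: le_trans Hn1.
    apply: (@le_trans _ _ (2 * e 0%N * 2^-1 ^+ n)); first by rewrite -mulrA ler_pM2l.
    rewrite ler_wpM2l ?mulr_ge0 ?(ltW (e_gt0 0%N))// ler_wiXn2l//; [exact: ltW|exact: leq_maxl].
  apply: (le_trans (HZ n i k z Kz)); apply: le_trans Hn2; rewrite /b.
  rewrite ler_wpM2l//; last by rewrite ler_wiXn2l//; [exact: ltW|exact: leq_maxr].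
  by rewrite !mulr_ge0 ?sqrtr_ge0 ?(ltW C0)// invr_ge0 subr_ge0 ltW.
- move=> z i j Kz.
  have bcvg : b @ \oo --> (0 : R).
    rewrite -(mulr0 (C * Num.sqrt Rmax / (1 - q))); apply: cvgMr.
    by apply: cvg_expr; rewrite ger0_norm.
  have dcvg i' k : (fun n => dx i' (y n k) z) @ \oo --> Z i' k z.
    apply/cvgrPdist_le => d d0; move/cvgrPdist_le : bcvg => /(_ _ d0).
    apply: filterS => n; rewrite sub0r normrN => h; rewrite distrC.
    by apply: (le_trans (HZ n i' k z Kz)); apply: le_trans h; exact: ler_norm.
  have gcvg : (fun n => gram (y n) i j z) @ \oo --> \sum_(k < 6) Z i k z * Z j k z.
    by apply: cvg_big => [|k _]; [exact: add_continuous|exact: cvgM].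
  apply: (cvg_unique _ gcvg) => //.
  (* At stage n the metric misses [gs] by the defect alone, whose coefficients are at most theta^n
     Rmax. *)
  rewrite [X in X @ _](_ : _ =
      (fun n => gs i j z - \sum_k (F n).1.2 k z * l k i * l k j)); last first.
    apply/funext => n; have [[_ [ O [[_ KO] _ _ H _]] _ _] _] := HF n.
    by rewrite -(H z i j (KO _ Kz)) addrK.
  suff sc : (fun n => \sum_k (F n).1.2 k z * l k i * l k j) @ \oo -->
      \sum_(k : I) 0 * l k i * l k j.
    have E0 : \sum_(k : I) 0 * l k i * l k j = 0 :> R.
      by rewrite big1// => k _; rewrite !mul0r.
    rewrite E0 in sc; have H := cvgB (cvg_cst (gs i j z)) sc.
    by rewrite subr0 in H; exact: H.
  apply: cvg_big => [|k _]; first exact: add_continuous.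
  apply: cvgMl; apply: cvgMl.
  have tcvg : (fun n => theta ^+ n * Rmax) @ \oo --> (0 : R).
    rewrite -(mul0r Rmax); apply: cvgMl; apply: cvg_expr.
    by rewrite ger0_norm// ltW.
  apply/cvgrPdist_le => d d0; move/cvgrPdist_le : tcvg => /(_ _ d0).
  apply: filterS => n; rewrite !sub0r !normrN; apply: le_trans.
  have [[_ [ O [_ _ rp _ _]] rR _] _] := HF n.
  rewrite ger0_norm; last by rewrite ltW// rp.
  by apply: le_trans (ler_norm _); exact: rR.
- move=> k z Kz; have := HY 0%N k z Kz; rewrite /y /e F0 /= => h.
  by apply: (le_trans h); lra.
(* The stage is chosen with 2^-n <= rho; its separation survives in the limit by the choice of the
   budget. *)
move=> rho rho0; have [n Hn] := geometric_small 1 half0' half1 rho0.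
rewrite mul1r in Hn; have [[_ _ _ H] _] := HF n.
exists (e n) => // t x x' Kx Kx' h.
have [k hk] := H t x x' Kx Kx' (le_trans Hn h); exists k.
have := HY n k _ Kx; have := HY n k _ Kx'; move: hk; rewrite -/(y n) -/(e n).
have := e_gt0 n; move: (e n) (y n k (t, x')) (y n k (t, x)) (Y k (t, x')) (Y k (t, x)).
move=> d a1 a2 b1 b2 d0.
have := ler_normD (a1 - b1) (b1 - b2); have := ler_normD (a1 - b1 + (b1 - b2)) (b2 - a2).
rewrite (_ : a1 - b1 + (b1 - b2) + (b2 - a2) = a1 - a2); last by ring.
by rewrite [`|b2 - a2|]distrC; lra.
Qed.

End Iteration.

(** * Decomposition into primitive metrics *)

Section ProductExpectation.
Context {R : comPzRingType} {U : finType}.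
Context (w : U -> bool -> R).
Hypothesis w1 : forall u, w u true + w u false = 1.

Definition bexp (u : U) (f : bool -> R) : R := w u true * f true + w u false * f false.

(** An expectation under the product of the two-point weights [w u]; independence is the
    distributivity of product over sum. *)
Lemma sum_prod_weight (c : U -> bool -> R) :
  \sum_(j : {ffun U -> bool}) (\prod_u w u (j u)) * \prod_u c u (j u) =
  \prod_u bexp u (c u).
Proof.
transitivity (\prod_u \sum_b w u b * c u b); last first.
  by apply: eq_bigr => u _; rewrite big_bool.
rewrite bigA_distr_bigA; apply: eq_bigr => j _.
by rewrite big_split.
Qed.

Lemma expect2 (f : U -> bool -> R) (u v : U) :
  \sum_(j : {ffun U -> bool}) (\prod_u w u (j u)) * (f u (j u) * f v (j v)) =
  if u == v then bexp u (fun b => f u b * f u b) else bexp u (f u) * bexp v (f v).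
Proof.
(* Both factors are spread over all coordinates, with 1 elsewhere, so that one product formula
   covers u = v as well. *)
pose c x b := (if x == u then f u b else 1) * (if x == v then f v b else 1).
have E (j : {ffun U -> bool}) : f u (j u) * f v (j v) = \prod_x c x (j x).
  rewrite /c big_split/= -!big_mkcond !big_pred1_eq//.
under eq_bigr do rewrite E; rewrite sum_prod_weight.
have one x : x != u -> x != v -> bexp x (c x) = 1.
  by move=> /negbTE xu /negbTE xv; rewrite /bexp /c xu xv !mulr1 w1.
have [uv|uv] := eqVneq u v.
  rewrite (bigD1 u)//= big1 ?mulr1 => [|x xu]; last by apply: one; rewrite -?uv.
  by rewrite /bexp /c -uv eqxx.
rewrite (bigD1 u)//= (bigD1 v) 1?eq_sym//= big1 ?mulr1 => [|x /andP[xu xv]]; last exact: one.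
by rewrite /bexp /c !eqxx (negbTE uv) [v == u]eq_sym (negbTE uv) !mulr1 !mul1r.
Qed.

End ProductExpectation.

Section Average.
Context {R : realType} (n : nat) (th : 'I_3 -> R) (f : 'I_3 -> bool -> R).

Definition coin (b : bool) (t : R) : R := if b then t else 1 - t.

(* Independent coins: the a-th coordinate of the random vector is the mean of
   n.+1 copies of f a, so that its variance is at most 1/n.+1 of theirs. *)
Definition coins : Type := {ffun 'I_3 * 'I_n.+1 -> bool}.

Definition coin_weight (j : coins) : R := \prod_u coin (j u) (th u.1).

Definition coin_mean (j : coins) (a : 'I_3) : R :=
  n.+1%:R^-1 * \sum_(i < n.+1) f a (j (a, i)).

Let mu a := th a * f a true + (1 - th a) * f a false.
Let s a := th a * (f a true * f a true) + (1 - th a) * (f a false * f a false).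

(** [mu] and [s] are the first and second moments of one coin. Different coordinates use disjoint
    sets of coins and are uncorrelated; within one coordinate only n.+1 of the (n.+1)^2 pairs
    consist of equal coins and contribute a variance. *)
Lemma coin_cov a b :
  \sum_(j : coins) coin_weight j * (coin_mean j a * coin_mean j b) =
  mu a * mu b + (if a == b then n.+1%:R^-1 * (s a - mu a ^+ 2) else 0).
Proof.
pose N : R := n.+1%:R.
have N0 : N != 0 by rewrite pnatr_eq0.
pose w (u : 'I_3 * 'I_n.+1) (x : bool) := coin x (th u.1).
have w1 u : w u true + w u false = 1 by rewrite /w /coin addrC subrK.
pose ff (u : 'I_3 * 'I_n.+1) := f u.1.
have E : \sum_(j : coins) coin_weight j * (coin_mean j a * coin_mean j b) =
  N^-1 ^+ 2 * \sum_(i < n.+1) \sum_(i' < n.+1)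
    (if (a, i) == (b, i') then s a else mu a * mu b).
  transitivity (N^-1 ^+ 2 * \sum_(i < n.+1) \sum_(i' < n.+1)
    \sum_(j : coins) coin_weight j * (ff (a, i) (j (a, i)) * ff (b, i') (j (b, i')))).
    under [in RHS]eq_bigr do rewrite exchange_big; rewrite [in RHS]exchange_big mulr_sumr/=.
    apply: eq_bigr => j _; rewrite /coin_mean.
    have -> (v x y z : R) : v * ((x * y) * (x * z)) = x ^+ 2 * (v * (y * z)) by ring.
    congr (_ * _).
    rewrite big_distrlr/= mulr_sumr; apply: eq_bigr => i _.
    by rewrite mulr_sumr.
  congr (_ * _); apply: eq_bigr => i _; apply: eq_bigr => i' _.
  rewrite (expect2 w1 ff (a, i) (b, i')) /bexp /w /coin /ff /=.
  by case: eqP => // -[<- _].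
rewrite E; have [<-|ab] := eqVneq a b; last first.
  under eq_bigr do under eq_bigr do rewrite xpair_eqE (negbTE ab) /=.
  by rewrite !sumr_const !card_ord -mulrnA -mulr_natl natrM -/N; field.
have -> : \sum_(i < n.+1) \sum_(i' < n.+1) (if (a, i) == (a, i') then s a else mu a * mu a)
   = N * (N * (mu a * mu a) + (s a - mu a * mu a)).
  transitivity (\sum_(i < n.+1) (N * (mu a * mu a) + (s a - mu a * mu a))).
    apply: eq_bigr => i _.
    transitivity (\sum_(i' < n.+1) (mu a * mu a + (if i' == i then s a - mu a * mu a else 0))).
      apply: eq_bigr => i' _; rewrite xpair_eqE eqxx /= eq_sym.
      by case: eqP => _; rewrite ?addr0// addrC subrK.
    by rewrite big_split/= sumr_const card_ord -mulr_natl -big_mkcond big_pred1_eq.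
  by rewrite sumr_const card_ord -[LHS]mulr_natl.
by rewrite -/N; field.
Qed.

End Average.

Section Decomposition.
Context {R : realType}.
Notation V4 := (R * 'rV[R]_3)%type.
Implicit Types (f g : V4 -> R) (z : V4) (O K : set V4).
Implicit Types (D : 'I_3 -> 'I_3 -> V4 -> R) (A : {set 'I_3}).

Definition quad D (h : 'I_3 -> R) z : R := \sum_i \sum_j h i * h j * D i j z.

(** The state of the elimination: [A] holds the remaining indices, the rows outside [A] vanish (by
    symmetry the columns too), and positivity is kept on [A] only. *)
Definition posdef_on O K A D (m : R) :=
  [/\ forall i j, smooth O (D i j), forall i j z, O z -> D i j z = D j i z,
      forall i j z, O z -> i \notin A -> D i j z = 0 &
      forall h z, K z -> m * \sum_(i in A) h i ^+ 2 <= quad D h z].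

(* Schur complement, in quadratic form version. *)
Lemma quad_schur (D : 'I_3 -> 'I_3 -> R) (p : 'I_3) (h h' : 'I_3 -> R) :
  (forall i j, D i j = D j i) -> D p p != 0 ->
  (forall i, h' i = if i == p then h p - \sum_q D p q / D p p * h q else h i) ->
  \sum_i \sum_j h' i * h' j * D i j =
  \sum_i \sum_j h i * h j * (D i j - D p i * D p j / D p p).
Proof.
move=> Ds Dp h'if; pose t := \sum_q D p q / D p p * h q.
have th : D p p * t = \sum_q D p q * h q.
  by rewrite /t mulr_sumr; apply: eq_bigr => q _; rewrite mulrA [_ * (_ / _)]mulrC divfK.
have h'E i : h' i = h i - (i == p)%:R * t.
  by rewrite h'if -/t; case: eqP => [->|_]; rewrite ?mul1r// mul0r subr0.
have d1 (F : 'I_3 -> R) : \sum_i (i == p)%:R * F i = F p.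
  rewrite (bigD1 p)//= eqxx mul1r big1 ?addr0// => i /negbTE ->.
  by rewrite mul0r.
have -> : \sum_i \sum_j h' i * h' j * D i j = \sum_i \sum_j h i * h j * D i j
   - t * (\sum_q D p q * h q) - t * (\sum_q D p q * h q) + t ^+ 2 * D p p.
  transitivity (\sum_i \sum_j h i * h j * D i j
     - \sum_i (i == p)%:R * (t * \sum_j D i j * h j)
     - \sum_i h i * (\sum_j (j == p)%:R * (t * D i j))
     + \sum_i (i == p)%:R * (\sum_j (j == p)%:R * (t ^+ 2 * D i j))).
    rewrite -!sumrB -big_split; apply: eq_bigr => i _ /=.
    rewrite !mulr_sumr -!sumrB -big_split; apply: eq_bigr => j _ /=.
    by rewrite !h'E; ring.
  rewrite !d1; congr (_ - _ - _ + _).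
  rewrite mulr_sumr; apply: eq_bigr => i _; rewrite d1 [D i p]Ds; ring.
rewrite -th.
have -> : \sum_i \sum_j h i * h j * (D i j - D p i * D p j / D p p) =
   \sum_i \sum_j h i * h j * D i j - (\sum_q D p q * h q) ^+ 2 / D p p.
  rewrite expr2 big_distrlr/= mulr_suml -sumrB; apply: eq_bigr => i _.
  by rewrite mulr_suml -sumrB; apply: eq_bigr => j _; field.
by rewrite -th; field.
Qed.

(* Splitting off the square of D_p / D_pp from D leaves the Schur complement.
   That square has variable direction; it is the mean of squares of random
   constant directions with coordinates +-L, up to the variance of these, which
   averaging n.+1 independent copies makes negligible. *)
Lemma eliminate O K A D p m : open O -> K `<=` O -> compact K -> p \notin A ->
  0 < m -> posdef_on O K (p |: A) D m ->
  exists O' D' (I : finType) (l : I -> 'I_3 -> R) (r : I -> V4 -> R),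
  [/\ [/\ open O', K `<=` O' & O' `<=` O], posdef_on O' K A D' (m / 2),
      forall k, smooth O' (r k), forall k z, K z -> 0 < r k z &
      forall z i j, O' z -> \sum_k r k z * l k i * l k j + D' i j z = D i j z].
Proof.
move=> oO KO cK pA m0 [sD symD suppD posD].
have Dpp z : K z -> 0 < D p p z.
  move=> Kz; have := posD (fun i => (i == p)%:R) z Kz.
  rewrite (bigD1 p) ?setU11//= eqxx expr1n big1 => [|i /andP[_ /negbTE ->]]; last first.
    by rewrite expr0n.
  rewrite addr0 mulr1 => h; apply: lt_le_trans m0 (le_trans h _).
  rewrite /quad (bigD1 p)//= [X in _ + X]big1 => [|i /negbTE ip]; last first.
    by rewrite big1// => j _; rewrite ip !mul0r.
  rewrite addr0 (bigD1 p)//= [X in _ + X]big1 => [|j /negbTE ->]; last by rewrite mulr0 mul0r.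
  by rewrite eqxx !mul1r addr0.
pose O1 := O `&` [set z | 0 < D p p z].
have oO1 : open O1 by exact: open_gt0.
have O1O : O1 `<=` O by move=> z [].
have KO1 : K `<=` O1 by move=> z Kz; split; [exact: KO|exact: Dpp].
have sD1 i j : smooth O1 (D i j) by exact: smooth_sub O1O (sD i j).
have Dp0 z : O1 z -> D p p z != 0 by move=> [_ /= h]; rewrite gt_eqF.
pose mu q z := D p q z * (D p p z)^-1.
have smu q : smooth O1 (mu q) by apply: smoothM => //; apply: smooth_inv.
have [B B0 HB] := family_bounded KO1 cK smu.
have [B' B'0 HB'] := family_bounded KO1 cK (fun _ : 'I_1 => sD1 p p).
pose L := B + 2.
have L0 : 0 < L by rewrite addr_gt0.
(* The probability of the value L, against -L, that makes the mean [mu q]. As |mu q| <= B < L on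
   [K], it lies strictly between 0 and 1, so that all weights are positive. *)
pose th q z := (mu q z + L) / (2 * L).
have L2 : 0 < 2 * L by rewrite mulr_gt0.
have sth q : smooth O1 (th q).
  by apply: smoothM => //; [apply: smoothD => //|]; exact: smooth_cst.
have th01 q z : K z -> 0 < th q z < 1.
  move=> Kz; have := HB q z Kz; rewrite ler_norml => /andP[h1 h2].
  have LE : L = B + 2 by [].
  by apply/andP; split; rewrite /th; [apply: divr_gt0 => //|rewrite ltr_pdivrMr//]; lra.
(* [B'] bounds D_pp and L^2 the variance of a coin; the averaged noise costs at most half of [m]. *)
have [n Hn] : exists n : nat, n.+1%:R^-1 * (B' * L ^+ 2) <= m / 2.
  have m20 : 0 < m / 2 by rewrite divr_gt0.
  pose x := B' * L ^+ 2 / (m / 2).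
  have x0 : 0 <= x by rewrite ltW// divr_gt0// mulr_gt0// exprn_gt0.
  exists (Num.bound x); rewrite ler_pdivrMl ?ltr0n// -ler_pdivrMr//.
  by apply: (le_trans (ltW (archi_boundP x0))); rewrite ler_nat.
(* Coordinate [p] is surely 1, in accordance with D_pp / D_pp, and coordinates outside [p |: A] are
   0 like the rows of [D]. *)
pose f (q : 'I_3) (b : bool) : R :=
  if q == p then 1 else if q \in A then (if b then L else - L) else 0.
have muE q z : O1 z -> th q z * f q true + (1 - th q z) * f q false = mu q z.
  move=> Oz; rewrite /f; have [->|qp] := eqVneq q p.
    by rewrite !mulr1 addrC subrK /mu divff// Dp0.
  case: ifPn => qA; first by rewrite /th; field; rewrite gt_eqF.
  rewrite !mulr0 addr0 /mu symD; last exact: O1O.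
  rewrite suppD ?mul0r//; first exact: O1O.
  by rewrite !inE negb_or qp.
pose v q z := if q \in A then L ^+ 2 - mu q z ^+ 2 else 0.
have vE q z : O1 z -> th q z * (f q true * f q true) + (1 - th q z) * (f q false * f q false)
    - mu q z ^+ 2 = v q z.
  move=> Oz; have := muE q z Oz; rewrite /f /v; have [->|qp] := eqVneq q p.
    by rewrite (negbTE pA) !mulr1 => <-; ring.
  case: ifPn => qA; first by move=> _; ring.
  by rewrite !mulr0 addr0 => <-; rewrite expr0n subr0.
pose N : R := n.+1%:R.
pose T i j z := D p i z * D p j z / D p p z
   + (if i == j then D p p z * (N^-1 * v i z) else 0).
have sv q : smooth O1 (v q).
  rewrite /v; case: (q \in A); last exact: smooth_cst.
  by apply: smoothD => //; [exact: smooth_cst|apply: smoothN => //; exact: smoothX].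
have sT i j : smooth O1 (T i j).
  apply: smoothD => //.
    by apply: smoothM => //; [exact: smoothM|exact: smooth_inv].
  case: (i == j); last exact: smooth_cst.
  by apply: smoothM => //; apply: smoothM => //; exact: smooth_cst.
exists O1, (fun i j z => D i j z - T i j z), (coins n : finType), (coin_mean f),
  (fun j z => D p p z * coin_weight (th^~ z) j); split => //.
- split.
  + by move=> i j; apply: smoothD => //; exact: smoothN.
  + move=> i j z Oz; have Oz' := O1O _ Oz; rewrite /T (symD i j)//.
    rewrite [D p j z * _]mulrC [j == i]eq_sym.
    by have [->|ij] := eqVneq i j.
  + move=> i j z Oz iA; have Oz' := O1O _ Oz; rewrite /T.
    have vi : v i z = 0 by rewrite /v (negbTE iA).
    rewrite vi !mulr0 if_same addr0.
    have [->|ip] := eqVneq i p; first by field; exact: Dp0.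
    have iU : i \notin p |: A by rewrite !inE negb_or ip.
    by rewrite (suppD i j)// (symD p i)// (suppD i p)// !mul0r subrr.
  + move=> h z Kz; have Oz1 := KO1 _ Kz; have Oz := KO _ Kz.
    pose h' i := if i == p then h p - \sum_q D p q z / D p p z * h q else h i.
    have S : quad D h' z = \sum_i \sum_j h i * h j * (D i j z - D p i z * D p j z / D p p z).
      apply: (quad_schur (D := fun i j => D i j z)) => //; last exact: Dp0.
      by move=> i j; exact: symD.
    have E : quad (fun i j z => D i j z - T i j z) h z = quad D h' z -
        \sum_(i in A) D p p z * (N^-1 * v i z) * h i ^+ 2.
      rewrite S /quad.
      have -> : \sum_(i in A) D p p z * (N^-1 * v i z) * h i ^+ 2 =
          \sum_i \sum_j h i * h j * (if i == j then D p p z * (N^-1 * v i z) else 0).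
        rewrite big_mkcond; apply: eq_bigr => i _.
        rewrite (bigD1 i)//= eqxx big1 => [|j /negbTE]; last first.
          by rewrite eq_sym => ->; rewrite mulr0.
        rewrite addr0 /v; case: (i \in A); last by rewrite !mulr0.
        by rewrite expr2 mulrC.
      rewrite -sumrB; apply: eq_bigr => i _; rewrite -sumrB; apply: eq_bigr => j _.
      by rewrite /T opprD addrA -mulrBr.
    rewrite E.
    have h1 : m * \sum_(i in A) h i ^+ 2 <= quad D h' z.
      apply: le_trans (posD h' z Kz); rewrite ler_pM2l//.
      rewrite big_setU1//= /h' [X in _ <= _ + X](eq_bigr (fun i => h i ^+ 2)) => [|i iA].
        by rewrite lerDr sqr_ge0.
      by rewrite ifN//; apply: contraNneq pA => <-.
    have h2 : \sum_(i in A) D p p z * (N^-1 * v i z) * h i ^+ 2 <= m / 2 * \sum_(i in A) h i ^+ 2.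
      rewrite mulr_sumr; apply: ler_sum => i iA; rewrite ler_wpM2r ?sqr_ge0//.
      apply: le_trans Hn; rewrite mulrCA ler_wpM2l ?invr_ge0//.
      have Dle : D p p z <= B' by apply: le_trans (ler_norm _) (HB' ord0 z Kz).
      have v0 : 0 <= v i z <= L ^+ 2.
        rewrite /v iA lerBlDr lerDl sqr_ge0 andbT subr_ge0.
        rewrite -[leLHS]real_normK ?num_real// ler_sqr ?nnegrE ?(ltW L0)//.
        by apply: (le_trans (HB i z Kz)); rewrite /L lerDl.
      by case/andP: v0 => v0 v1; apply: ler_pM => //; rewrite ltW// Dpp.
    move: h1 h2; move: (\sum_(i in A) h i ^+ 2) (quad _ _ _) (\sum_(i in A) _) => u1 u2 u3; lra.
- move=> j; apply: smoothM => //; apply: smooth_prod => // u _.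
  rewrite /coin; case: (j u) => //.
  by apply: smoothD => //; [exact: smooth_cst|exact: smoothN].
- move=> j z Kz; rewrite mulr_gt0 ?Dpp//; apply: prodr_gt0 => u _.
  by rewrite /coin; have /andP[t0 t1] := th01 u.1 z Kz; case: ifP; rewrite ?subr_gt0.
- move=> z i j Oz.
  have -> : \sum_(k : coins n) D p p z * coin_weight (th^~ z) k * coin_mean f k i * coin_mean f k j =
     D p p z * \sum_(k : coins n) coin_weight (th^~ z) k * (coin_mean f k i * coin_mean f k j).
    by rewrite mulr_sumr; apply: eq_bigr => k _; rewrite !mulrA.
  rewrite coin_cov !muE// (vE i z Oz) /T.
  have -> : D p i z * D p j z / D p p z = D p p z * (mu i z * mu j z).
    by rewrite /mu; field; exact: Dp0.
  by case: eqP => _; ring.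
Qed.

End Decomposition.

Section Spanning.
Context {R : realType}.

Definition pair_dir (ab : 'I_3 * 'I_3) (i : 'I_3) : R := (i == ab.1)%:R + (i == ab.2)%:R.

(** Polarization. An off-diagonal E_ab is carried by the square of e_a + e_b, with weight 1/2 since
    each pair occurs in both orders. For equal indices the direction is 2 e_a, with square 4 e_a (x)
    e_a, and the coefficient also removes the diagonal surplus that the mixed pairs create. *)
Definition pair_coef (ab : 'I_3 * 'I_3) (a b : 'I_3) : R :=
  if ab.1 == ab.2 then
    (if a == ab.1 then (if b == ab.1 then 1 / 4 else - (1 / 4)) else 0)
  else (if (a == ab.1) && (b == ab.2) then 1 / 2 else 0).

Lemma sum_pair (F : 'I_3 * 'I_3 -> R) : \sum_ab F ab = \sum_a \sum_b F (a, b).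
Proof. by rewrite pair_bigA; apply: eq_bigr => -[]. Qed.

Lemma pair_dir_spanning : spanning pair_dir.
Proof.
exists pair_coef => E Es i j; rewrite sum_pair.
have [E10 E20 E21] : [/\ E 1 0 = E 0 1, E 2 0 = E 0 2 & E 2 1 = E 1 2] by split; exact: Es.
have H (P : 'I_3 -> Prop) : P 0 -> P 1 -> P 2 -> forall i, P i.
  move=> P0 P1 P2 [[|[|[|n]]] hi]; last by [].
  - by rewrite (_ : Ordinal hi = 0)//; exact: val_inj.
  - by rewrite (_ : Ordinal hi = 1)//; exact: val_inj.
  - by rewrite (_ : Ordinal hi = 2)//; exact: val_inj.
have S3 (F : 'I_3 -> R) : \sum_i F i = F 0 + F 1 + F 2.
  rewrite !big_ord_recl big_ord0 addr0 addrA; congr (_ + F _ + F _); exact: val_inj.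
rewrite !S3 /pair_coef /pair_dir /=.
by move: i j; apply: (H); apply: (H); rewrite /= ?E10 ?E20 ?E21; field.
Qed.

Lemma spanning_inr (I J : finType) (l : I -> 'I_3 -> R) (l' : J -> 'I_3 -> R) :
  spanning l' -> spanning (fun k : I + J => match k with inl k => l k | inr k => l' k end).
Proof.
case=> c Hc; exists (fun k => match k with inl _ => fun _ _ => 0 | inr k => c k end) => E Es i j.
rewrite big_sumType/= [X in X + _]big1 ?add0r; last first.
  by move=> k _; rewrite big1 ?mul0r// => a _; rewrite big1// => b _; rewrite mul0r.
exact: Hc.
Qed.

End Spanning.

Section Decompose.
Context {R : realType}.
Notation V4 := (R * 'rV[R]_3)%type.
Implicit Types (f g : V4 -> R) (z : V4) (O K : set V4).
Implicit Types (D : 'I_3 -> 'I_3 -> V4 -> R) (A : {set 'I_3}).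

(** Three eliminations exhaust the indices and leave zero, but the directions that they produce are
    not known to span. A small multiple of the squares of all [pair_dir] is therefore set aside
    first and added back at the end with the positive coefficient [eta]. *)
Lemma decompose O K D m : open O -> K `<=` O -> compact K -> 0 < m ->
  posdef_on O K (finset.setTfor 'I_3) D m ->
  exists O' (I : finType) (l : I -> 'I_3 -> R) (r : I -> V4 -> R),
  [/\ [/\ open O', K `<=` O' & O' `<=` O], spanning l,
      forall k, smooth O' (r k), forall k z, K z -> 0 < r k z &
      forall z i j, O' z -> \sum_k r k z * l k i * l k j = D i j z].
Proof.
move=> oO KO cK m0 [sD symD _ posD].
(* The squares of all nine pairs add up to at most 12 times the sum of the h_i^2, so that setting
   them aside costs half of [m]. *)
pose eta := m / 24%:R.
have eta0 : 0 < eta by rewrite divr_gt0// ltr0n.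
pose S (i j : 'I_3) : R := \sum_ab @pair_dir R ab i * pair_dir ab j.
pose D0 i j z := D i j z - eta * S i j.
have [A1 p1] : posdef_on O K (finset.setTfor 'I_3) D0 (m / 2) /\ True; last clear p1.
  split=> //; split.
  - by move=> i j; apply: smoothD => //; exact: smooth_cst.
  - move=> i j z Oz; rewrite /D0 symD//; congr (_ - _ * _).
    by apply: eq_bigr => ab _; rewrite mulrC.
  - by move=> i j z _; rewrite inE.
  - move=> h z Kz.
    have -> : quad D0 h z = quad D h z - eta * \sum_ab (h ab.1 + h ab.2) ^+ 2.
      have -> : \sum_(ab : 'I_3 * 'I_3) (h ab.1 + h ab.2) ^+ 2 = \sum_i \sum_j h i * h j * S i j.
        under [RHS]eq_bigr do under eq_bigr do rewrite mulr_sumr.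
        under [RHS]eq_bigr do rewrite exchange_big/=.
        rewrite exchange_big/=; apply: eq_bigr => ab _.
        have -> : h ab.1 + h ab.2 = \sum_i h i * pair_dir ab i.
          rewrite /pair_dir; under eq_bigr do rewrite mulrDr !mulr_natr !mulrb.
          by rewrite big_split/= -!big_mkcond !big_pred1_eq.
        rewrite expr2 big_distrlr; apply: eq_bigr => i _; apply: eq_bigr => j _ /=.
        by ring.
      rewrite /quad mulr_sumr -sumrB; apply: eq_bigr => i _.
      by rewrite mulr_sumr -sumrB; apply: eq_bigr => j _; rewrite /D0; ring.
    have : \sum_(ab : 'I_3 * 'I_3) (h ab.1 + h ab.2) ^+ 2 <= 12%:R * \sum_(i in (finset.setTfor 'I_3)) h i ^+ 2.
      have -> : 12%:R * \sum_(i in (finset.setTfor 'I_3)) h i ^+ 2 =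
          \sum_(ab : 'I_3 * 'I_3) (2 * h ab.1 ^+ 2 + 2 * h ab.2 ^+ 2).
        rewrite sum_pair; have -> : \sum_(i in (finset.setTfor 'I_3)) h i ^+ 2 = \sum_i h i ^+ 2.
          by apply: eq_bigl => i; rewrite inE.
        transitivity (\sum_i (3%:R * (2 * h i ^+ 2) + 2 * \sum_j h j ^+ 2)).
          by rewrite big_split/= sumr_const card_ord -!mulr_sumr -(mulr_natl (2 * _)); ring.
        apply: eq_bigr => i _.
        by rewrite big_split/= sumr_const card_ord -mulr_sumr -(mulr_natl (2 * _)).
      apply: ler_sum => ab _; rewrite -subr_ge0.
      by rewrite (_ : _ - _ = (h ab.1 - h ab.2) ^+ 2) ?sqr_ge0//; ring.
    have := posD h z Kz; rewrite /eta.
    move: (quad D h z) (\sum_(ab : 'I_3 * 'I_3) _) (\sum_(i in _) _) => u1 u2 u3 e1 e2.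
    have : m / 24%:R * u2 <= m / 24%:R * (12%:R * u3) by rewrite ler_pM2l.
    by move: e1; rewrite -!mulrA; move: (m * _) => x e1; lra.
have m20 : 0 < m / 2 by rewrite divr_gt0.
have E0 : 0 |: ((finset.setTfor 'I_3) :\ 0) = (finset.setTfor 'I_3) by apply: finset.setD1K; rewrite inE.
have E1 : 1 |: ((finset.setTfor 'I_3) :\ 0 :\ 1) = (finset.setTfor 'I_3) :\ 0 by apply: finset.setD1K; rewrite !inE.
have E2 : 2 |: ((finset.setTfor 'I_3) :\ 0 :\ 1 :\ 2) = (finset.setTfor 'I_3) :\ 0 :\ 1 by apply: finset.setD1K; rewrite !inE.
rewrite -E0 in A1.
have [|O1 [D1 [I1 [l1 [r1 [[oO1 KO1 O1O] pD1 sr1 r10 H1]]]]]] := eliminate oO KO cK _ m20 A1.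
  by rewrite !inE.
rewrite -E1 in pD1; have m4 : 0 < m / 2 / 2 by rewrite divr_gt0.
have [|O2 [D2 [I2 [l2 [r2 [[oO2 KO2 O2O] pD2 sr2 r20 H2]]]]]] := eliminate oO1 KO1 cK _ m4 pD1.
  by rewrite !inE.
rewrite -E2 in pD2; have m8 : 0 < m / 2 / 2 / 2 by rewrite divr_gt0.
have [|O3 [D3 [I3 [l3 [r3 [[oO3 KO3 O3O] [_ _ supp3 _] sr3 r30 H3]]]]]] := eliminate oO2 KO2 cK _ m8 pD2.
  by rewrite !inE.
have D30 i j z : O3 z -> D3 i j z = 0.
  move=> Oz; apply: supp3 => //; rewrite !inE.
  by case: i => [[|[|[|n]]] hi].
exists O3, (I1 + (I2 + (I3 + 'I_3 * 'I_3)))%type,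
  (fun k => match k with inl k => l1 k | inr (inl k) => l2 k
     | inr (inr (inl k)) => l3 k | inr (inr (inr k)) => pair_dir k end),
  (fun k => match k with inl k => r1 k | inr (inl k) => r2 k
     | inr (inr (inl k)) => r3 k | inr (inr (inr k)) => fun=> eta end); split.
- by split => // z /O3O/O2O/O1O.
- have := spanning_inr l1 (spanning_inr l2 (spanning_inr l3 pair_dir_spanning)).
  by congr spanning; apply/funext => -[|[|[|]]].
- move=> [k|[k|[k|k]]].
  + by apply: smooth_sub (sr1 k) => z /O3O/O2O.
  + by apply: smooth_sub (sr2 k).
  + exact: sr3.
  + exact: smooth_cst.
- move=> [k|[k|[k|k]]] z Kz; [exact: r10|exact: r20|exact: r30|exact: eta0].
- move=> z i j Oz; have Oz2 := O3O _ Oz; have Oz1 := O2O _ Oz2.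
  rewrite !big_sumType/=.
  have -> : \sum_(ab : 'I_3 * 'I_3) eta * pair_dir ab i * pair_dir ab j = eta * S i j.
    by rewrite mulr_sumr; apply: eq_bigr => ab _; rewrite mulrA.
  have := H1 z i j Oz1; have := H2 z i j Oz2; have := H3 z i j Oz; rewrite D30// /D0.
  by move: (\sum_k _) (\sum_k _) (\sum_k _) (eta * _) => u1 u2 u3 u4; lra.
Qed.

End Decompose.

(** * The limit embedding *)

Section Vectors.
Context {R : realType}.

Lemma rV_norm_le n (v : 'rV[R]_n) (M : R) : 0 <= M -> (forall i, `|v 0 i| <= M) -> `|v| <= M.
Proof.
move=> M0 H; rewrite [leLHS]/Num.Def.normr /= mx_normrE; apply: bigmax_le => // -[i j] _ /=.
by rewrite ord1.
Qed.

Lemma continuous_linear_rV n (W : normedModType R) (c : 'I_n -> W) :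
  continuous (fun h : 'rV[R]_n => \sum_i h 0 i *: c i).
Proof.
move=> h; have -> : (fun h : 'rV[R]_n => \sum_i h 0 i *: c i) =
    \sum_i (fun h : 'rV[R]_n => h 0 i *: c i).
  by apply/funext => k; rewrite fct_sumE.
apply: differentiable_continuous; apply: differentiable_sum => i.
by apply: differentiableZl; exact: differentiable_coord.
Qed.

Section LinearOfCoef.
Context {n : nat} {W : normedModType R} (c : 'I_n -> W).

Definition lin_coef (h : 'rV[R]_n) : W := \sum_i h 0 i *: c i.

Lemma lin_coef_linear : linear lin_coef.
Proof.
move=> a u v; rewrite /lin_coef scaler_sumr -big_split; apply: eq_bigr => i _ /=.
by rewrite !mxE scalerDl scalerA.
Qed.

HB.instance Definition _ :=
  GRing.isLinear.Build R 'rV[R]_n W *:%R lin_coef lin_coef_linear.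

End LinearOfCoef.

Lemma is_diff_of_eps n (W : normedModType R) (f : 'rV[R]_n -> W) (c : 'I_n -> W) x :
  (forall e : R, 0 < e -> \forall h \near (0 : 'rV[R]_n),
     `|f (h + x) - f x - \sum_i h 0 i *: c i| <= e * `|h|) ->
  differentiable f x /\ forall i, 'D_(delta_mx 0 i) f x = c i.
Proof.
move=> H; have [df dE] : is_diff x f (lin_coef c).
  by apply: is_diff_eps => //; exact: continuous_linear_rV.
split => // i; rewrite deriveE// dE /lin_coef (bigD1 i)//= mxE !eqxx scale1r.
by rewrite big1 ?addr0// => j /negbTE ji; rewrite mxE ji andbF scale0r.
Qed.

End Vectors.

Section ClosureProduct.
Context {R : realType}.
Notation V4 := (R * 'rV[R]_3)%type.
Context (T : R) (Om : set 'rV[R]_3).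
Hypothesis oOm : open Om.
Hypothesis cOm : compact (closure Om).

Definition cyl : set V4 := `[0, T]%classic `*` closure Om.

Lemma cyl_compact : compact cyl.
Proof. by apply: compact_setX => //; exact: segment_compact. Qed.

Lemma cyl_in (t : R) x : 0 <= t <= T -> Om x -> cyl (t, x).
Proof. by move=> t0 Omx; split; [rewrite /= in_itv|exact: subset_closure]. Qed.

(** The neighbourhood [O] depends on [e], because each corrugation may shrink the domain on which
    the maps are smooth. *)
Definition C1_limit (Y : 'I_6 -> V4 -> R) (Z : 'I_3 -> 'I_6 -> V4 -> R) :=
  forall e : R, 0 < e -> exists y O, [/\ open O, cyl `<=` O, forall k, smooth O (y k)
    & forall z, cyl z -> (forall k, `|y k z - Y k z| <= e) /\
        (forall i k, `|dx i (y k) z - Z i k z| <= e)].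

Context (Y : 'I_6 -> V4 -> R) (Z : 'I_3 -> 'I_6 -> V4 -> R).
Hypothesis YZ : C1_limit Y Z.

Definition rowmap : R -> 'rV[R]_3 -> 'rV[R]_6 := fun t x => \row_k Y k (t, x).

Lemma limit_near (U : V4 -> R) :
  (forall e : R, 0 < e -> exists (phi : V4 -> R) O, [/\ open O, cyl `<=` O, smooth O phi &
     forall z, cyl z -> `|phi z - U z| <= e]) ->
  forall z (e : R), cyl z -> 0 < e -> \forall w \near z, cyl w -> `|U w - U z| <= e.
Proof.
move=> H z e Kz e0; have e3 : 0 < e / 3%:R by rewrite divr_gt0.
have [phi [ O [oO KO sphi Hphi]]] := H _ e3.
have /cvgrPdist_le /(_ _ e3) := smooth_continuous sphi (KO _ Kz).
apply: filterS => w hw Kw; have := Hphi _ Kz; have := Hphi _ Kw; move: hw.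
move: (phi z) (phi w) (U z) (U w) => a b c d.
rewrite !ler_norml => /andP[? ?] /andP[? ?] /andP[? ?].
by apply/andP; split; lra.
Qed.

Lemma limit_Y k (e : R) : 0 < e -> exists (phi : V4 -> R) O,
  [/\ open O, cyl `<=` O, smooth O phi & forall z, cyl z -> `|phi z - Y k z| <= e].
Proof.
move=> e0; have [y [ O [oO KO sy H]]] := YZ e0.
by exists (y k), O; split => // z Kz; have [h _] := H z Kz.
Qed.

Lemma limit_Z i k (e : R) : 0 < e -> exists (phi : V4 -> R) O,
  [/\ open O, cyl `<=` O, smooth O phi & forall z, cyl z -> `|phi z - Z i k z| <= e].
Proof.
move=> e0; have [y [ O [oO KO sy H]]] := YZ e0.
exists (dx i (y k)), O; split => //; first exact: smooth_dx.
by move=> z Kz; have [_ h] := H z Kz.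
Qed.

Lemma limit_bounded (U : V4 -> R) :
  (forall e : R, 0 < e -> exists (phi : V4 -> R) O, [/\ open O, cyl `<=` O, smooth O phi &
     forall z, cyl z -> `|phi z - U z| <= e]) ->
  exists M, forall z, cyl z -> `|U z| <= M.
Proof.
move=> H; have [phi [ O [oO KO sphi Hphi]]] := H 1 ltr01.
have [|B B0 HB] := @compact_continuous_bounded _ _ cyl phi cyl_compact.
  by move=> z Kz; apply: smooth_continuous (KO _ Kz).
exists (B + 1) => z Kz; rewrite -(subrK (phi z) (U z)) addrC (le_trans (ler_normD _ _))//.
by apply: lerD; [exact: HB|rewrite distrC; exact: Hphi].
Qed.

(** Uniformity in x comes from compactness of [closure Om], applied to a smooth approximant, which
    is continuous on a full neighbourhood; [U] itself is controlled on [cyl] only. *)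
Lemma limit_time (U : V4 -> R) :
  (forall e : R, 0 < e -> exists (phi : V4 -> R) O, [/\ open O, cyl `<=` O, smooth O phi &
     forall z, cyl z -> `|phi z - U z| <= e]) ->
  forall t0 e : R, 0 <= t0 <= T -> 0 < e ->
  \forall t \near t0, 0 <= t <= T -> forall x, closure Om x -> `|U (t, x) - U (t0, x)| <= e.
Proof.
move=> H t0 e t0T e0; have e4 : 0 < e / 4 by rewrite divr_gt0.
have [phi [ O [oO KO sphi Hphi]]] := H _ e4.
have /compact_near_coveringP cO := cOm.
have ph x : closure Om x -> \forall x' \near x & i \near t0,
    `|phi (i, x') - phi (t0, x')| <= e / 2.
  move=> Cx; have Kx : cyl (t0, x) by split => //=; rewrite in_itv.
  have /cvgrPdist_le /(_ _ e4) := smooth_continuous sphi (KO _ Kx).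
  move=> [[A B] /= [nA nB] AB].
  exists (B, A) => // -[x' t] /= [Bx' At].
  have h1 := AB (t, x') (conj At Bx'); have h2 := AB (t0, x') (conj (nbhs_singleton nA) Bx').
  move: h1 h2 => /=; move: (phi (t0, x)) (phi (t, x')) (phi (t0, x')) => a b c.
  rewrite !ler_norml => /andP[? ?] /andP[? ?].
  by apply/andP; split; lra.
have nt : \forall t \near t0, forall x, closure Om x ->
    `|phi (t, x) - phi (t0, x)| <= e / 2 := cO _ (nbhs t0) (fun t x => `|phi (t, x) - phi (t0, x)| <= e / 2) _ ph.
near=> t => tT x Cx.
have Ht : forall x, closure Om x -> `|phi (t, x) - phi (t0, x)| <= e / 2.
  by near: t; exact: nt.
have := Ht x Cx; have := Hphi (t, x); have := Hphi (t0, x).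
move=> /(_ (conj _ Cx)); rewrite /= in_itv/= t0T => /(_ isT).
move=> + /(_ (conj _ Cx)); rewrite /= in_itv/= tT => + /(_ isT).
move: (phi (t, x)) (phi (t0, x)) (U (t, x)) (U (t0, x)) => a b c d.
rewrite !ler_norml => /andP[? ?] /andP[? ?] /andP[? ?].
by apply/andP; split; lra.
Unshelve. all: by end_near. Qed.

(** Maps and x-derivatives converge uniformly. The approximating map is chosen after the increment
    [h], within d |h| of [Y], and the mean value theorem is applied to it. *)
Lemma rowmap_diff (t : R) x : 0 <= t <= T -> Om x ->
  differentiable (rowmap t) x /\
  forall i, partial i (rowmap t) x = \row_k Z i k (t, x).
Proof.
move=> tT Omx; apply: is_diff_of_eps => e e0.
(* Two values with error d |h| each and three partial derivatives with error 2 d each add up to 8 d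
   |h|. *)
pose d := e / 8%:R; have d0 : 0 < d by rewrite divr_gt0.
have Kx : cyl (t, x) by exact: cyl_in.
have nZ : \forall w \near (t, x), cyl w -> forall ik : 'I_3 * 'I_6, `|Z ik.1 ik.2 w - Z ik.1 ik.2 (t, x)| <= d.
  have : forall ik : 'I_3 * 'I_6, \forall w \near (t, x), cyl w -> `|Z ik.1 ik.2 w - Z ik.1 ik.2 (t, x)| <= d.
    by move=> [i k]; apply: limit_near => //; exact: limit_Z.
  by move=> /filter_forall; apply: filterS => w h Kw ik; exact: h.
have /nbhs_ballP[r1 /= r10 Hr1] : nbhs x Om by exact: open_nbhs_nbhs.
move: nZ => /nbhs_ballP[r2 /= r20 Hr2].
pose r := Num.min r1 r2.
have r0 : 0 < r by rewrite lt_min r10.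
have : \forall h \near (0 : 'rV[R]_3), `|h| < r.
  apply/nbhs_ballP; exists r => // h; rewrite -ball_normE /= sub0r normrN//.
apply: filterS => h hr; apply: rV_norm_le; first by rewrite mulr_ge0// ltW.
move=> k; have [->|h0] := eqVneq h 0.
  rewrite add0r subrr sub0r normr0 mulr0 big1 ?oppr0 ?mxE ?normr0// => i _.
  by rewrite mxE scale0r.
have hn : 0 < `|h| by rewrite normr_gt0.
have dn : 0 < Num.min d (d * `|h|) by rewrite lt_min d0 mulr_gt0.
have [y [ O [oO KO sy Hy]]] := YZ dn.
have bx : ball (t, x) r (t, x) by exact: ballxx.
have ballE (w : 'rV[R]_3) : ball (t, x) r (t, w) -> cyl (t, w) /\ ball (t, x) r2 (t, w).
  move=> bw; split; last by apply: le_ball bw; rewrite ge_min lexx orbT.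
  apply: cyl_in => //; apply: Hr1.
  by case: bw => _ /= bw; apply: le_ball bw; rewrite ge_min lexx.
have bh : ball (t, x) r (t, h + x).
  split; first exact: ballxx.
  by rewrite /= -ball_normE /= opprD addrCA subrr addr0 normrN.
have [Kh _] := ballE _ bh.
pose F : V4 -> R := y k.
have [s bs] : exists2 s, ball (t, x) r (t, s) &
   F (t, h + x) - F (t, x) = \sum_(i < 3) (h + x - x) 0 i * dx i F (t, s).
  have H : forall s : R, 0 <= s <= 1 -> differentiable F (s *: ((0, h) : V4) + (t, x)).
    move=> s s01; apply: smooth_diff (sy k) _; apply: KO.
    have -> : s *: ((0, h) : V4) + (t, x) = s *: ((t, h + x) - (t, x)) + (t, x).
      by congr pair; rewrite /= ?subrr// addrK.
    have bs := ball_segment bx bh s01.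
    move: bs; rewrite (_ : s *: ((t, h + x) - (t, x)) + (t, x) = (t, s *: h + x)).
      by move=> /ballE[].
    by congr pair; rewrite /= ?subrr ?scaler0 ?add0r// addrK.
  have [s s01 E] := mvt_line H.
  have sE : s *: ((0, h) : V4) + (t, x) = (t, s *: h + x).
    by congr pair; rewrite /= scaler0 add0r.
  exists (s *: h + x).
    have := ball_segment bx bh s01.
    rewrite (_ : s *: ((t, h + x) - (t, x)) + (t, x) = (t, s *: h + x))//.
    by congr pair; rewrite /= ?subrr ?scaler0 ?add0r// addrK.
  rewrite addrK -derive_horizontal -?sE; last exact: H.
  by rewrite -E; congr (F _ - _); congr pair; rewrite /= add0r.
rewrite addrK => E.
have [Ks bs2] := ballE _ bs.
have [yh dyh] := Hy _ Kh; have [yx _] := Hy _ Kx; have [_ dys] := Hy _ Ks.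
have e1 : `|F (t, h + x) - Y k (t, h + x)| <= d * `|h|.
  by apply: (le_trans (yh k)); rewrite ge_min lexx orbT.
have e2 : `|F (t, x) - Y k (t, x)| <= d * `|h|.
  by apply: (le_trans (yx k)); rewrite ge_min lexx orbT.
have e3 : `|\sum_(i < 3) h 0 i * (dx i F (t, s) - Z i k (t, x))| <= 3%:R * (`|h| * (2 * d)).
  apply: sum_row_le => i; first exact: ler_coord.
  have h1 : `|dx i F (t, s) - Z i k (t, s)| <= d by apply: (le_trans (dys i k)); rewrite ge_min lexx.
  have h2 : `|Z i k (t, s) - Z i k (t, x)| <= d by exact: (Hr2 _ bs2 Ks (i, k)).
  rewrite -(subrK (Z i k (t, s)) (dx i F (t, s))) -addrA (le_trans (ler_normD _ _))//.
  by rewrite mulr_natl mulr2n lerD.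
have -> : (rowmap t (h + x) - rowmap t x - \sum_i h 0 i *: \row_k0 Z i k0 (t, x)) 0 k =
   Y k (t, h + x) - Y k (t, x) - \sum_i h 0 i * Z i k (t, x).
  rewrite !mxE summxE; congr (_ - _); apply: eq_bigr => i _.
  by rewrite !mxE.
have E2 : \sum_(i < 3) h 0 i * (dx i F (t, s) - Z i k (t, x)) =
    F (t, h + x) - F (t, x) - \sum_i h 0 i * Z i k (t, x).
  by rewrite E -sumrB; apply: eq_bigr => i _; rewrite mulrBr.
rewrite E2 in e3; move: e1 e2 e3.
have dE : e * `|h| = 8%:R * (d * `|h|) by rewrite /d; field.
rewrite dE (_ : 3%:R * (`|h| * (2 * d)) = 6%:R * (d * `|h|)); last by ring.
move: (d * `|h|) (F _) (F _) (Y k _) (Y k _) (\sum_i _) => c a1 a2 b1 b2 S.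
rewrite !ler_norml => /andP[? ?] /andP[? ?] /andP[? ?].
by apply/andP; split; lra.
Qed.

End ClosureProduct.

Section StepFunctions.
Context {R : realType}.
Implicit Types (Om : set 'rV[R]_3) (y : R -> 'rV[R]_3 -> 'rV[R]_6).

(* Step functions that take on [i h, (i + 1) h[ the value of y at i h. *)
Lemma Linfty_of_continuous Om (T : R) y : 0 < T ->
  (forall t, 0 <= t < T -> C1_on Om (y t)) -> continuous_C1loc Om T y ->
  (forall K : set 'rV[R]_3, compact K -> K `<=` Om ->
    exists M, forall t, 0 < t < T -> C1_le K (y t) M) ->
  Linfty_C1loc Om T y.
Proof.
move=> T0 yC1 yc yb K cK KO; split; last first.
  have [M HM] := yb K cK KO; exists M; apply: aeW => t; exact: HM.
pose h n : R := T / n.+1%:R.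
have h0 n : 0 < h n by rewrite divr_gt0.
pose A n (i : 'I_n.+1) : set (measurableTypeR R) := `[i%:R * h n, i.+1%:R * h n[%classic.
pose s n t x := \sum_(i < n.+1) (\1_(A n i) t : R) *: y (i%:R * h n) x.
have ih n (i : 'I_n.+1) : 0 <= i%:R * h n < T.
  rewrite mulr_ge0 ?(ltW (h0 n))//= /h mulrA ltr_pdivrMr ?ltr0n// mulrC ltr_pM2l//.
  by rewrite ltr_nat.
exists s; split.
  move=> n; exists n.+1, (A n), (fun i => y (i%:R * h n)); split => //.
  - by move=> i; exact: measurable_itv.
  - by move=> i; apply: yC1; exact: ih.
apply: aeW => t /andP[t0 tT] e e0.
have t0T : 0 <= t < T by rewrite (ltW t0).
have /nbhs_ballP[d /= d0 Hd] := yc K cK KO t t0T e e0.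
have [N HN] : exists N : nat, forall n, (N <= n)%N -> h n < d.
  exists (Num.bound (T / d)) => n Nn; rewrite /h ltr_pdivrMr ?ltr0n// mulrC -ltr_pdivrMr//.
  have Td : 0 <= T / d by rewrite divr_ge0// ltW.
  apply: (lt_le_trans (archi_boundP Td)); rewrite ler_nat.
  exact: leq_trans Nn (leqnSn n).
exists N => // n /= /HN hd.
pose k := Num.truncn (t / h n).
have k1 : k%:R * h n <= t < k.+1%:R * h n.
  rewrite -ler_pdivlMr// -ltr_pdivrMr//.
  by apply: truncn_itv; rewrite divr_ge0// ltW.
have kn : (k < n.+1)%N.
  rewrite -(ltr_nat R) -(ltr_pM2r (h0 n)) (le_lt_trans (andP k1).1)//.
  by rewrite /h mulrC divfK ?pnatr_eq0.
have sE : s n t = y (k%:R * h n).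
  apply/funext => x; rewrite /s (bigD1 (Ordinal kn))//= big1 ?addr0.
    have tA : t \in A n (Ordinal kn) by apply/mem_set; rewrite /A /= in_itv.
    by rewrite indicE tA scale1r.
  move=> i ik; rewrite indicE memNset ?scale0r//; rewrite /A /= in_itv/= => /andP[i1 i2].
  move/negP: ik; apply; apply/eqP/val_inj => /=; apply/eqP.
  case/andP: k1 => k1 k2.
  have ik : (i < k.+1)%N by rewrite -(ltr_nat R) -(ltr_pM2r (h0 n)) (le_lt_trans i1 k2).
  have ki : (k < i.+1)%N by rewrite -(ltr_nat R) -(ltr_pM2r (h0 n)) (le_lt_trans k1 i2).
  by rewrite eqn_leq -ltnS ik.
rewrite sE; apply: Hd; last first.
  by rewrite /= in_itv/=; exact: (ih n (Ordinal kn)).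
rewrite -ball_normE/=; case/andP: k1 => k1 k2.
rewrite ger0_norm ?subr_ge0//; apply: lt_trans hd.
by rewrite ltrBlDr (lt_le_trans k2)// -natr1 mulrDl mul1r addrC.
Qed.

End StepFunctions.

(** * Properties of the limit map *)

Section Wrinkled.
Context {R : realType}.
Notation V4 := (R * 'rV[R]_3)%type.
Context (T : R) (Om : set 'rV[R]_3) (gs : 'rV[R]_3 -> 'M[R]_3).
Hypothesis T0 : 0 < T.
Hypothesis oOm : open Om.
Hypothesis cOm : compact (closure Om).
Hypothesis gs_pos : forall x (h : 'rV[R]_3), h != 0 ->
  0 < \sum_i \sum_j h 0 i * h 0 j * gs x i j.
Context (Y : 'I_6 -> V4 -> R) (Z : 'I_3 -> 'I_6 -> V4 -> R).
Hypothesis YZ : C1_limit T Om Y Z.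
Hypothesis Zgs : forall z i j, cyl T Om z -> \sum_(k < 6) Z i k z * Z j k z = gs z.2 i j.
Hypothesis Ysep : forall rho, 0 < rho -> exists2 mu, 0 < mu & forall t x x',
  cyl T Om (t, x) -> cyl T Om (t, x') -> rho <= `|x' - x| ->
  exists k, mu <= `|Y k (t, x') - Y k (t, x)|.

Let yw := rowmap Y.

Lemma near_slice (t : R) (x : 'rV[R]_3) (P : V4 -> Prop) :
  (\forall w \near (t, x), P w) -> \forall w \near x, P (t, w).
Proof.
move=> [[A B] /= [nA nB] AB]; apply: filterS nB => w Bw; apply: AB; split => //=.
exact: nbhs_singleton nA.
Qed.

Lemma rowmap_partial (t : R) x i : 0 <= t <= T -> Om x -> partial i (yw t) x = \row_k Z i k (t, x).
Proof. by move=> tT Omx; have [_] := rowmap_diff oOm YZ tT Omx; apply. Qed.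

Lemma rowmap_C1_on (t : R) : 0 <= t <= T -> C1_on Om (yw t).
Proof.
move=> tT x Omx; have [dy _] := rowmap_diff oOm YZ tT Omx; split => // i.
apply/(@cvgrPdist_le _ _ _ (nbhs x) (nbhs_filter x)) => e e0.
have nZ : \forall w \near x, forall k, cyl T Om (t, w) -> `|Z i k (t, w) - Z i k (t, x)| <= e.
  apply: (@filter_forall _ _ _ _ (nbhs_filter x)) => k; apply: (near_slice (P := fun w => cyl T Om w -> `|Z i k w - Z i k (t, x)| <= e)).
  exact: (limit_near (limit_Z YZ i k) (cyl_in tT Omx) e0).
have nO : \forall w \near x, Om w by exact: open_nbhs_nbhs.
apply: (@filterS2 _ _ (nbhs_filter x) _ _ _ _ nZ nO) => w Hw Omw.
rewrite !rowmap_partial//; apply: rV_norm_le; first exact: ltW.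
by move=> k; rewrite !mxE distrC; apply: Hw; exact: cyl_in.
Qed.

Lemma rowmap_isometric (t : R) x : 0 <= t <= T -> Om x -> isometric_at (yw t) gs x.
Proof.
move=> tT Omx i j; rewrite !rowmap_partial//.
rewrite -(Zgs (z := (t, x)) i j); last exact: cyl_in.
by apply: eq_bigr => k _; rewrite !mxE.
Qed.

Lemma rowmap_row_free (t : R) x : 0 <= t <= T -> Om x -> row_free ('J (yw t) x).
Proof.
move=> tT Omx; have [dy _] := rowmap_diff oOm YZ tT Omx.
have JE i k : 'J (yw t) x i k = Z i k (t, x).
  have := rowmap_partial i tT Omx; rewrite /partial deriveEjacobian// -rowE => /rowP /(_ k).
  by rewrite !mxE.
have u : 'J (yw t) x *m ('J (yw t) x)^T \in unitmx.
  apply: unitmx_gram => h H; apply: contrapT => /eqP h0.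
  have := gs_pos x h0; suff -> : \sum_i \sum_j h 0 i * h 0 j * gs x i j = 0 by rewrite ltxx.
  rewrite -[RHS]H; under [RHS]eq_bigr do rewrite expr2 big_distrlr.
  rewrite [RHS]exchange_big; apply: eq_bigr => i _ /=.
  rewrite [RHS]exchange_big; apply: eq_bigr => j _ /=.
  rewrite -(Zgs (z := (t, x)) i j); last exact: cyl_in.
  by rewrite mulr_sumr; apply: eq_bigr => k _; rewrite !JE; ring.
apply/row_freeP; exists (('J (yw t) x)^T *m invmx ('J (yw t) x *m ('J (yw t) x)^T)).
by rewrite mulmxA mulmxV.
Qed.

(** Separation at every scale says that close images have close preimages. This gives injectivity
    and the continuity of the inverse at once. *)
Lemma rowmap_embedding (t : R) : 0 <= t <= T -> embedding_on Om (yw t).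
Proof.
move=> tT; split.
- by move=> x Omx; have [] := rowmap_diff oOm YZ tT Omx.
- by move=> x; exact: rowmap_row_free.
have far rho : 0 < rho -> exists2 mu, 0 < mu & forall x x', Om x -> Om x' ->
    `|yw t x' - yw t x| < mu -> `|x' - x| < rho.
  move=> rho0; have [mu mu0 H] := Ysep rho0; exists mu => // x x' Ox Ox' hlt.
  rewrite ltNge; apply/negP => hge.
  have [k hk] := H t x x' (cyl_in tT Ox) (cyl_in tT Ox') hge.
  have := ler_coord (yw t x' - yw t x) k; rewrite !mxE => h2.
  by have := lt_le_trans hlt (le_trans hk h2); rewrite ltxx.
pose h (w : 'rV[R]_6) : 'rV[R]_3 := if pselect (exists x, Om x /\ yw t x = w) is left e then projT1 (cid e) else 0.
have hK x : Om x -> Om (h (yw t x)) /\ yw t (h (yw t x)) = yw t x.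
  move=> Omx; rewrite /h; case: pselect => [e|[]]; last by exists x.
  by case: cid => x' [].
have hE x : Om x -> h (yw t x) = x.
  move=> Omx; have [Oh Eh] := hK x Omx.
  apply/eqP; rewrite -subr_eq0 -normr_eq0; apply: contraT => n0.
  have d0 : 0 < `|h (yw t x) - x| by rewrite lt_def n0 normr_ge0.
  have [mu mu0 H] := far _ d0.
  by have := H x (h (yw t x)) Omx Oh; rewrite Eh subrr normr0 ltxx => /(_ mu0).
exists h => //; apply/subspace_continuousP => w [x Omx <-].
apply/cvgrPdist_lt => rho rho0; have [mu mu0 H] := far _ rho0.
apply/nbhs_ballP; exists mu => // w' bw [x' Ox' E]; subst w'.
rewrite -[from_subspace _ _ (yw t x)]/(h _) -[from_subspace _ _ (yw t x')]/(h _) !hE//; apply: H => //.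
by move: bw; rewrite -ball_normE.
Qed.

Lemma subC1_le (f f' : 'rV[R]_3 -> 'rV[R]_6) (K : set 'rV[R]_3) M :
  (forall x, K x -> differentiable f x) -> (forall x, K x -> differentiable f' x) ->
  (forall x, K x -> `|f x - f' x| <= M /\ forall i, `|partial i f x - partial i f' x| <= M) ->
  C1_le K (f \- f') M.
Proof.
move=> df df' H x Kx; have [h1 h2] := H x Kx; split => // i.
have -> : partial i (f \- f') x = partial i f x - partial i f' x.
  by apply: deriveB; apply: diff_derivable; [exact: df|exact: df'].
exact: h2.
Qed.

Lemma rowmap_continuous : continuous_C1loc Om T yw.
Proof.
move=> K cK KO t0 t0T e e0.
have t0T' : 0 <= t0 <= T by case/andP: t0T => -> /ltW ->.
have nY : \forall t \near t0, forall k, 0 <= t <= T -> forall x, closure Om x -> `|Y k (t, x) - Y k (t0, x)| <= e.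
  exact: (@filter_forall _ _ _ _ (nbhs_filter t0) (fun k => limit_time cOm (limit_Y YZ k) t0T' e0)).
have nZ : \forall t \near t0, forall ik : 'I_3 * 'I_6, 0 <= t <= T -> forall x, closure Om x ->
    `|Z ik.1 ik.2 (t, x) - Z ik.1 ik.2 (t0, x)| <= e.
  exact: (@filter_forall _ _ _ _ (nbhs_filter t0) (fun ik : 'I_3 * 'I_6 => limit_time cOm (limit_Z YZ ik.1 ik.2) t0T' e0)).
suff : \forall t \near t0, `[0, T[%classic t -> C1_le K (yw t \- yw t0) e by [].
apply: (@filterS2 _ _ (nbhs_filter t0) _ _ _ _ nY nZ) => t HY HZ.
rewrite /= in_itv/= => /andP[ta tb].
have tT : 0 <= t <= T by rewrite ta ltW.
apply: subC1_le.
- by move=> x /KO Ox; have [] := rowmap_diff oOm YZ tT Ox.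
- by move=> x /KO Ox; have [] := rowmap_diff oOm YZ t0T' Ox.
move=> x /KO Ox; have Cx : closure Om x by exact: subset_closure.
split=> [|i]; first by apply: rV_norm_le; [exact: ltW|move=> k; rewrite !mxE; exact: HY].
rewrite !rowmap_partial//; apply: rV_norm_le; first exact: ltW.
by move=> k; rewrite !mxE; exact: (HZ (i, k)).
Qed.

Lemma rowmap_bounded : exists M, forall t x, 0 <= t <= T -> Om x ->
  `|yw t x| <= M /\ forall i, `|partial i (yw t) x| <= M.
Proof.
have /choice[MY HY] k : exists M, forall z, cyl T Om z -> `|Y k z| <= M.
  exact: (limit_bounded cOm (limit_Y YZ k)).
have /choice[MZ HZ] (ik : 'I_3 * 'I_6) : exists M, forall z, cyl T Om z -> `|Z ik.1 ik.2 z| <= M.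
  exact: (limit_bounded cOm (limit_Z YZ ik.1 ik.2)).
pose M := \sum_k `|MY k| + \sum_ik `|MZ ik|.
have M0 : 0 <= M by rewrite addr_ge0// sumr_ge0.
exists M => t x tT Ox; have Kx := cyl_in tT Ox; split => [|i].
  apply: rV_norm_le => // k; rewrite mxE; apply: (le_trans (HY k _ Kx)).
  apply: (le_trans (ler_norm _)); rewrite /M (bigD1 k)//= -addrA lerDl.
  by rewrite addr_ge0// sumr_ge0.
rewrite rowmap_partial//; apply: rV_norm_le => // k; rewrite mxE.
apply: (le_trans (HZ (i, k) _ Kx)); apply: (le_trans (ler_norm _)).
rewrite /M [X in _ + X](bigD1 (i, k))//= addrCA lerDl.
by rewrite addr_ge0// sumr_ge0.
Qed.

Lemma wrinkled_rowmap : wrinkled Om T gs yw.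
Proof.
have tT t : 0 <= t < T -> 0 <= t <= T by move=> /andP[-> /ltW ->].
split.
- move=> t /tT t0; split; [exact: rowmap_C1_on|exact: rowmap_embedding|].
  by move=> x; exact: rowmap_isometric.
- apply: Linfty_of_continuous => //; last 1 first.
  + move=> K cK KO; have [M HM] := rowmap_bounded; exists M => t /andP[t0 t1] x /KO Ox.
    by apply: HM => //; rewrite (ltW t0) ltW.
  + by move=> t /tT; exact: rowmap_C1_on.
  + exact: rowmap_continuous.
- exact: rowmap_continuous.
Qed.

End Wrinkled.

(** * The flow and the Couette metric *)

Section Components.
Context {R : realType}.

Lemma differentiable_component (V : normedModType R) n (F : V -> 'rV[R]_n) z k :
  differentiable F z -> differentiable (fun w => F w 0 k) z.
Proof.
move=> dF; apply: (@differentiable_comp _ _ _ _ F (fun h : 'rV[R]_n => h 0 k)) => //.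
exact: differentiable_coord.
Qed.

Lemma derive_component (V : normedModType R) n (F : V -> 'rV[R]_n) z v k :
  differentiable F z -> 'D_v (fun w => F w 0 k) z = 'D_v F z 0 k.
Proof. by move=> dF; rewrite derive_mx ?mxE//; exact: diff_derivable. Qed.

Lemma smooth_component (V : normedModType R) n (F : V -> 'rV[R]_n) (O : set V) k :
  open O -> (forall vs z, O z -> differentiable (iter_derive vs F) z) ->
  smooth O (fun z => F z 0 k).
Proof.
move=> oO + d; elim: d F => [|d IH] F HF.
  by split => // z Oz; apply: differentiable_component; exact: (HF [::]).
split; first by move=> z Oz; apply: differentiable_component; exact: (HF [::]).
move=> v; apply: (@Ck_ext _ _ d O (fun z => 'D_v F z 0 k)) => //.
  by move=> z Oz; rewrite derive_component//; exact: (HF [::]).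
(* [iter_derive] applies the last direction of the list first, so that the inner derivative along
   [v] is appended at the end. *)
apply: IH => vs z Oz; have := HF (rcons vs v) z Oz.
by rewrite /iter_derive foldr_rcons.
Qed.

Lemma smooth_scalar (V : normedModType R) (F : V -> R^o) (O : set V) :
  open O -> (forall vs z, O z -> differentiable (iter_derive vs F) z) ->
  smooth O (F : V -> R).
Proof.
move=> oO + d; elim: d F => [|d IH] F HF.
  by split => // z Oz; exact: (HF [::]).
split; first by move=> z Oz; exact: (HF [::]).
move=> v; apply: IH => vs z Oz; have := HF (rcons vs v) z Oz.
by rewrite /iter_derive foldr_rcons.
Qed.

Lemma dx_slice (F : R -> 'rV[R]_3 -> R) i t x :
  dx i (fun z => F z.1 z.2) (t, x) = partial i (F t) x.
Proof.
rewrite /dx /partial /derive; set d := (fun _ : R => _); set d' := (fun _ : R => _).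
suff -> : d = d' by []; apply/funext => h; rewrite /d /d' /=.
by rewrite scaler0 add0r.
Qed.

Lemma partial_component n (f : 'rV[R]_3 -> 'rV[R]_n) i x k : differentiable f x ->
  partial i f x 0 k = partial i (fun y => f y 0 k) x.
Proof. by move=> df; rewrite /partial derive_component. Qed.

Lemma quad_formE (A : 'M[R]_3) (v : 'rV[R]_3) :
  quad_form A v = \sum_i \sum_j v 0 i * v 0 j * A i j.
Proof.
transitivity (\sum_j (\sum_i v 0 i * A i j) * v 0 j).
  by rewrite /quad_form mxE; apply: eq_bigr => j _; rewrite [v^T _ _]mxE [(v *m A) _ _]mxE.
rewrite [RHS]exchange_big; apply: eq_bigr => j _ /=.
by rewrite mulr_suml; apply: eq_bigr => i _; ring.
Qed.

Definition row_of (h : 'I_3 -> R) : 'rV[R]_3 := \row_i h i.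

Lemma gstarE (V B : R) x i j : gstar V B x i j =
  (if i == j then B ^+ 2 else 0) + (if (i == j) && (i == i3) then couette_df V B (x 0 i3) ^+ 2 else 0).
Proof.
rewrite mxE; have [_|_] := eqVneq i j => /=; last by rewrite addr0.
by case: (i == i3); rewrite ?addr0.
Qed.

Lemma gstar_quad (V B : R) x (h : 'I_3 -> R) :
  \sum_i \sum_j h i * h j * gstar V B x i j =
  B ^+ 2 * (\sum_i h i ^+ 2) + (h i3 * couette_df V B (x 0 i3)) ^+ 2.
Proof.
transitivity (\sum_i (B ^+ 2 * h i ^+ 2 + (if i == i3 then (h i3 * couette_df V B (x 0 i3)) ^+ 2 else 0))).
  apply: eq_bigr => i _; rewrite (bigD1 i)//= big1 => [|j /negbTE ji]; last first.
    by rewrite gstarE [i == j]eq_sym ji add0r mulr0.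
  rewrite addr0 gstarE eqxx /=; case: eqP => [->|_]; last by rewrite !addr0; ring.
  by move: (couette_df _ _ _) => c; ring.
by rewrite big_split/= -mulr_sumr -big_mkcond big_pred1_eq.
Qed.

Lemma smooth_gstar (V B : R) (O : set (R * 'rV[R]_3)) i j : open O ->
  smooth O (fun z : R * 'rV[R]_3 => gstar V B z.2 i j).
Proof.
move=> oO; pose c : R := if i == j then B ^+ 2 else 0.
apply: (@smooth_ext _ _ _ (fun z : R * 'rV[R]_3 => c +
    (if (i == j) && (i == i3) then couette_df V B (z.2 0 i3) ^+ 2 else 0))) => //.
  by move=> z _; rewrite gstarE.
apply: smoothD => //; first exact: smooth_cst.
case: (_ && _); last exact: smooth_cst.
apply: smoothX => //; apply: smoothM => //; first exact: smooth_cst.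
apply: smooth_atan => //; apply: smoothN => //; apply: smoothM => //; first exact: smooth_cst.
by apply: smoothX => //; exact: smooth_coord2.
Qed.

End Components.

(** * Approximation of the geometric image *)

Section Existence.
Context {R : realType}.
Notation V4 := (R * 'rV[R]_3)%type.

(** Shortness is given for t < T and on the open set only, whereas the iteration runs on the compact
    cylinder. A strict failure at a limit point would spread to nearby points, where it is
    excluded. *)
Lemma cyl_dense (T : R) (Om : set 'rV[R]_3) (F : V4 -> R) (c : R) z : 0 < T ->
  {for z, continuous F} -> cyl T Om z ->
  (forall t x, 0 <= t < T -> Om x -> c <= F (t, x)) -> c <= F z.
Proof.
move=> Tpos; case: z => t0 x0 cF [/= t0T Cx] H.
rewrite leNgt; apply/negP => Fc.
have [[A B] /= [nA nB] AB] : \forall w \near (t0, x0), F w < c.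
  by move: Fc => /(cvgr_lt _ cF).
have [x [Omx Bx]] := Cx _ nB.
have [t [tT At]] : exists t, 0 <= t < T /\ A t.
  move: t0T; rewrite in_itv/= => /andP[t00 t0T].
  have /nbhs_ballP[e /= e0 He] := nA.
  (* A time near [t0] that is below [T] even for t0 = T and does not leave the interval at 0. *)
  exists (Num.max 0 (t0 - e / 2)); split.
    by rewrite le_max lexx gt_max Tpos/=; lra.
  apply: He; rewrite -ball_normE/= ltr_norml; apply/andP.
  by have [h|h] := leP 0 (t0 - e / 2); split; lra.
have := AB (t, x) (conj At Bx); rewrite /= ltNge => /negP; apply.
exact: H.
Qed.

Lemma image_gram (Rh : R -> 'rV[R]_3 -> @tensor4 R) (Om0 Om1 : set 'rV[R]_3)
  (T0 T : R) (x0 : 'rV[R]_3) (g : R -> 'rV[R]_3 -> 'M[R]_3)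
  (yg : R -> 'rV[R]_3 -> 'rV[R]_6) :
  geometric_image Rh Om0 T0 x0 g yg -> closure Om1 `<=` Om0 -> T < T0 ->
  let y k (z : V4) := yg z.1 z.2 0 k in
  exists O, [/\ open O, cyl T Om1 `<=` O, forall k, smooth O (y k) &
    forall z i j, cyl T Om1 z -> gram y i j z = g z.1 z.2 i j].
Proof.
move=> [_ _ _ [ O [oO OO dO]] emb iso] CO TT0 y.
have inK t x : cyl T Om1 (t, x) -> 0 <= t < T0 /\ Om0 x.
  move=> [/= + Cx]; rewrite in_itv/= => /andP[t0 tT]; split; last exact: CO.
  by rewrite t0 (le_lt_trans tT).
exists O; split => //.
- move=> [t x] Kz; have [tT Ox] := inK t x Kz; apply: OO; split; last exact: Ox.
  by rewrite /= in_itv.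
- by move=> k; exact: smooth_component.
move=> [t x] i j Kz; have [tT Ox] := inK t x Kz.
have dyE i' k : dx i' (y k) (t, x) = partial i' (yg t) x 0 k.
  rewrite (dx_slice (fun t x => yg t x 0 k)) partial_component//.
  by have [H _ _] := emb t tT; exact: H.
by rewrite -(iso t x tT Ox i j); apply: eq_bigr => k _; rewrite !dyE.
Qed.

Lemma approx_wrinkled (Rh : R -> 'rV[R]_3 -> @tensor4 R) (Om0 Om1 : set 'rV[R]_3)
  (T0 T : R) (x0 : 'rV[R]_3) (g : R -> 'rV[R]_3 -> 'M[R]_3)
  (yg : R -> 'rV[R]_3 -> 'rV[R]_6) (V B eps : R) :
  geometric_image Rh Om0 T0 x0 g yg -> open Om1 -> compact (closure Om1) ->
  closure Om1 `<=` Om0 -> 0 < T -> T < T0 -> 0 < B -> 0 < eps ->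
  (forall t x, 0 <= t < T -> Om1 x -> le_form (g t x) (gstar V B x)) ->
  exists yw, wrinkled Om1 T (gstar V B) yw /\
    forall t x, 0 <= t < T -> Om1 x -> `|yg t x - yw t x| <= eps.
Proof.
move=> image oOm cOm CO Tpos TT0 B0 eps0 short.
have [ O [oO KO sy gramE]] := image_gram image CO TT0.
move: image => [gpos _ _ _ emb _].
pose K : set V4 := cyl T Om1.
have cK : compact K by exact: cyl_compact.
have inK t x : K (t, x) -> 0 <= t < T0 /\ Om0 x.
  move=> [/= + Cx]; rewrite in_itv/= => /andP[t0 tT]; split; last exact: CO.
  by rewrite t0 (le_lt_trans tT).
pose y k (z : V4) := yg z.1 z.2 0 k.
have {}KO : K `<=` O by [].
have {}sy k : smooth O (y k) by exact: sy.
have {}gramE i j z : K z -> gram y i j z = g z.1 z.2 i j by exact: gramE.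
have [m m0 Hm] : exists2 m, 0 < m & forall z (h : 'rV[R]_3), K z ->
    m * `|h| ^+ 2 <= \sum_i \sum_j h 0 i * h 0 j * gram y i j z.
  apply: posdef_uniform => //.
    by move=> z i j Kz; apply: smooth_continuous (KO _ Kz); exact: smooth_gram.
  move=> [t x] h Kz h0; have [tT Ox] := inK t x Kz.
  have [_ /(_ h h0)] := gpos t x tT Ox; rewrite quad_formE; congr (_ < _).
  by apply: eq_bigr => i _; apply: eq_bigr => j _; rewrite gramE.
have [By By0 HBy] := family_bounded KO cK sy.
(* The contraction by 1 - del moves [y] by at most eps / 2, and the iteration spends the other half;
   del <= 1/2 keeps the factor positive. *)
pose del := Num.min (1 / 2) (eps / (2 * By)).
have del0 : 0 < del by rewrite lt_min !divr_gt0// mulr_gt0.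
have del2 : del <= 1 / 2 by rewrite ge_min lexx.
have delB : del * By <= eps / 2.
  have : del <= eps / (2 * By) by rewrite ge_min lexx orbT.
  by rewrite invfM mulrA ler_pdivlMr.
pose c := 1 - del.
have c0 : 0 < c by rewrite /c; lra.
have c1 : c ^+ 2 < 1 by rewrite expr_lt1 ?(ltW c0)// /c; lra.
pose y1 k (z : V4) := c * y k z.
have sy1 k : smooth O (y1 k) by apply: smoothM => //; exact: smooth_cst.
have dy1 i k z : O z -> dx i (y1 k) z = c * dx i (y k) z.
  by move=> Oz; rewrite dxZ//; exact: smooth_diff (sy k) Oz.
have gram1 i j z : O z -> gram y1 i j z = c ^+ 2 * gram y i j z.
  move=> Oz; rewrite /gram mulr_sumr; apply: eq_bigr => k _.
  by rewrite !dy1//; move: (dx _ _ _) (dx _ _ _) => a b; ring.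
pose gs i j (z : V4) := gstar V B z.2 i j.
have sgs i j : smooth O (gs i j) by exact: smooth_gstar.
pose D0 i j z := gs i j z - gram y1 i j z.
have sD0 i j : smooth O (D0 i j).
  by apply: smoothD => //; apply: smoothN => //; exact: smooth_gram.
(* From g <= gstar follows gstar - c^2 g >= (1 - c^2) gstar >= (1 - c^2) B^2, so that plain
   shortness becomes strict with a uniform constant. *)
pose m1 := (1 - c ^+ 2) * B ^+ 2.
have m10 : 0 < m1 by rewrite mulr_gt0 ?subr_gt0 ?exprn_gt0.
have D0pos h z : K z -> m1 * \sum_i h i ^+ 2 <= quad D0 h z.
  move=> Kz; apply: (cyl_dense Tpos _ Kz) => [|t x tT Ox].
    apply: smooth_continuous (KO _ Kz); apply: smooth_sum => // i _; apply: smooth_sum => // j _.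
    by apply: smoothM => //; exact: smooth_cst.
  have Kt : K (t, x) by apply: cyl_in => //; case/andP: tT => -> /ltW ->.
  have Ot := KO _ Kt.
  have := short t x tT Ox (row_of h); rewrite !quad_formE.
  under eq_bigr do under eq_bigr do rewrite !mxE.
  under [X in _ <= X -> _]eq_bigr do under eq_bigr do rewrite ![row_of _ _ _]mxE.
  move=> gle.
  have -> : quad D0 h (t, x) = \sum_i \sum_j h i * h j * gstar V B x i j -
      c ^+ 2 * \sum_i \sum_j h i * h j * g t x i j.
    rewrite /quad mulr_sumr -sumrB; apply: eq_bigr => i _.
    rewrite mulr_sumr -sumrB; apply: eq_bigr => j _.
    rewrite /D0 gram1// gramE// /gs /=; move: (gstar _ _ _ _ _) => v.
    by ring.
  have gsB : B ^+ 2 * (\sum_i h i ^+ 2) <= \sum_i \sum_j h i * h j * gstar V B x i j.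
    by rewrite gstar_quad lerDl sqr_ge0.
  move: gle gsB; move: (\sum_i \sum_j h i * h j * g t x i j) => u1.
  move: (\sum_i \sum_j h i * h j * gstar V B x i j) (\sum_i h i ^+ 2) => u2 u3 e1 e2.
  have c20 : 0 <= c ^+ 2 by exact: sqr_ge0.
  apply: (@le_trans _ _ ((1 - c ^+ 2) * u2)).
    by rewrite /m1 -mulrA ler_wpM2l// subr_ge0 ltW.
  by rewrite mulrBl mul1r lerD2l lerN2 ler_wpM2l.
have pD : posdef_on O K (finset.setTfor 'I_3) D0 m1.
  split; first exact: sD0.
  - move=> i j z Oz; rewrite /D0 gramC; congr (_ - _).
    by rewrite /gs !gstarE [j == i]eq_sym; have [->|] := eqVneq i j.
  - by move=> i j z _; rewrite inE.
  - move=> h z Kz; apply: le_trans (D0pos h z Kz); rewrite ler_pM2l//.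
    by rewrite le_eqVlt; apply/orP; left; apply/eqP; apply: eq_bigl => i; rewrite inE.
have [ O' [I [l [r [[oO' KO' O'O] span sr r0 HD]]]]] := decompose oO KO cK m10 pD.
have imm : immersion_bound K y1 (c ^+ 2 * m).
  move=> z h Kz; rewrite gram_quad -mulrA.
  apply: (@le_trans _ _ (c ^+ 2 * \sum_i \sum_j h 0 i * h 0 j * gram y i j z)).
    by rewrite ler_wpM2l ?sqr_ge0// Hm.
  rewrite mulr_sumr le_eqVlt; apply/orP; left; apply/eqP; apply: eq_bigr => i _.
  rewrite mulr_sumr; apply: eq_bigr => j _; rewrite gram1; last exact: KO.
  by ring.
have m20 : 0 < c ^+ 2 * m by rewrite mulr_gt0// exprn_gt0.
have y1sep : separated K y1.
  apply: (separated_immersion oO KO cOm sy1 m20 imm).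
  move=> t x x' Kx Kx' E; have [tT Ox] := inK t x Kx; have [_ Ox'] := inK t x' Kx'.
  have [_ _ [h hK _]] := emb t tT.
  rewrite -(hK x Ox) -(hK x' Ox'); congr h; apply/rowP => k.
  by have := E k; rewrite /y1 /y /= => /mulfI; apply; rewrite gt_eqF.
have st : short_map K gs l (c ^+ 2 * m) y1 r.
  exists O'; split => //.
  - by split => // k; exact: smooth_sub O'O (sy1 k).
  - by move=> z i j Oz; rewrite HD// /D0 addrCA subrr addr0.
have eps20 : 0 < eps / 2 by rewrite divr_gt0.
have [Y [Z [HYZ HZ HY Hsep]]] := short_map_limit cK span m20 eps20 st.
have gsp x (h : 'rV[R]_3) : h != 0 -> 0 < \sum_i \sum_j h 0 i * h 0 j * gstar V B x i j.
  move=> h0; rewrite (gstar_quad V B x (fun i => h 0 i)) ltr_wpDr ?sqr_ge0//.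
  rewrite mulr_gt0 ?exprn_gt0// lt_def sumr_ge0 ?andbT => [|i _]; last exact: sqr_ge0.
  apply: contra_neq h0 => /psumr_eq0P H; apply/rowP => i; rewrite mxE.
  by apply/eqP; rewrite -sqrf_eq0; apply/eqP; apply: H => // j _; exact: sqr_ge0.
exists (rowmap Y); split.
  exact: (wrinkled_rowmap Tpos oOm cOm gsp HYZ HZ Hsep).
move=> t x tT Ox; have Kx : K (t, x).
  by apply: cyl_in => //; case/andP: tT => -> /ltW ->.
apply: rV_norm_le; first exact: ltW.
move=> k; rewrite !mxE.
have h1 := HY k _ Kx; have h2 := HBy k _ Kx.
have -> : yg t x 0 k - Y k (t, x) = del * y k (t, x) + (y1 k (t, x) - Y k (t, x)).
  by rewrite /y1 /y /c /=; ring.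
rewrite (le_trans (ler_normD _ _))// [leRHS](splitr eps) lerD//.
rewrite normrM gtr0_norm//; apply: le_trans delB; exact: ler_wpM2l (ltW del0) _ _ h2.
Qed.

End Existence.

(** * Flatness of the Couette metric *)

Section Flatness.
Context {R : realType}.

Lemma partial_coord3 (phi : R -> R) i (x : 'rV[R]_3) :
  partial i (fun y : 'rV[R]_3 => phi (y 0 i3)) x =
  if i == i3 then 'D_1 phi (x 0 i3) else 0.
Proof.
rewrite /partial /derive; have [->|ii] := eqVneq i i3.
  set d := (fun _ : R => _); set d' := (fun _ : R => _).
  suff -> : d = d' by []; apply/funext => h; rewrite /d /d' /=.
  by rewrite !mxE !eqxx.
set d := (fun _ : R => _).
have -> : d = fun=> 0.
  apply/funext => h; rewrite /d /= !mxE eq_sym (negbTE ii) andbF mulr0 add0r subrr.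
  by rewrite scaler0.
exact: lim_cst.
Qed.

Lemma invmx_gstar (V B : R) (x : 'rV[R]_3) k l : 0 < B ->
  invmx (gstar V B x) k l = if k == l then
    (if k == i3 then (B ^+ 2 + couette_df V B (x 0 i3) ^+ 2)^-1 else (B ^+ 2)^-1) else 0.
Proof.
move=> B0; pose D : 'M[R]_3 := \matrix_(k, l) if k == l then
    (if k == i3 then (B ^+ 2 + couette_df V B (x 0 i3) ^+ 2)^-1 else (B ^+ 2)^-1) else 0.
have B20 : 0 < B ^+ 2 by rewrite exprn_gt0.
have AD : gstar V B x *m D = 1%:M.
  apply/matrixP => i j; rewrite mxE (bigD1 i)//= big1 ?addr0 => [|q /negbTE qi]; last first.
    by rewrite gstarE [i == q]eq_sym qi /= addr0 mul0r.
  rewrite gstarE eqxx /= !mxE; have [_|_] := eqVneq i j; last by rewrite mulr0.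
  case: eqP => [_|_]; first by rewrite divff// gt_eqF// ltr_wpDr// sqr_ge0.
  by rewrite addr0 divff// gt_eqF.
have uA : gstar V B x \in unitmx by have [] := mulmx1_unit AD.
by rewrite -[invmx _]mulmx1 -AD mulmxA mulVmx// mul1mx mxE.
Qed.

Lemma christoffel_gstar (V B : R) : 0 < B -> exists G : R -> R, forall k i j,
  christoffel (gstar V B) k i j =
  (fun x => if [&& k == i3, i == i3 & j == i3] then G (x 0 i3) else 0).
Proof.
move=> B0; pose phi s := B ^+ 2 + couette_df V B s ^+ 2.
exists (fun s => 2^-1 * ((phi s)^-1 * 'D_1 phi s)) => k i j; apply/funext => x.
have dg a b c : partial a (fun y => gstar V B y b c) x =
    if [&& a == i3, b == i3 & c == i3] then 'D_1 phi (x 0 i3) else 0.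
  pose c0 : R := if b == c then B ^+ 2 else 0.
  have -> : (fun y => gstar V B y b c) =
      (fun y => (if (b == i3) && (c == i3) then phi else (fun=> c0)) (y 0 i3)).
    apply/funext => y; rewrite gstarE /c0 /phi.
    have [->|bc] := eqVneq b c; first by rewrite andTb andbb; case: ifP; rewrite ?addr0.
    rewrite /= addr0; case: ifP => // /andP[/eqP b3 /eqP c3].
    by rewrite b3 c3 eqxx in bc.
  rewrite partial_coord3; case: (a == i3) => //=; case: (_ && _) => //.
  exact: derive_cst.
rewrite /christoffel; under eq_bigr do rewrite !dg.
have [i_3|ni] := boolP (i == i3); last first.
  rewrite !(andbF, andFb) big1 ?mulr0// => q _.
  by rewrite /= !(andbF) addr0 subr0 mulr0.
have [j_3|nj] := boolP (j == i3); last first.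
  rewrite !(andbF, andFb) big1 ?mulr0// => q _.
  by rewrite /= !(andbF) addr0 subr0 mulr0.
rewrite /= !andbT (bigD1 i3)//= big1 ?addr0 => [|q /negbTE ->]; last first.
  by rewrite /= addr0 subr0 mulr0.
rewrite addrK invmx_gstar//; by case: eqP => [_|_]; rewrite ?mul0r ?mulr0.
Qed.

(** The only Christoffel symbol that can be nonzero is Gamma_33^3, a function of x_3. A derivative
    term survives only if k, q, l, j are all 3, and then the two cancel; so do the quadratic
    terms. *)
Lemma Riem_gstar (V B : R) x : 0 < B -> Riem (gstar V B) x = fun _ _ _ _ => 0.
Proof.
move=> B0; have [G HG] := christoffel_gstar V B0.
apply/funext => i; apply/funext => j; apply/funext => k; apply/funext => l.
rewrite /Riem big1// => q _; rewrite !HG.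
have dG a b c d : partial a (fun x : 'rV[R]_3 => if [&& b == i3, c == i3 & d == i3] then G (x 0 i3) else 0) x
    = if [&& a == i3, b == i3, c == i3 & d == i3] then 'D_1 G (x 0 i3) else 0.
  have -> : (fun x : 'rV[R]_3 => if [&& b == i3, c == i3 & d == i3] then G (x 0 i3) else 0) =
      (fun x => (if [&& b == i3, c == i3 & d == i3] then G else (fun=> 0)) (x 0 i3)).
    by apply/funext => y; case: ifP.
  rewrite partial_coord3; case: (a == i3) => //=; case: [&& _, _ & _] => //.
  exact: derive_cst.
rewrite !dG [X in _ * (_ + X)]big1 ?addr0 => [|r _].
  rewrite (_ : [&& k == i3, q == i3, l == i3 & j == i3] = [&& l == i3, q == i3, k == i3 & j == i3]).
    by rewrite subrr mulr0.
  by case: (k == i3); case: (q == i3); case: (l == i3); case: (j == i3).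
rewrite !HG; case: (k == i3); case: (q == i3); case: (l == i3); case: (j == i3);
  by case: (r == i3); rewrite /= ?mul0r ?mulr0 ?subrr.
Qed.

End Flatness.

(** * Large B, and positivity of the curvature matrix for short times *)

Section TimeLocal.
Context {R : realType}.
Notation V4 := (R * 'rV[R]_3)%type.

Lemma sqr_norm_le_sum n (h : 'rV[R]_n) : `|h| ^+ 2 <= \sum_i h 0 i ^+ 2.
Proof.
have s0 : 0 <= \sum_i h 0 i ^+ 2 by apply: sumr_ge0 => i _; exact: sqr_ge0.
have : `|h| <= Num.sqrt (\sum_i h 0 i ^+ 2).
  apply: rV_norm_le; first exact: sqrtr_ge0.
  move=> i; rewrite -sqrtr_sqr ler_wsqrtr// (bigD1 i)//= lerDl.
  by apply: sumr_ge0 => j _; exact: sqr_ge0.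
by rewrite -ler_sqr ?nnegrE ?sqrtr_ge0// sqr_sqrtr.
Qed.

Lemma gstar_dominates (Rh : R -> 'rV[R]_3 -> @tensor4 R) (Om0 Om1 : set 'rV[R]_3)
  (T0 T V : R) (x0 : 'rV[R]_3) (g : R -> 'rV[R]_3 -> 'M[R]_3)
  (yg : R -> 'rV[R]_3 -> 'rV[R]_6) :
  geometric_image Rh Om0 T0 x0 g yg -> compact (closure Om1) ->
  closure Om1 `<=` Om0 -> T < T0 ->
  exists2 B0 : R, 0 < B0 & forall B, B0 <= B ->
    forall t x, 0 <= t < T -> Om1 x -> le_form (g t x) (gstar V B x).
Proof.
move=> image cOm CO TT0; have [ O [oO KO sy gramE]] := image_gram image CO TT0.
have [M M0 HM] := @family_bounded _ O (cyl T Om1) ('I_3 * 'I_3)%type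
  (fun ij => gram (fun k (z : V4) => yg z.1 z.2 0 k) ij.1 ij.2) KO (cyl_compact cOm)
  (fun ij => smooth_gram ij.1 ij.2 oO sy).
(* The nine entries of g are at most [M], so that g is at most 9 M |h|^2; the summand 1 makes B >=
   1, hence B^2 >= B >= 9 M. *)
exists (9%:R * M + 1); first by rewrite addr_gt0// mulr_gt0.
move=> B BM t x tT Ox h; have Kx : cyl T Om1 (t, x).
  by apply: cyl_in => //; case/andP: tT => -> /ltW ->.
rewrite !quad_formE; apply: (@le_trans _ _ (9%:R * M * `|h| ^+ 2)).
  apply: (le_trans (ler_norm _)); apply: quad3_bound => i j.
  by rewrite -(gramE (t, x) i j Kx); exact: (HM (i, j)).
rewrite (gstar_quad V B x (fun i => h 0 i)).
apply: (@le_trans _ _ (B ^+ 2 * \sum_i h 0 i ^+ 2)); last by rewrite lerDl sqr_ge0.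
have M9 : 0 <= 9%:R * M by rewrite mulr_ge0// ltW.
apply: ler_pM (sqr_norm_le_sum h) => //.
have B1 : 1 <= B by lra.
by rewrite expr2 (le_trans _ (_ : B * 1 <= _))// ?ler_pM2l//; lra.
Qed.

(** [Rh] is known only through pointwise relations. Rewriting its matrix in terms of the flux
    exhibits entries that are smooth in space-time. *)
Definition flux_mx (M : 'I_3 -> 'I_3 -> R) : 'M[R]_3 :=
  \matrix_(a, b) nth 0 (nth [::]
    [:: [:: M i3 i3; M i1 i3; - M i2 i3];
        [:: M i1 i3; M i1 i1; - M i1 i2];
        [:: - M i2 i3; - M i1 i2; M i2 i2]] a) b.

Lemma Rhat_flux gamma u p x (Q : @tensor4 R) : is_Rhat gamma u p x Q ->
  Rhat_mx Q = flux_mx (fun i j => momentum_flux gamma u p i j x).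
Proof.
move=> [_ [[e1 e2 e3] [e4 e5 e6]]]; apply/matrixP => a b; rewrite !mxE.
by rewrite e1 e2 e3 e4 e5 e6.
Qed.

Lemma tr_flux_mx M : (flux_mx M)^T = flux_mx M.
Proof.
by apply/matrixP => -[[|[|[|a]]] ha] [[|[|[|b]]] hb]; rewrite !mxE.
Qed.

(** Positivity at t = 0 is uniform on the compact closure of [Om1], and the entries are continuous
    in t uniformly in x: if all nine move by at most m / 18, the form changes by at most half of m
    |h|^2. *)
Lemma Rhat_posdef_local (V gamma Ts : R) (u : R -> 'rV[R]_3 -> 'rV[R]_3)
    (p : R -> 'rV[R]_3 -> R) (Rh : R -> 'rV[R]_3 -> @tensor4 R) (Om1 : set 'rV[R]_3) :
  0 < Ts -> ns_solution V gamma Ts u p ->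
  (forall t x, 0 <= t < Ts -> slab x -> is_Rhat gamma (u t) (p t) x (Rh t x)) ->
  (forall x, slab x -> posdef (Rhat_mx (Rh 0 x))) ->
  compact (closure Om1) -> closure Om1 `<=` slab ->
  exists2 tau : R, 0 < tau & forall t x, 0 <= t < tau -> Om1 x ->
    posdef (Rhat_mx (Rh t x)).
Proof.
move=> Ts0 flow RhE pos0 cOm Cslab.
have [ O1 [oO1 sO1 d1]] := ns_smooth_u flow.
have [ O2 [oO2 sO2 d2]] := ns_smooth_p flow.
pose O := O1 `&` O2; have oO : open O by exact: openI.
pose uz i (z : V4) := u z.1 z.2 0 i.
pose pz (z : V4) : R := p z.1 z.2.
have su i : smooth O (uz i).
  by apply: (@smooth_sub _ _ O1); [move=> z []|exact: smooth_component].
have sp : smooth O pz.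
  by apply: (@smooth_sub _ _ O2); [move=> z []|exact: smooth_scalar].
pose N i j z := uz i z * uz j z - (- (pz z *+ (i == j)) +
  2 * gamma * (2^-1 * (dx i (uz j) z + dx j (uz i) z))).
have sN i j : smooth O (N i j).
  apply: smoothD => //; first exact: smoothM.
  apply: smoothN => //; apply: smoothD => //.
    apply: smoothN => //; case: (i == j); last first.
      by apply: smooth_ext (smooth_cst O 0) => // z _; rewrite mulr0n.
    by apply: smooth_ext sp => // z _; rewrite mulr1n.
  apply: smoothM => //; first exact: smooth_cst.
  apply: smoothM => //; first exact: smooth_cst.
  by apply: smoothD => //; exact: smooth_dx.
have NE i j t x : N i j (t, x) = momentum_flux gamma (u t) (p t) i j x.
  rewrite /N /momentum_flux /stress /strain.
  by rewrite (dx_slice (fun t x => u t x 0 j)) (dx_slice (fun t x => u t x 0 i)).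
(* Compactness requires a closed time interval inside the half-open one of the flow. *)
pose T := Ts / 2; have T0 : 0 < T by rewrite divr_gt0.
have KO : cyl T Om1 `<=` O.
  have h z : cyl T Om1 z -> (`[0, Ts[%classic `*` slab) z.
    move=> [h1 h2]; split; last exact: Cslab.
    move: h1; rewrite /= !in_itv/= => /andP[-> /le_lt_trans]; apply.
    by rewrite /T; lra.
  by move=> z /h hz; split; [exact: sO1|exact: sO2].
pose F a b z : R := flux_mx (fun i j => N i j z) a b.
have sF a b : smooth O (F a b).
  have sP f i j : (forall z, f z = N i j z) -> smooth O f.
    by move=> fE; apply: (@smooth_ext _ _ _ (N i j)).
  have sM f i j : (forall z, f z = - N i j z) -> smooth O f.
    by move=> fE; apply: (@smooth_ext _ _ _ (fun z => - N i j z)) => //; exact: smoothN.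
  case: a b => [[|[|[|a]]] ha] [[|[|[|b]]] hb] //.
  - by apply: (sP _ i3 i3) => z; rewrite /F mxE.
  - by apply: (sP _ i1 i3) => z; rewrite /F mxE.
  - by apply: (sM _ i2 i3) => z; rewrite /F mxE.
  - by apply: (sP _ i1 i3) => z; rewrite /F mxE.
  - by apply: (sP _ i1 i1) => z; rewrite /F mxE.
  - by apply: (sM _ i1 i2) => z; rewrite /F mxE.
  - by apply: (sM _ i2 i3) => z; rewrite /F mxE.
  - by apply: (sM _ i1 i2) => z; rewrite /F mxE.
  - by apply: (sP _ i2 i2) => z; rewrite /F mxE.
have FE t x a b : 0 <= t < Ts -> slab x -> F a b (t, x) = Rhat_mx (Rh t x) a b.
  move=> tT sx; rewrite (Rhat_flux (RhE t x tT sx)) /F; congr (flux_mx _ _ _).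
  by apply/funext => i; apply/funext => j; exact: NE.
(* The cylinder of height 0 is the initial slice. *)
have K0O : cyl 0 Om1 `<=` O.
  move=> z [h1 h2]; apply: KO; split => //.
  by move: h1; rewrite /= !in_itv/= => /andP[-> /le_trans]; apply; exact: ltW.
have [m m0 Hm] : exists2 m, 0 < m & forall z (h : 'rV[R]_3), cyl 0 Om1 z ->
    m * `|h| ^+ 2 <= \sum_i \sum_j h 0 i * h 0 j * F i j z.
  apply: posdef_uniform; first exact: cyl_compact.
    by move=> z i j Kz; apply: smooth_continuous (K0O _ Kz).
  move=> [t x] h [/= + Cx] h0; rewrite in_itv/= => /le_anti t0; subst t.
  have [_ /(_ h h0)] := pos0 x (Cslab _ Cx); rewrite quad_formE; congr (_ < _).
  apply: eq_bigr => i _; apply: eq_bigr => j _; rewrite FE ?lexx//.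
  exact: Cslab.
have m18 : 0 < m / 18%:R by rewrite divr_gt0.
have T00 : 0 <= (0 : R) <= T by rewrite lexx ltW.
have near0 : forall ab : 'I_3 * 'I_3, \forall t \near (0 : R), 0 <= t <= T ->
    forall x, closure Om1 x -> `|F ab.1 ab.2 (t, x) - F ab.1 ab.2 (0, x)| <= m / 18%:R.
  move=> ab; apply: (limit_time cOm _ T00 m18) => e e0.
  exists (F ab.1 ab.2), O; split => // z _.
  by rewrite subrr normr0 ltW.
have /nbhs_ballP[d /= d0 Hd] := @filter_forall _ _ _ _ (nbhs_filter (0 : R)) near0.
exists (Num.min d T); first by rewrite lt_min d0.
move=> t x; rewrite lt_min => /and3P[t0 td tT] Ox.
have Cx : closure Om1 x by exact: subset_closure.
have tTs : 0 <= t < Ts by rewrite t0 (lt_trans tT)// /T; lra.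
have sx := Cslab _ Cx.
split; first by rewrite (Rhat_flux (RhE t x tTs sx)) tr_flux_mx.
move=> h h0; rewrite quad_formE.
have hn : 0 < `|h| ^+ 2 by rewrite exprn_gt0// normr_gt0.
have bt : ball (0 : R) d t by rewrite -ball_normE/= sub0r normrN ger0_norm.
have tT' : 0 <= t <= T by rewrite t0 ltW.
have K0 : cyl 0 Om1 (0, x) by split => //=; rewrite in_itv/= lexx.
have := quad3_bound h (fun i j => Hd t bt (i, j) tT' x Cx).
rewrite (_ : \sum_i \sum_j _ = \sum_i \sum_j h 0 i * h 0 j * F i j (t, x) -
   \sum_i \sum_j h 0 i * h 0 j * F i j (0, x)); last first.
  by rewrite -sumrB; apply: eq_bigr => i _; rewrite -sumrB; apply: eq_bigr => j _; rewrite mulrBr.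
have := Hm _ h K0; rewrite ler_norml => h1 /andP[h2 _].
rewrite (_ : \sum_i \sum_j _ = \sum_i \sum_j h 0 i * h 0 j * F i j (t, x)); last first.
  by apply: eq_bigr => i _; apply: eq_bigr => j _; rewrite FE.
have m2 : 0 < m * `|h| ^+ 2 by rewrite mulr_gt0.
move: h1 h2; rewrite (_ : 9%:R * (m / 18%:R) * `|h| ^+ 2 = m * `|h| ^+ 2 / 2); last by field.
move: (m * _) m2 (\sum_i _) (\sum_i _) => v v0 u1 u2; lra.
Qed.

End TimeLocal.

(** * Nonuniqueness and energy *)

Section Solutions.
Context {R : realType}.
Implicit Types (Om : set 'rV[R]_3) (f : 'rV[R]_3 -> 'rV[R]_6).

Lemma partial_translate i f c : partial i (fun x => f x + c) = partial i f.
Proof.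
apply/funext => x; rewrite /partial /derive.
set F := (fun h : R => _); set G := (fun h : R => _); suff -> : F = G by [].
by apply/funext => h; rewrite /F /G /= opprD addrACA subrr addr0.
Qed.

Lemma C1_on_translate Om f c : C1_on Om f -> C1_on Om (fun x => f x + c).
Proof.
move=> Hf x /Hf[df cf]; split; first exact: differentiableD.
by move=> i; rewrite partial_translate.
Qed.

Lemma C1_on_bounded Om f (K : set 'rV[R]_3) : C1_on Om f -> compact K ->
  K `<=` Om -> exists M, C1_le K f M.
Proof.
move=> Hf cK KO.
have bd (h : 'rV[R]_3 -> 'rV[R]_6) : (forall x, K x -> {for x, continuous h}) ->
    exists M, forall x, K x -> `|h x| <= M.
  move=> ch; have [|M _ HM] := @compact_continuous_bounded _ _ K (fun x => `|h x|) cK.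
    by move=> x Kx; apply: (continuous_comp (ch x Kx)); exact: norm_continuous.
  by exists M => x /HM; rewrite normr_id.
have [M0 H0] := bd f (fun x Kx => differentiable_continuous (Hf x (KO x Kx)).1).
have /choice[M HM] i := bd (partial i f) (fun x Kx => (Hf x (KO x Kx)).2 i).
exists (`|M0| + \sum_i `|M i|) => x Kx; split => [|i].
  by rewrite (le_trans (H0 x Kx))// (le_trans (ler_norm _))// lerDl sumr_ge0.
rewrite (le_trans (HM i x Kx))// (le_trans (ler_norm _))// (bigD1 i)//= addrCA lerDl.
by rewrite addr_ge0// sumr_ge0.
Qed.

(* No initial jump is forbidden, so every translate of the initial value gives
   a solution that is constant for positive times. *)
Lemma jump_solution Om T gs (y0 : 'rV[R]_3 -> 'rV[R]_6) (c : 'rV[R]_6) :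
  C1_on Om y0 -> (forall x, Om x -> isometric_at y0 gs x) ->
  ivp_solution Om T gs y0 (fun t x => y0 x + (if t == 0 then 0 else c)).
Proof.
move=> C0 iso0; set y := (fun t x => _).
have C1 : C1_on Om (fun x => y0 x + c) by exact: C1_on_translate.
have yE t : 0 < t < T -> y t = fun x => y0 x + c.
  by move=> /andP[t0 _]; apply/funext => x; rewrite /y gt_eqF.
split; last by move=> x _; rewrite /y eqxx addr0.
- move=> t tT; rewrite yE//; split => // x Ox i j.
  by rewrite !partial_translate; exact: iso0.
- move=> K cK KO; split; last first.
    have [M HM] := C1_on_bounded C1 cK KO; exists M; apply: aeW => t tT.
    by rewrite yE.
  exists (fun _ _ x => y0 x + c); split.
    move=> n; exists 1, (fun=> setT), (fun=> fun x => y0 x + c); split => //.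
    by move=> t x; rewrite big_ord1 indicT scale1r.
  apply: aeW => t tT e e0; exists 0 => // n _; rewrite yE// => x _.
  have -> : (fun x => y0 x + c) \- (fun x => y0 x + c) = cst 0.
    by apply/funext => z /=; rewrite subrr.
  rewrite normr0; split => [|i]; first exact: ltW.
  by rewrite /partial derive_cst normr0 ltW.
Qed.

Lemma infinite_solutions Om T gs (y0 : 'rV[R]_3 -> 'rV[R]_6) x0 : 0 < T -> Om x0 ->
  C1_on Om y0 -> (forall x, Om x -> isometric_at y0 gs x) ->
  infinite_set [set restrict_domain Om T y | y in [set y | ivp_solution Om T gs y0 y]].
Proof.
move=> T0 Ox0 C0 iso0.
pose y (n : nat) (t : R) x := y0 x + (if t == 0 then 0 else const_mx n%:R : 'rV[R]_6).
have sub : range (fun n => restrict_domain Om T (y n)) `<=`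
    [set restrict_domain Om T y | y in [set y | ivp_solution Om T gs y0 y]].
  by move=> _ [n _ <-]; exists (y n); first exact: (jump_solution T _ C0 iso0).
refine (sub_infinite_set sub _).
rewrite (eq_finite_set (inj_card_eq _)); first exact: infinite_nat.
(* All these solutions agree at t = 0; they are told apart at the positive time T / 2, where the
   translation is visible. *)
move=> n m _ _ /(congr1 (@^~ (T / 2, x0))); rewrite /restrict_domain !patchE.
rewrite mem_set; last first.
  by split => //=; rewrite in_itv/= divr_ge0 ?(ltW T0)//= ltr_pdivrMr//; lra.
rewrite /y /= gt_eqF ?divr_gt0// => /addrI /rowP /(_ ord0); rewrite !mxE => /eqP.
by rewrite eqr_nat => /eqP.
Qed.

End Solutions.

(** * The energy integral *)

Section Energy.
Context {R : realType}.

(* Unlike ge0_le_integral, no measurability is assumed: both sides are suprema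
   over simple functions. *)
Lemma ge0_le_integralT d (T : measurableType d) (mu : {measure set T -> \bar R})
  (f g : T -> \bar R) : (forall x, 0 <= f x)%E -> (forall x, f x <= g x)%E ->
  (\int[mu]_x f x <= \int[mu]_x g x)%E.
Proof.
move=> f0 fg; rewrite !ge0_integralTE//; last by move=> x; exact: le_trans (fg x).
apply: le_ereal_sup => _ [h hf <-]; exists h => // x.
exact: le_trans (hf x) (fg x).
Qed.

(** A bounded [Om] lies in a cube of finite measure, and the integrand extended by zero is dominated
    by a constant on that cube. *)
Lemma integral3_lty (Om : set 'rV[R]_3) (F : 'rV[R]_3 -> R) (r M : R) :
  (forall x, Om x -> `|x| <= r) -> (forall x, Om x -> 0 <= F x <= M) ->
  (integral3 Om F < +oo)%E.
Proof.
move=> Omr FM; rewrite /integral3 integral_mkcond.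
pose I : set R := `[- r, r]%classic; pose box : set (R * R * R) := (I `*` I) `*` I.
have mI : measurable (I : set (measurableTypeR R)) by exact: measurable_itv.
have mbox : measurable (box : set (measurableTypeR R * measurableTypeR R * measurableTypeR R)).
  by apply: measurableX => //; exact: measurableX.
have M0 a : (vec3 @^-1` Om) a -> 0 <= M by move=> /FM /andP[/le_trans]; apply.
(* For empty [Om] the constant [M] may be negative, hence its absolute value. *)
apply: (@le_lt_trans _ _ (\int[lebesgue3]_a (`|M|%:E * (\1_box a)%:E)))%E.
  apply: ge0_le_integralT => a; rewrite patchE.
    by case: ifPn => // /set_mem /FM /andP[]; rewrite lee_fin.
  case: ifPn => [/set_mem Oma|_]; last by rewrite -EFinM lee_fin mulr_ge0.
  have a_box : a \in box.
    apply/mem_set; have := Omr _ Oma; rewrite /box /I.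
    have co i : `|vec3 a 0 i| <= `|vec3 a| by exact: ler_coord.
    move=> xr; split; [split|] => /=; rewrite in_itv/= -ler_norml.
    - by have := le_trans (co i1) xr; rewrite mxE.
    - by have := le_trans (co i2) xr; rewrite mxE.
    - by have := le_trans (co i3) xr; rewrite mxE.
  rewrite indicE a_box -EFinM lee_fin mulr1.
  by have /andP[_ /le_trans] := FM _ Oma; apply; exact: ler_norm.
rewrite ge0_integralZl//; last by apply/measurable_EFinP; exact: measurable_indic.
have I_lty : (@lebesgue_measure R I < +oo)%E.
  by rewrite /I lebesgue_measure_itv/=; case: ifP => _; rewrite ?ltry// -EFinB ltry.
rewrite lte_mul_pinfty// integral_indic// setIT.
suff : (@lebesgue3 R box < +oo)%E by [].
have -> : @lebesgue3 R box = (@lebesgue_measure R I * @lebesgue_measure R I * @lebesgue_measure R I)%E.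
  rewrite -(product_measure1E _ _ mI mI); apply: product_measure1E => //.
  exact: measurableX.
have I_fin : (@lebesgue_measure R I \is a fin_num)%E by rewrite ge0_fin_numE// measure_ge0.
by rewrite lte_mul_pinfty ?mule_ge0 ?measure_ge0 ?fin_numM.
Qed.

Lemma energyE (Om : set 'rV[R]_3) y t gs :
  (forall x, Om x -> isometric_at (y t) gs x) ->
  energy Om y t = integral3 Om (fun x => \tr (gs x)).
Proof.
move=> iso; apply: eq_integral => a /set_mem Oma; congr (_%:E).
by apply: eq_bigr => i _; rewrite -(iso _ Oma).
Qed.

(** The variable entry is bounded because the arctangent stays below pi / 2 in absolute value,
    whatever x_3. *)
Lemma tr_gstar_lty (Om : set 'rV[R]_3) (V B : R) : compact (closure Om) ->
  (integral3 Om (fun x => \tr (gstar V B x)) < +oo)%E.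
Proof.
move=> cOm.
have trE x : \tr (gstar V B x) = B ^+ 2 *+ 3 + couette_df V B (x 0 i3) ^+ 2.
  by rewrite /mxtrace !big_ord_recl big_ord0 !mxE /= mulrS mulr2n; ring.
have [r _ Hr] : exists2 r, 0 < r & forall x, closure Om x -> `| `|x| | <= r.
  apply: compact_continuous_bounded => // x _.
  exact: norm_continuous.
apply: (@integral3_lty _ _ r (B ^+ 2 *+ 3 + B ^+ 2 * (pi / 2) ^+ 2)) => x Ox.
  by rewrite -normr_id; apply: Hr; exact: subset_closure.
rewrite trE addr_ge0 ?mulrn_wge0 ?sqr_ge0//= lerD2l /couette_df exprMn.
rewrite ler_wpM2l ?sqr_ge0// -ler_sqrt ?sqr_ge0// !sqrtr_sqr.
by rewrite [leRHS]ger0_norm ?divr_ge0 ?pi_ge0// ler_norml !ltW ?atan_ltpi2 ?atan_gtNpi2.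
Qed.
End Energy.

Theorem theorem7p1 (R : realType) (V gamma Ts : R)
    (u : R -> 'rV[R]_3 -> 'rV[R]_3) (p : R -> 'rV[R]_3 -> R)
    (Rh : R -> 'rV[R]_3 -> @tensor4 R)
    (Om0 : set 'rV[R]_3) (T0 : R) (x0 : 'rV[R]_3)
    (g : R -> 'rV[R]_3 -> 'M[R]_3) (yg : R -> 'rV[R]_3 -> 'rV[R]_6)
    (Om1 : set 'rV[R]_3) (T : R)
    (V_gt0 : 0 < V) (gamma_gt0 : 0 < gamma) (Ts_gt0 : 0 < Ts)
    (flow : ns_solution V gamma Ts u p)
    (p_gt0 : forall x, slab x -> 0 < p 0 x)
    (RhE : forall t x, 0 <= t < Ts -> slab x ->
       is_Rhat gamma (u t) (p t) x (Rh t x))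
    (Rh_posdef0 : forall x, slab x -> posdef (Rhat_mx (Rh 0 x)))
    (Om0_open : open Om0) (Om0_slab : Om0 `<=` slab) (T0_le : T0 <= Ts)
    (image : geometric_image Rh Om0 T0 x0 g yg)
    (Om1_open : open Om1) (Om1_compact : compact (closure Om1))
    (Om1_Om0 : closure Om1 `<=` Om0) (x0_Om1 : Om1 x0) (T_gt0 : 0 < T)
    (T_lt : T < T0) :
  (exists2 tau : R, 0 < tau & forall t x, 0 <= t < tau -> Om1 x ->
     posdef (Rhat_mx (Rh t x))) /\
  (exists2 B0 : R, 0 < B0 & forall B, B0 <= B ->
     forall t x, 0 <= t < T -> Om1 x -> le_form (g t x) (gstar V B x)) /\
  forall B : R, 0 < B ->
  (forall x, Riem (gstar V B) x = fun _ _ _ _ => 0) /\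
  ((forall t x, 0 <= t < T -> Om1 x -> le_form (g t x) (gstar V B x)) ->
   (forall eps : R, 0 < eps ->
      exists yw : R -> 'rV[R]_3 -> 'rV[R]_6,
        [/\ wrinkled Om1 T (gstar V B) yw,
            forall t x, 0 <= t < T -> Om1 x -> `|yg t x - yw t x| <= eps,
            forall t, 0 <= t < T ->
              energy Om1 yw t = integral3 Om1 (fun x => \tr (gstar V B x)) &
            (integral3 Om1 (fun x => \tr (gstar V B x)) < +oo)%E]) /\
   (forall yw : R -> 'rV[R]_3 -> 'rV[R]_6, wrinkled Om1 T (gstar V B) yw ->
      infinite_set [set restrict_domain Om1 T y | y in
        [set y | ivp_solution Om1 T (gstar V B) (yw 0) y]])).
Proof.
split; [|split].
- apply: (Rhat_posdef_local Ts_gt0 flow RhE Rh_posdef0 Om1_compact).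
  exact: subset_trans Om1_Om0 Om0_slab.
- exact: gstar_dominates image Om1_compact Om1_Om0 T_lt.
move=> B B_gt0; split=> [x|short]; first exact: Riem_gstar.
split=> [eps eps_gt0|yw [yw_iso _ _]]; last first.
  have [|C1 _ iso] := yw_iso 0; first by rewrite lexx.
  exact: infinite_solutions T_gt0 x0_Om1 C1 iso.
have [yw [Hyw close]] := approx_wrinkled image Om1_open Om1_compact Om1_Om0
  T_gt0 T_lt B_gt0 eps_gt0 short.
exists yw; split; [exact: Hyw|exact: close| |exact: tr_gstar_lty].
by move=> t tT; apply: energyE; have [/(_ t tT)[_ _ iso]] := Hyw.
Qed.
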